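(* Fix $(c_0,A_0)\in\mathcal{P}_1\cup\mathcal{P}_2$ with $A_0$ sufficiently large. Let $L_0$ be the period of $\varphi_{(c_0,A_0)}$. For $(c,A)\in\mathcal{O}$ let $\phi=(\varphi_{(c,A)},\varphi_{(c,A)})$. Then $\phi$ is orbitally stable in $X=H^1_{per}([0,L_0])\times H^1_{per}([0,L_0])$ by the periodic flow of $$\begin{cases}\partial_tu_1+\frac12\partial_x\left(u_2\log u_1^2+u_2\log u_2^2\right)+\partial_x^3u_1=0,\\ \partial_tu_2+\frac12\partial_x\left(u_1\log u_1^2+u_1\log u_2^2\right)+\partial_x^3u_2=0.\end{cases}$$
   Context: $\mathcal{P}_1=\{(c,A)\in\mathbb{R}^2:|A|<2e^{c/2-1}\}$ and $\mathcal{P}_2=\{(c,A)\in\mathbb{R}^2:|A|>2e^{c/2-1}\}$. The family $\varphi_{(c,A)}$ (known existence result): for fixed $(c_0,A_0)\in\mathcal{P}_1\cup\mathcal{P}_2$ there are an open neighborhood $\mathcal{O}$ of $(c_0,A_0)$ and a smooth family $(c,A)\in\mathcal{O}\mapsto\varphi_{(c,A)}\in H^2_{per}([0,L_0])$ of even $L_0$-periodic solutions of $$-\varphi''+c\varphi-\varphi\log\varphi^2+A=0,$$ where $L_0$ is the (minimal) period of $\varphi_{(c_0,A_0)}$, determined by the level curves of the energy of this ODE. If $A_0>0$ is sufficiently large then, taking $\mathcal{O}$ smaller if necessary, one may assume $\varphi_{(c,A)}>1$ for all $(c,A)\in\mathcal{O}$. ''$A_0$ sufficiently large'' refers to this situation,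 with $\mathcal{O}$ so chosen. $\phi$ is the profile of the traveling wave $\phi(x-ct)$ of the system. Standing assumption: the $L_0$-periodic Cauchy problem for the system is globally well-posed in $X$, and the system conserves its energy $E(u)=\int_0^{L_0}\{\frac12((\partial_xu_1)^2+(\partial_xu_2)^2)-R(u)\}dx$ with $R(u_1,u_2)=\frac12u_1u_2\log(u_1^2u_2^2)-u_1u_2$, its momentum $F(u)=\frac12\int_0^{L_0}(u_1^2+u_2^2)dx$ and its mass $M(u)=\int_0^{L_0}(u_1+u_2)dx$. Orbital stability: let $\rho(u,v)=\inf_{y\in\mathbb{R}}\|u-v(\cdot+y)\|_X$. $\phi$ is orbitally stable in $X$ by the periodic flow if for every $\varepsilon>0$ there is $\delta>0$ such that whenever $u_0\in X$ and $\|u_0-\phi\|_X<\delta$, the solution $u(t)$ with initial data $u_0$ exists globally and satisfies $\rho(u(t),\phi)<\varepsilon$ for all $t\ge0$. *)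

(* Defs.v *)
From HB Require Import structures.
From mathcomp Require Import all_boot all_order all_algebra.
From mathcomp Require Import all_classical all_reals all_analysis.

Set Implicit Arguments.
Unset Strict Implicit.
Unset Printing Implicit Defensive.

Import Order.TTheory GRing.Theory Num.Theory.
Import numFieldNormedType.Exports.

Local Open Scope classical_set_scope.
Local Open Scope ring_scope.

Section PeriodicSobolev.
Context {R : realType}.
Local Notation mu := (@lebesgue_measure R).
Implicit Types (L : R) (u v g psi : R -> R).

Definition periodic L u := forall x, u (x + L) = u x.

Definition is_min_period L u :=
  [/\ 0 < L, periodic L u & forall T, 0 < T -> periodic T u -> L <= T].

Definition int_per L u : R := \int[mu]_(x in `[0, L]) u x.

Definition test_fun L psi :=
  periodic L psi /\ forall n x, derivable (derive1n n psi) x 1.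

Definition L2per L : set (R -> R) := [set g |
  [/\ periodic L g, measurable_fun setT g &
      mu.-integrable `[0, L] (fun x => (g x ^+ 2)%:E)]].

Definition weak_derivative L u g :=
  forall psi, test_fun L psi ->
    int_per L (fun x => u x * derive1 psi x)
    = - int_per L (fun x => g x * psi x).

(* An element of H^1_per is represented by its unique continuous
   representative, so that equality of functions is equality in H^1_per. *)
Definition H1per L : set (R -> R) := [set u |
  [/\ periodic L u, continuous u &
      exists2 g, L2per L g & weak_derivative L u g]].

(* A chosen weak derivative. It is determined only up to a null set, and is
   only ever used under an integral or a further weak derivative. *)
Definition wderiv L u : R -> R :=
  get [set g | L2per L g /\ weak_derivative L u g].

Definition H1norm L u : R :=
  Num.sqrt (int_per L (fun x => u x ^+ 2)
            + int_per L (fun x => wderiv L u x ^+ 2)).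

Definition H2per L : set (R -> R) := [set u |
  H1per L u /\ exists2 g, H1per L g & weak_derivative L u g].

Definition H2norm L u : R :=
  Num.sqrt (int_per L (fun x => u x ^+ 2)
            + int_per L (fun x => wderiv L u x ^+ 2)
            + int_per L (fun x => wderiv L (wderiv L u) x ^+ 2)).

End PeriodicSobolev.

Section WaveFamily.
Context {R : realType}.
Implicit Types (L c A : R) (f : R -> R) (O : set (R * R)).
Implicit Types (phi F G : R * R -> R -> R).

Definition P1 : set (R * R) :=
  [set p | `|p.2| < 2 * expR (p.1 / 2 - 1)].

Definition P2 : set (R * R) :=
  [set p | 2 * expR (p.1 / 2 - 1) < `|p.2|].

(* Since [ln 0 = 0], the term [f log f^2] vanishes where [f] does, as its
   continuous extension should. *)
Definition wave_equation c A f := forall x,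
  [/\ derivable f x 1, derivable (derive1 f) x 1 &
      - derive1n 2 f x + c * f x - f x * ln (f x ^+ 2) + A = 0].

Definition H2_continuous L O F := forall p, O p ->
  H2norm L (F q - F p) @[q --> p] --> (0 : R).

Definition H2_partial1 L O F G := forall p, O p ->
  H2norm L (fun x => h^-1 * (F (p.1 + h, p.2) x - F p x) - G p x)
    @[h --> 0^'] --> (0 : R).

Definition H2_partial2 L O F G := forall p, O p ->
  H2norm L (fun x => h^-1 * (F (p.1, p.2 + h) x - F p x) - G p x)
    @[h --> 0^'] --> (0 : R).

(* [phi] is C^infinity from the open set [O] to H^2_per: it has continuous
   partial derivatives [D i j = d_c^i d_A^j phi] of all orders, the limits
   being taken in H^2_per. *)
Definition H2_smooth L O phi :=
  exists D : nat -> nat -> R * R -> R -> R,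
    (forall p, O p -> D 0%N 0%N p = phi p) /\
    forall i j,
      [/\ forall p, O p -> H2per L (D i j p),
          H2_continuous L O (D i j),
          H2_partial1 L O (D i j) (D i.+1 j) &
          H2_partial2 L O (D i j) (D i j.+1)].

Record wave_family c0 A0 L0 O phi : Prop := WaveFamily {
  wf_open : open O;
  wf_base : O (c0, A0);
  wf_smooth : H2_smooth L0 O phi;
  wf_even : forall p, O p -> forall x, phi p (- x) = phi p x;
  (* all orbits of the family lie on level curves of the same period [L0] *)
  wf_period : forall p, O p -> is_min_period L0 (phi p);
  wf_equation : forall c A, O (c, A) -> wave_equation c A (phi (c, A))
}.

End WaveFamily.

Section LogKdVSystem.
Context {R : realType}.
Local Notation mu := (@lebesgue_measure R).
Local Notation X := ((R -> R) * (R -> R))%type.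
Implicit Types (L : R) (w : X) (u : R -> X).

Definition Xper L : set X := [set w | H1per L w.1 /\ H1per L w.2].

Definition Xnorm L w : R :=
  Num.sqrt (H1norm L w.1 ^+ 2 + H1norm L w.2 ^+ 2).

Definition translate (y : R) w : X :=
  (fun x => w.1 (x + y), fun x => w.2 (x + y)).

Definition rho L w w' : R :=
  inf [set Xnorm L (w - translate y w') | y in [set: R]].

(* [flux u1 u2] and [flux u2 u1] are the nonlinearities of the first and
   second equation. *)
Definition flux (a b : R) : R := b * ln (a ^+ 2) + b * ln (b ^+ 2).

(* Distributional form, integrated in time, of
     d_t v + 1/2 d_x (flux v z) + d_x^3 v = 0
   for [t >= 0]. Since [log v^2] is unbounded where [v] vanishes while [z] does
   not, local integrability of the nonlinearity is part of the notion of
   solution. *)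
Definition weak_equation L (v z : R -> R -> R) :=
  (forall T, 0 < T ->
     (mu \x mu)%E.-integrable (`[0, T] `*` `[0, L])
       (fun q : R * R => (flux (v q.1 q.2) (z q.1 q.2))%:E)) /\
  (forall psi, test_fun L psi -> forall t, 0 <= t ->
     int_per L (fun x => v t x * psi x) - int_per L (fun x => v 0 x * psi x)
     = \int[mu]_(s in `[0, t]) int_per L (fun x =>
         2^-1 * flux (v s x) (z s x) * derive1 psi x
         + v s x * derive1n 3 psi x)).

Record solution L w0 u : Prop := Solution {
  sol_mem : forall t, 0 <= t -> Xper L (u t);
  sol_init : u 0 = w0;
  sol_continuous : forall t, 0 <= t ->
    Xnorm L (u s - u t) @[s --> within [set s | 0 <= s] (nbhs t)] --> (0 : R);
  sol_eq1 : weak_equation L (fun t => (u t).1) (fun t => (u t).2);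
  sol_eq2 : weak_equation L (fun t => (u t).2) (fun t => (u t).1)
}.

Record globally_well_posed L : Prop := GloballyWellPosed {
  gwp_existence : forall w0, Xper L w0 -> exists u, solution L w0 u;
  gwp_uniqueness : forall w0 u u', solution L w0 u -> solution L w0 u' ->
    forall t, 0 <= t -> u t = u' t;
  gwp_dependence : forall w0 u, solution L w0 u -> forall T, 0 < T ->
    forall e, 0 < e -> exists2 d, 0 < d & forall w0' u', solution L w0' u' ->
      Xnorm L (w0' - w0) < d ->
      forall t, 0 <= t <= T -> Xnorm L (u' t - u t) < e
}.

Definition potential (a b : R) : R :=
  2^-1 * a * b * ln (a ^+ 2 * b ^+ 2) - a * b.

Definition energy L w : R := int_per L (fun x =>
  2^-1 * (wderiv L w.1 x ^+ 2 + wderiv L w.2 x ^+ 2)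
  - potential (w.1 x) (w.2 x)).

Definition momentum L w : R :=
  2^-1 * int_per L (fun x => w.1 x ^+ 2 + w.2 x ^+ 2).

Definition mass L w : R := int_per L (fun x => w.1 x + w.2 x).

Definition conserved L (Q : X -> R) := forall w0 u, solution L w0 u ->
  forall t, 0 <= t -> Q (u t) = Q w0.

Definition orbitally_stable L w := forall e, 0 < e ->
  exists2 d, 0 < d & forall w0, Xper L w0 -> Xnorm L (w0 - w) < d ->
    (exists u, solution L w0 u) /\
    forall u, solution L w0 u -> forall t, 0 <= t -> rho L (u t) w < e.

End LogKdVSystem.

(* Main.v *)
Require Import Defs.
From HB Require Import structures.
From mathcomp Require Import all_boot all_order all_algebra.
From mathcomp Require Import all_classical all_reals all_analysis.
From mathcomp Require Import ring lra.

(** The wave is a critical point of [energy + c * momentum + A * mass], a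
    conserved quantity, and the second variation of this functional at the wave
    splits. For a perturbation with symmetric part [P = (u_1 + u_2) / 2 - phi]
    and antisymmetric part [D = (u_1 - u_2) / 2] it is, up to a cubic remainder,
    the sum of
      [itg (P' ^ 2 - (ln (phi ^ 2) + 2 - c) * P ^ 2)] and
      [itg (D' ^ 2 + (c + ln (phi ^ 2)) * D ^ 2)]
    ([lyapunov_expand]). Stability follows once both forms are coercive modulo
    what the flow controls: the means of [u_1] and [u_2], which are conserved
    separately, the momentum, which fixes the integral of [P * phi] up to a
    quadratic error, and translations, which are used to impose one zero of [P].

    The symmetric form ([form_coercive]). Its kernel contains [phi'], and it has a
    negative direction, so the constraints are essential. Instead of a spectral
    argument, the square is completed on each half period between two extrema of
    the wave: away from the extrema
      [P' ^ 2 - f' (phi) * P ^ 2 = (P' - (phi'' * P + r) / phi') ^ 2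
         - 2 * P * r' (phi) - r ^ 2 / phi' ^ 2 + d/dx (...)],
    where [f] is [force] and [r] is a quadratic polynomial in [phi] chosen to
    cancel the singularities at the extrema. The term in [r'] only involves the
    two constraints, as [r'] is affine. The term in [r ^ 2] has the wrong sign,
    but for a harmonic oscillator it is an exact derivative minus a positive
    quadratic form in the boundary values of [P] ([barrier_deriv]). The wave is
    compared with an oscillator that has the same turning points and the same
    forces there; by Hermite interpolation, using that the third derivative
    [- 2 / s ^ 2] of the force is negative, the wave is the faster one
    ([kinetic_compare]), and this makes all remaining terms positive.

    The antisymmetric form ([form2_coercive]). Its potential is positive if
    [1 <= c]. Otherwise, since [ln (phi ^ 2) > 0], a Sturm comparison for [phi']
    shows that half a period is shorter than [pi / sqrt (2 - c)], and a Wirtinger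
    inequality applies to functions of mean zero.

    Both estimates are proved for continuously differentiable functions and
    extended to the Sobolev class by convolution with trigonometric kernels
    ([sobolev_form_ge0]). The weak derivative that enters the energy is only
    determined almost everywhere; that its integrals do not depend on the choice
    is [sobolev_unique].

    Finally, [modulation] chooses the translate for which [P] vanishes at a
    quarter of the period, [drift_lower] bounds the perturbation by the change of
    the conserved quantities, and a continuity argument in time gives
    [half_wave_stable]. An even wave of minimal period [L0] does reduce to a
    monotone half wave ([even_profile_half_wave]). *)

Import Order.TTheory GRing.Theory Num.Theory.
Import numFieldNormedType.Exports.

Local Open Scope classical_set_scope.
Local Open Scope ring_scope.

Set Implicit Arguments.
Unset Strict Implicit.
Unset Printing Implicit Defensive.

(** * Calculus on segments *)

Section Calculus.
Context {R : realType}.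
Implicit Types (f g F G : R -> R) (x y a b c k l : R).
Local Notation mu := (@lebesgue_measure R).

(** A plain proposition, so that derivatives are built by syntax-directed
    rules on lambda terms instead of by instance resolution. *)
Definition has_deriv f x a : Prop := is_derive x 1 f a.

Lemma der_cst c x : has_deriv (fun _ : R => c) x 0.
Proof. exact: is_derive_cst. Qed.

Lemma der_id x : has_deriv (fun y : R => y) x 1.
Proof. exact: is_derive_id. Qed.

Lemma der_add f g x a b : has_deriv f x a -> has_deriv g x b ->
  has_deriv (fun y => f y + g y) x (a + b).
Proof. exact: is_deriveD. Qed.

Lemma der_opp f x a : has_deriv f x a -> has_deriv (fun y => - f y) x (- a).
Proof. exact: is_deriveN. Qed.

Lemma der_mul f g x a b : has_deriv f x a -> has_deriv g x b ->
  has_deriv (fun y => f y * g y) x (f x * b + g x * a).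
Proof. exact: is_deriveM. Qed.

Lemma der_exp f n x a : has_deriv f x a ->
  has_deriv (fun y => f y ^+ n) x (n%:R * f x ^+ n.-1 * a).
Proof.
by move=> fa; have := is_deriveX n fa; rewrite (_ : f ^+ n = (fun y => f y ^+ n)) //;
  apply/funext => y; rewrite fctE.
Qed.

Lemma der_inv f x a : f x != 0 -> has_deriv f x a ->
  has_deriv (fun y => (f y)^-1) x (- a / f x ^+ 2).
Proof.
move=> f0 fa; apply: is_derive_eq (is_deriveV f0 fa) _.
by rewrite /GRing.scale /=; field.
Qed.

Lemma der_comp F f x a b : has_deriv F (f x) b -> has_deriv f x a ->
  has_deriv (fun y => F (f y)) x (a * b).
Proof. by move=> dF df; rewrite mulrC; exact: (is_derive1_comp dF df). Qed.

Lemma der_eq f x a b : has_deriv f x a -> a = b -> has_deriv f x b.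
Proof. by move=> ? <-. Qed.

Lemma der_continuous f x a : has_deriv f x a -> {for x, continuous f}.
Proof.
by move=> [df _]; apply/differentiable_continuous/derivable1_diffP.
Qed.

Lemma der_derive1 f x a : has_deriv f x a -> derive1 f x = a.
Proof. by move=> [_ <-]; rewrite derive1E. Qed.

Lemma der_unique f x a b : has_deriv f x a -> has_deriv f x b -> a = b.
Proof. by move=> /der_derive1 <- /der_derive1 <-. Qed.

Lemma der_of_derivable f x : derivable f x 1 -> has_deriv f x (derive1 f x).
Proof. by move=> df; rewrite derive1E; exact: derivableP. Qed.

Lemma cont_add f g : continuous f -> continuous g ->
  continuous (fun x => f x + g x).
Proof. by move=> cf cg x; apply: cvgD; [exact: cf|exact: cg]. Qed.

Lemma cont_opp f : continuous f -> continuous (fun x => - f x).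
Proof. by move=> cf x; apply: cvgN; exact: cf. Qed.

Lemma cont_mul f g : continuous f -> continuous g ->
  continuous (fun x => f x * g x).
Proof. by move=> cf cg x; apply: cvgM; [exact: cf|exact: cg]. Qed.

Lemma cont_exp f n : continuous f -> continuous (fun x => f x ^+ n).
Proof.
by move=> cf x; apply: (@continuous_comp _ _ _ f (fun y => y ^+ n));
  [exact: cf|exact: exprn_continuous].
Qed.

Lemma cont_cst c : continuous (fun _ : R => c).
Proof. by move=> x; exact: cvg_cst. Qed.

Lemma cont_id : continuous (fun x : R => x).
Proof. by move=> x; exact: cvg_id. Qed.

Lemma cont_comp F f : continuous F -> continuous f ->
  continuous (fun x => F (f x)).
Proof. by move=> cF cf x; apply: continuous_comp; [exact: cf|exact: cF]. Qed.

Lemma cont_norm f : continuous f -> continuous (fun x => `|f x|).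
Proof. by move=> cf x; apply: cvg_norm; exact: cf. Qed.

Lemma cont_der f g : (forall x, has_deriv f x (g x)) -> continuous f.
Proof. by move=> df x; exact: der_continuous (df x). Qed.

End Calculus.

Ltac der_step :=
  lazymatch goal with
  | |- has_deriv (fun _ => ?c) _ _ => apply: der_cst
  | |- has_deriv (fun x => x) _ _ => apply: der_id
  | |- has_deriv (fun x => @?f x + @?g x) _ _ => apply: (@der_add _ f g)
  | |- has_deriv (fun x => - (@?f x)) _ _ => apply: (@der_opp _ f)
  | |- has_deriv (fun x => @?f x * @?g x) _ _ => apply: (@der_mul _ f g)
  | |- has_deriv (fun x => (@?f x) ^+ ?n) _ _ => apply: (@der_exp _ f n)
  | |- has_deriv (fun x => (@?f x)^-1) _ _ => apply: (@der_inv _ f)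
  | |- has_deriv (fun x => sin (@?f x)) _ _ => apply: (@der_comp _ sin f)
  | |- has_deriv (fun x => cos (@?f x)) _ _ => apply: (@der_comp _ cos f)
  | |- has_deriv (fun x => ln (@?f x)) _ _ => apply: (@der_comp _ (@ln _) f)
  | |- has_deriv (fun x => expR (@?f x)) _ _ => apply: (@der_comp _ expR f)
  | |- has_deriv sin _ _ => apply: is_derive_sin
  | |- has_deriv cos _ _ => apply: is_derive_cos
  | |- has_deriv expR _ _ => apply: is_derive_expR
  | |- has_deriv (fun x => ?F (@?f x)) _ _ => apply: (@der_comp _ F f)
  end.
Ltac der := repeat first [match goal with H : _ |- _ => apply: H end | der_step].

Ltac cont_rule :=
  lazymatch goal with
  | |- continuous cos => apply: continuous_cos
  | |- continuous sin => apply: continuous_sin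
  | |- continuous (fun _ => ?c) => apply: cont_cst
  | |- continuous (fun x => x) => apply: cont_id
  | |- continuous (fun x => @?f x + @?g x) => apply: (@cont_add _ f g)
  | |- continuous (fun x => - (@?f x)) => apply: (@cont_opp _ f)
  | |- continuous (fun x => @?f x * @?g x) => apply: (@cont_mul _ f g)
  | |- continuous (fun x => (@?f x) ^+ ?n) => apply: (@cont_exp _ f n)
  | |- continuous (fun x => `|@?f x|) => apply: (@cont_norm _ f)
  | |- continuous (fun x => cos (@?f x)) => apply: (@cont_comp _ cos f)
  | |- continuous (fun x => sin (@?f x)) => apply: (@cont_comp _ sin f)
  end.
Ltac cont_comp_rule :=
  lazymatch goal with
  | |- continuous (fun x => ?F (@?f x)) => apply: (@cont_comp _ F f)
  end.
Ltac cont := repeat first [cont_rule | assumption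
  | match goal with H : _ |- _ => apply: H end | cont_comp_rule].

Section Integrals.
Context {R : realType}.
Implicit Types (f g F G : R -> R) (x y a b c k l : R).
Local Notation mu := (@lebesgue_measure R).

Definition itg a b f : R := \int[mu]_(x in `[a, b]) f x.
Definition itgable a b f := mu.-integrable `[a, b] (EFin \o f).

Lemma int_perE L f : int_per L f = itg 0 L f.
Proof. by []. Qed.

Lemma cont_itgable a b f : continuous f -> itgable a b f.
Proof.
move=> cf; apply: continuous_compact_integrable; first exact: segment_compact.
exact: continuous_subspaceT.
Qed.

Lemma eq_itg a b f g : (forall x, a <= x <= b -> f x = g x) ->
  itg a b f = itg a b g.
Proof.
by move=> fg; apply: eq_Rintegral => x; rewrite inE /= in_itv /=; exact: fg.
Qed.

Lemma itgableD a b f g : itgable a b f -> itgable a b g ->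
  itgable a b (fun x => f x + g x).
Proof. by move=> fi gi; exact: (integrableD _ fi gi). Qed.

Lemma itgableZ a b f k : itgable a b f -> itgable a b (fun x => k * f x).
Proof. by move=> fi; exact: (integrableZl _ k fi). Qed.

Lemma itgableN a b f : itgable a b f -> itgable a b (fun x => - f x).
Proof.
move=> fi; move: (itgableZ (-1) fi); rewrite (_ : (fun x => -1 * f x) = (fun x => - f x)) //.
by apply/funext => x; rewrite mulN1r.
Qed.

Lemma itgableB a b f g : itgable a b f -> itgable a b g ->
  itgable a b (fun x => f x - g x).
Proof. by move=> fi gi; apply: itgableD => //; exact: itgableN. Qed.

Lemma itgD a b f g : itgable a b f -> itgable a b g ->
  itg a b (fun x => f x + g x) = itg a b f + itg a b g.
Proof. by move=> fi gi; exact: RintegralD. Qed.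

Lemma itgZ a b f k : itgable a b f ->
  itg a b (fun x => k * f x) = k * itg a b f.
Proof. by move=> fi; exact: RintegralZl. Qed.

Lemma itgN a b f : itgable a b f -> itg a b (fun x => - f x) = - itg a b f.
Proof.
move=> fi; rewrite -mulN1r -itgZ //.
by apply: eq_itg => x _; rewrite mulN1r.
Qed.

Lemma itgB a b f g : itgable a b f -> itgable a b g ->
  itg a b (fun x => f x - g x) = itg a b f - itg a b g.
Proof.
by move=> fi gi; rewrite itgD ?itgN //; exact: itgableN.
Qed.

Lemma le_itg a b f g : itgable a b f -> itgable a b g ->
  (forall x, a <= x <= b -> f x <= g x) -> itg a b f <= itg a b g.
Proof.
by move=> fi gi fg; apply: le_Rintegral.
Qed.

Lemma itg_ge0 a b f : (forall x, a <= x <= b -> 0 <= f x) -> 0 <= itg a b f.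
Proof.
by move=> f0; apply: Rintegral_ge0 => x /=; rewrite in_itv /=; exact: f0.
Qed.

Lemma itg_cst a b c : a <= b -> itg a b (fun _ => c) = c * (b - a).
Proof.
move=> ab; rewrite /itg Rintegral_cst //= lebesgue_measure_itv /= lte_fin.
case: ltP => [_|ba]; first by [].
by rewrite (_ : b = a) ?subrr //; apply/eqP; rewrite eq_le ba ab.
Qed.

Lemma itg_der a b F f : a <= b -> continuous f ->
  (forall x, a <= x <= b -> has_deriv F x (f x)) -> itg a b f = F b - F a.
Proof.
rewrite le_eqVlt => /predU1P[-> _ _|ab cf dF].
  by rewrite /itg set_itv1 Rintegral_set1 subrr.
have a_in : a <= a <= b by rewrite lexx ltW.
have b_in : a <= b <= b by rewrite lexx ltW.
rewrite /itg /Rintegral (@continuous_FTC2 _ f F) //.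
- exact: continuous_subspaceT.
- split=> [x||].
  + by rewrite in_itv /= => /andP[/ltW ax /ltW xb]; have [] := dF x; rewrite ?ax.
  + by apply: cvg_at_right_filter; exact: der_continuous (dF a a_in).
  + by apply: cvg_at_left_filter; exact: der_continuous (dF b b_in).
- move=> x; rewrite in_itv /= => /andP[/ltW ax /ltW xb].
  by apply: der_derive1 (dF x _); rewrite ax.
Qed.

Lemma itg_split a b c f : a <= b -> b <= c -> itgable a c f ->
  itg a c f = itg a b f + itg b c f.
Proof.
move=> ab bc fi.
have := @Rintegral_itvB R f (BLeft a) (BRight c) b fi.
rewrite !bnd_simp => /(_ ab bc) h.
rewrite /itg -(Rintegral_itv_obnd_cbnd (f:=f) (r:=b) (b:=BRight c)).
  by rewrite -h addrC subrK.
by apply: integrableS fi => //; apply: subset_itvr; rewrite bnd_simp.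
Qed.

(** Continuous functions have primitives on a half-line, which is all that is
    needed for periodic functions. *)
Lemma itg_primitive a x f : continuous f -> a < x ->
  has_deriv (fun y => itg a y f) x (f x).
Proof.
move=> cf ax.
have [] := @continuous_FTC1_closed R f a x (x + 1); first by rewrite ltrDl.
- exact: cont_itgable.
- by [].
- exact: cf.
by move=> d <-; exact: der_of_derivable.
Qed.

End Integrals.

Section MeanValue.
Context {R : realType}.
Implicit Types (f g h df F G : R -> R) (x y a b c k l L : R).

Lemma within_cont a b f : (forall x, a <= x <= b -> {for x, continuous f}) ->
  {within `[a, b], continuous f}.
Proof.
move=> cf; apply: continuous_in_subspaceT => x.
by rewrite inE /= in_itv /=; exact: cf.
Qed.

Lemma mean_value a b f df : a < b ->
  (forall x, a <= x <= b -> has_deriv f x (df x)) ->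
  exists2 c, a < c < b & f b - f a = df c * (b - a).
Proof.
move=> ab d; have [x||c] := @MVT R f df a b ab.
- by rewrite in_itv /= => /andP[/ltW ax /ltW xb]; apply: d; rewrite ax.
- by apply: within_cont => x /d /der_continuous.
- by rewrite in_itv /=; exists c.
Qed.

Lemma der_ge0_le a b f df : a <= b ->
  (forall x, a <= x <= b -> has_deriv f x (df x)) ->
  (forall x, a <= x <= b -> 0 <= df x) -> f a <= f b.
Proof.
rewrite le_eqVlt => /predU1P[-> //|ab] d d0.
have [c /andP[ac cb] e] := mean_value ab d.
by rewrite -subr_ge0 e mulr_ge0 ?d0 ?subr_ge0 ?(ltW ac) ?(ltW cb) ?(ltW ab).
Qed.

Lemma der_gt0_lt a b f df : a < b ->
  (forall x, a <= x <= b -> has_deriv f x (df x)) ->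
  (forall x, a < x < b -> 0 < df x) -> f a < f b.
Proof.
move=> ab d d0; have [c acb e] := mean_value ab d.
by rewrite -subr_gt0 e mulr_gt0 ?d0 ?subr_gt0.
Qed.

Lemma der0_eq a b f : (forall x, Num.min a b <= x <= Num.max a b ->
  has_deriv f x 0) -> f a = f b.
Proof.
wlog ab : a b / a <= b => [hw|].
  by case/orP: (le_total a b) => ab d; [|apply/esym]; apply: hw => //;
    rewrite minC maxC.
rewrite (min_idPl ab) (max_idPr ab) => d.
move: ab; rewrite le_eqVlt => /predU1P[-> //|ab].
have [c _] := @mean_value a b f (fun=> 0) ab d.
by rewrite mul0r => /eqP; rewrite subr_eq0 => /eqP.
Qed.

Lemma rolle a b f df : a < b ->
  (forall x, a <= x <= b -> has_deriv f x (df x)) -> f a = f b ->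
  exists2 c, a < c < b & df c = 0.
Proof.
move=> ab d e; have [c cab] := mean_value ab d.
rewrite e subrr => /esym/eqP; rewrite mulf_eq0 subr_eq0 (gt_eqF ab) orbF.
by move=> /eqP ?; exists c.
Qed.

Lemma intermediate a b f v : a <= b ->
  (forall x, a <= x <= b -> {for x, continuous f}) ->
  (f a <= v <= f b) || (f b <= v <= f a) -> exists2 c, a <= c <= b & f c = v.
Proof.
move=> ab cf hv; have [||c] := @IVT R f a b v ab; last by rewrite in_itv; exists c.
  exact: within_cont.
by rewrite ge_min le_max; case/orP: hv => /andP[-> ->]; rewrite ?orbT.
Qed.

Lemma cont_bounded a b f : (forall x, a <= x <= b -> {for x, continuous f}) ->
  exists2 M, 0 < M & forall x, a <= x <= b -> `|f x| <= M.
Proof.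
move=> cf; case: (leP a b) => [ab|ba]; last first.
  by exists 1 => // x /andP[ax xb]; move: (le_trans ax xb); rewrite leNgt ba.
have [|c _ hc] := @EVT_max R (fun x => `|f x|) a b ab.
  by apply: within_cont => x /cf cfx; exact: cvg_norm.
exists (`|f c| + 1); first by rewrite ltr_wpDl.
move=> x xab; rewrite (le_trans (hc x _)) ?in_itv //.
by rewrite lerDl.
Qed.

Lemma cont_pos_min a b f : a <= b ->
  (forall x, a <= x <= b -> {for x, continuous f}) ->
  (forall x, a <= x <= b -> 0 < f x) ->
  exists2 m, 0 < m & forall x, a <= x <= b -> m <= f x.
Proof.
move=> ab cf f0; have [|c cab hc] := @EVT_min R f a b ab.
  by apply: within_cont => x /cf.
exists (f c); first by apply: f0; move: cab; rewrite in_itv.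
by move=> x xab; apply: hc; rewrite in_itv.
Qed.

Lemma cont_le_right a b f g : a < b ->
  {for a, continuous f} -> {for a, continuous g} ->
  (forall x, a < x < b -> f x <= g x) -> f a <= g a.
Proof.
move=> ab cf cg fg.
have cf' : f x @[x --> a^'+] --> f a by exact: cvg_at_right_filter.
have cg' : g x @[x --> a^'+] --> g a by exact: cvg_at_right_filter.
apply: ler_cvg_to cf' cg' _; near=> x; apply: fg; apply/andP; split.
  by near: x; exact: nbhs_right_gt.
by near: x; exact: nbhs_right_lt.
Unshelve. all: by end_near. Qed.

End MeanValue.

Section MoreIntegrals.
Context {R : realType}.
Implicit Types (f g h F G : R -> R) (x y a b c k l L : R).

Lemma cauchy_schwarz a b f g : itgable a b (fun x => f x ^+ 2) ->
  itgable a b (fun x => g x ^+ 2) -> itgable a b (fun x => f x * g x) ->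
  itg a b (fun x => f x * g x) ^+ 2
  <= itg a b (fun x => f x ^+ 2) * itg a b (fun x => g x ^+ 2).
Proof.
move=> ff gg fg; set A := itg _ _ (fun x => f x ^+ 2).
set B := itg _ _ (fun x => f x * g x); set C := itg _ _ (fun x => g x ^+ 2).
have q (s t : R) : 0 <= s ^+ 2 * A + 2 * s * t * B + t ^+ 2 * C.
  rewrite -!itgZ // -!itgD //; try by do ?[exact: itgableZ | apply: itgableD].
  apply: itg_ge0 => x _.
  rewrite (_ : _ + _ = (s * f x + t * g x) ^+ 2) ?sqr_ge0 //; ring.
have C0 : 0 <= C by apply: itg_ge0 => x _; exact: sqr_ge0.
have [C_eq0|Cn0] := eqVneq C 0.
  rewrite C_eq0 mulr0; move: (q 1) => {}q.
  have [->|Bn0] := eqVneq B 0; first by rewrite expr0n.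
  have := q (- (A + 1) / (2 * B)); rewrite C_eq0 mulr0 addr0.
  rewrite (_ : _ + _ = -1) ?ler0N1 //; by field.
have Cpos : 0 < C by rewrite lt_neqAle eq_sym Cn0.
(* the minimum of the quadratic form in [s : t] is at [C : - B] *)
have := q C (- B).
rewrite (_ : _ + _ = C * (A * C - B ^+ 2)); last by ring.
by rewrite pmulr_rge0 // subr_ge0.
Qed.

(** Both integrals are increments of the same primitive. *)
Lemma itg_shift_zero L h y : continuous h -> Defs.periodic L h -> 0 < L ->
  itg 0 L (fun x => h (x + y)) = itg y (y + L) h.
Proof.
move=> ch ph L0; pose N := - (`|y| + 1); pose H x := itg N x h.
have dH x : N < x -> has_deriv H x (h x) by exact: itg_primitive.
have Ny x : y <= x -> N < x.
  move=> yx; rewrite /N (lt_le_trans _ yx) // ltrNl.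
  by rewrite (le_lt_trans (ler_norm _)) // normrN ltrDl.
have -> : itg y (y + L) h = H (y + L) - H y.
  apply: itg_der => //; first by rewrite lerDl ltW.
  by move=> x /andP[/Ny ? _]; exact: dH.
have -> : H (y + L) - H y = H (L + y) - H (0 + y) by rewrite add0r (addrC L).
apply: (@itg_der _ 0 L (fun x => H (x + y))); rewrite ?(ltW L0) //.
  by cont.
move=> x /andP[x0 _]; have ? : has_deriv H (x + y) (h (x + y)).
  by apply/dH/Ny; rewrite lerDr.
by apply: der_eq; [der|ring].
Qed.

(** The increment over a period of a primitive of [h] does not depend on the
    starting point, because its derivative vanishes. *)
Lemma itg_period L h y : continuous h -> Defs.periodic L h -> 0 < L ->
  itg 0 L (fun x => h (x + y)) = itg 0 L h.
Proof.
move=> ch ph L0; rewrite itg_shift_zero //.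
pose N := - (`|y| + 1); pose H x := itg N x h.
have dH x : N < x -> has_deriv H x (h x) by exact: itg_primitive.
have Ny : N < y.
  by rewrite /N ltrNl (le_lt_trans (ler_norm _)) // normrN ltrDl.
have N0 : N < 0 by rewrite /N oppr_lt0 ltr_wpDl.
have -> : itg y (y + L) h = H (y + L) - H y.
  apply: itg_der => //; first by rewrite lerDl ltW.
  by move=> x /andP[yx _]; apply: dH; exact: lt_le_trans yx.
have -> : itg 0 L h = H L - H 0.
  apply: itg_der => //; first exact: ltW.
  by move=> x /andP[x0 _]; apply: dH; exact: lt_le_trans x0.
rewrite -[X in H X - H 0]add0r; apply: (@der0_eq _ y 0 (fun s => H (s + L) - H s)).
move=> x /andP[+ _]; rewrite ge_min => hx.
have Nx : N < x by case/orP: hx; exact: lt_le_trans.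
have ? : has_deriv H (x + L) (h x).
  by rewrite -ph; apply: dH; rewrite (lt_le_trans Nx) // lerDl ltW.
have ? := dH x Nx.
by apply: der_eq; [der|ring].
Qed.

(** The wave is symmetric about [0] and [l]: reflecting the second half period
    reduces estimates to a half period between two extrema. *)
Lemma itg_fold l h : continuous h -> Defs.periodic (l + l) h -> 0 < l ->
  itg 0 (l + l) h = itg 0 l h + itg 0 l (fun x => h (- x)).
Proof.
move=> ch ph l0; have L0 : 0 < l + l by rewrite addr_gt0.
rewrite -(itg_period (- l) ch ph L0) itg_shift_zero //.
rewrite addKr.
pose N := - l - 1; pose H x := itg N x h.
have dH x : - l <= x -> has_deriv H x (h x).
  by move=> lx; apply: itg_primitive => //; rewrite (lt_le_trans _ lx) // /N; lra.
have -> : itg (- l) l h = H l - H (- l).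
  by apply: itg_der => //; [lra|move=> x /andP[/dH]].
have -> : itg 0 l h = H l - H 0.
  by apply: itg_der => //; [lra|move=> x /andP[? _]; apply: dH; lra].
have -> : itg 0 l (fun x => h (- x)) = - H (- l) - - H (- 0).
  apply: (@itg_der _ 0 l (fun x => - H (- x))); [lra|by cont|].
  move=> x /andP[_ xl]; have ? : has_deriv H (- x) (h (- x)) by apply: dH; lra.
  by apply: der_eq; [der|ring].
by rewrite oppr0; ring.
Qed.

End MoreIntegrals.

(** * Hermite interpolation at two double nodes *)

Section Hermite.
Context {R : realType}.
Implicit Types (lo hi s x : R).

(** Subtracting the right multiple of the nodal polynomial creates a third
    zero, and Rolle's theorem is then used four times. *)
Lemma hermite_error (D0 D1 D2 D3 D4 : R -> R) lo hi s :
  (forall x, lo <= x <= hi -> has_deriv D0 x (D1 x)) ->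
  (forall x, lo <= x <= hi -> has_deriv D1 x (D2 x)) ->
  (forall x, lo <= x <= hi -> has_deriv D2 x (D3 x)) ->
  (forall x, lo <= x <= hi -> has_deriv D3 x (D4 x)) ->
  D0 lo = 0 -> D0 hi = 0 -> D1 lo = 0 -> D1 hi = 0 -> lo < s < hi ->
  exists2 xi, lo < xi < hi & D0 s = D4 xi / 24 * ((s - lo) * (hi - s)) ^+ 2.
Proof.
move=> d0 d1 d2 d3 l0 h0 l1 h1 /andP[ls sh].
have q0 : ((s - lo) * (hi - s)) ^+ 2 != 0.
  by rewrite expf_neq0 // mulf_neq0 // subr_eq0 gt_eqF.
pose K := D0 s / ((s - lo) * (hi - s)) ^+ 2.
pose G0 x := D0 x - K * ((x - lo) ^+ 2 * (hi - x) ^+ 2).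
pose G1 x := D1 x - K * (2 * (x - lo) * (hi - x) * (lo + hi - 2 * x)).
pose G2 x := D2 x - K * (2 * (lo + hi - 2 * x) ^+ 2 - 4 * (x - lo) * (hi - x)).
pose G3 x := D3 x - K * (- 12 * (lo + hi - 2 * x)).
pose G4 x := D4 x - K * 24.
have e0 x : lo <= x <= hi -> has_deriv G0 x (G1 x).
  move=> xi; have ? := d0 x xi; rewrite /G0 /G1.
  by apply: der_eq; [der|rewrite /=; ring].
have e1 x : lo <= x <= hi -> has_deriv G1 x (G2 x).
  move=> xi; have ? := d1 x xi; rewrite /G1 /G2.
  by apply: der_eq; [der|rewrite /=; ring].
have e2 x : lo <= x <= hi -> has_deriv G2 x (G3 x).
  move=> xi; have ? := d2 x xi; rewrite /G2 /G3.
  by apply: der_eq; [der|rewrite /=; ring].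
have e3 x : lo <= x <= hi -> has_deriv G3 x (G4 x).
  move=> xi; have ? := d3 x xi; rewrite /G3 /G4.
  by apply: der_eq; [der|rewrite /=; ring].
have z0l : G0 lo = 0 by rewrite /G0 l0; ring.
have z0h : G0 hi = 0 by rewrite /G0 h0; ring.
have z0s : G0 s = 0.
  by rewrite /G0 /K -exprMn -mulrA mulVf ?mulr1 ?subrr.
have z1l : G1 lo = 0 by rewrite /G1 l1; ring.
have z1h : G1 hi = 0 by rewrite /G1 h1; ring.
have step (G H : R -> R) p q : (forall x, lo <= x <= hi -> has_deriv G x (H x)) ->
    lo <= p -> p < q -> q <= hi -> G p = 0 -> G q = 0 ->
    exists2 r, p < r < q & H r = 0.
  move=> dG lp pq qh Gp Gq; apply: (rolle pq) => [x /andP[px xq]|].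
    by apply: dG; rewrite (le_trans lp px) (le_trans xq qh).
  by rewrite Gp.
have [c1 /andP[c1l c1s] z1] := step _ _ _ _ e0 (lexx _) ls (ltW sh) z0l z0s.
have [c2 /andP[c2l c2s] z2] := step _ _ _ _ e0 (ltW ls) sh (lexx _) z0s z0h.
have c1h : c1 <= hi := ltW (lt_trans c1s sh).
have lc2 : lo <= c2 := ltW (lt_trans ls c2l).
have [p1 /andP[p1l p1c] y1] := step _ _ _ _ e1 (lexx _) c1l c1h z1l z1.
have [p2 /andP[p2l p2c] y2] := step _ _ _ _ e1 (ltW c1l) (lt_trans c1s c2l) (ltW c2s) z1 z2.
have [p3 /andP[p3l p3c] y3] := step _ _ _ _ e1 lc2 c2s (lexx _) z2 z1h.
have p12 := lt_trans p1c p2l; have p23 := lt_trans p2c p3l.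
have p2h := ltW (lt_trans p2c c2s); have lp2 := ltW (lt_trans c1l p2l).
have [r1 /andP[r1l r1c] x1] := step _ _ _ _ e2 (ltW p1l) p12 p2h y1 y2.
have [r2 /andP[r2l r2c] x2] := step _ _ _ _ e2 lp2 p23 (ltW p3c) y2 y3.
have lr1 := lt_trans p1l r1l; have r2h := lt_trans r2c p3c.
have [xi /andP[rx xr] w] := step _ _ _ _ e3 (ltW lr1) (lt_trans r1c r2l) (ltW r2h) x1 x2.
exists xi; first by rewrite (lt_trans lr1 rx) (lt_trans xr r2h).
have -> : D4 xi = K * 24 by move/eqP: w; rewrite subr_eq0 => /eqP.
by rewrite mulfK ?pnatr_eq0 // /K divfK.
Qed.

End Hermite.

(** * The profile equation *)

Section Profile.
Context {R : realType}.
Implicit Types (c A l L s x : R) (phi y z : R -> R).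

(** With these conventions the profile equation is [phi'' = - force c A phi],
    and [phi' ^ 2 / 2 + force_prim c A phi] is its energy. *)
Definition force c A s : R := s * ln (s ^+ 2) - c * s - A.
Definition force1 c s : R := ln (s ^+ 2) + 2 - c.
Definition force_prim c A s : R :=
  2^-1 * s ^+ 2 * ln (s ^+ 2) - 2^-1 * (c + 1) * s ^+ 2 - A * s.

Lemma der_ln_sqr s : 0 < s -> has_deriv (fun s => ln (s ^+ 2)) s (2 / s).
Proof.
move=> s0; have s20 : 0 < s ^+ 2 by rewrite exprn_gt0.
have ? : has_deriv (@ln R) (s ^+ 2) (s ^+ 2)^-1 by exact: is_derive1_ln.
by apply: der_eq; [der|rewrite /=; field; rewrite gt_eqF].
Qed.

Lemma der_force c A s : 0 < s -> has_deriv (force c A) s (force1 c s).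
Proof.
move=> s0; have ? := der_ln_sqr s0; rewrite /force /force1.
by apply: der_eq; [der|rewrite /=; field; rewrite gt_eqF].
Qed.

Lemma der_force1 c s : 0 < s -> has_deriv (force1 c) s (2 / s).
Proof.
move=> s0; have ? := der_ln_sqr s0; rewrite /force1.
by apply: der_eq; [der|rewrite /=; field; rewrite gt_eqF].
Qed.

Lemma der_force_prim c A s : 0 < s ->
  has_deriv (force_prim c A) s (force c A s).
Proof.
move=> s0; have ? := der_ln_sqr s0; rewrite /force_prim /force.
by apply: der_eq; [der|rewrite /=; field; rewrite gt_eqF].
Qed.

(** Above the value [1] the force is smooth and the logarithm positive. *)
Record profile c A phi phi1 : Prop := Profile {
  pr_gt1 : forall x, 1 < phi x;
  pr_der : forall x, has_deriv phi x (phi1 x);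
  pr_der1 : forall x, has_deriv phi1 x (- force c A (phi x))
}.

Lemma gt1_gt0 s : 1 < s -> 0 < s.
Proof. exact: lt_trans. Qed.

Lemma profile_gt0 c A phi phi1 x : profile c A phi phi1 -> 0 < phi x.
Proof. by move=> [h _ _]; exact: gt1_gt0. Qed.

Lemma force_lipschitz c A M : exists2 K, 0 < K & forall s t, 1 <= s <= M ->
  1 <= t <= M -> `|force c A s - force c A t| <= K * `|s - t|.
Proof.
have [|K K0 hK] := @cont_bounded R 1 M (force1 c).
  move=> s /andP[s1 _]; apply: der_continuous (der_force1 c _).
  exact: lt_le_trans s1.
exists K => // s t; wlog st : s t / t < s => [hw|].
  case: (ltgtP t s) => [?|?|->]; [exact: hw|by rewrite distrC [X in _ * X]distrC; move=> ? ?; apply: hw|by rewrite !subrr normr0 mulr0].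
move=> /andP[s1 sM] /andP[t1 tM].
have [|r /andP[tr rs] ->] := @mean_value R t s (force c A) (force1 c) st.
  by move=> r /andP[tr _]; apply: der_force; rewrite (lt_le_trans _ tr) // (lt_le_trans _ t1).
by rewrite normrM ler_wpM2r // hK // (le_trans t1 (ltW tr)) (le_trans (ltW rs) sM).
Qed.

(** Two solutions with the same Cauchy data coincide: the energy of their
    difference satisfies a linear differential inequality. *)
Lemma profile_unique c A M y y1 z z1 x0 :
  profile c A y y1 -> profile c A z z1 ->
  (forall x, y x <= M) -> (forall x, z x <= M) ->
  y x0 = z x0 -> y1 x0 = z1 x0 -> y = z.
Proof.
move=> [y_gt1 dy dy1] [z_gt1 dz dz1] yM zM e0 e1.
have [K K0 hK] := force_lipschitz c A M.
pose N x := (y x - z x) ^+ 2 + (y1 x - z1 x) ^+ 2.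
pose N1 x := 2 * (y x - z x) * (y1 x - z1 x)
  - 2 * (y1 x - z1 x) * (force c A (y x) - force c A (z x)).
have dN x : has_deriv N x (N1 x).
  by rewrite /N /N1; apply: der_eq; [der|rewrite /=; ring].
have N_ge0 x : 0 <= N x by rewrite addr_ge0 // sqr_ge0.
have hN x : `|N1 x| <= (1 + K) * N x.
  have := hK (y x) (z x); rewrite !yM !zM !(ltW (y_gt1 _)) !(ltW (z_gt1 _)).
  move=> /(_ isT isT); rewrite /N /N1.
  set p := y x - z x; set q := y1 x - z1 x; set d := force _ _ _ - _ => dp.
  have h1 : `|2 * p * q| <= p ^+ 2 + q ^+ 2.
    by rewrite ler_norml; apply/andP; split;
      [have := sqr_ge0 (p + q)|have := sqr_ge0 (p - q)]; nra.
  have h2 : `|2 * q * d| <= K * (p ^+ 2 + q ^+ 2).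
    rewrite !normrM (ger0_norm (ler0n _ 2)).
    have -> : p ^+ 2 + q ^+ 2 = `|p| ^+ 2 + `|q| ^+ 2 by rewrite !real_normK ?num_real.
    have := sqr_ge0 (`|p| - `|q|); have := normr_ge0 q; have := normr_ge0 p.
    move: dp; set P := `|p|; set Q := `|q|; set E := `|d|.
    move=> h p0 q0 h3.
    have h4 : Q * E <= Q * (K * P) by rewrite ler_wpM2l.
    have h5 : 0 <= K * (P - Q) ^+ 2 by rewrite mulr_ge0 // ltW.
    nra.
  by apply: le_trans (ler_normB _ _) _; lra.
have N0 x : N x = 0.
  have Nx0 : N x0 = 0 by rewrite /N e0 e1 !subrr expr0n addr0.
  apply/eqP; rewrite eq_le N_ge0 andbT.
  case: (leP x0 x) => [xx|/ltW xx].
    have : - (N x0 * expR (- (1 + K) * x0)) <= - (N x * expR (- (1 + K) * x)).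
      apply: (@der_ge0_le _ x0 x (fun t => - (N t * expR (- (1 + K) * t)))
        (fun t => ((1 + K) * N t - N1 t) * expR (- (1 + K) * t))) => //.
        by move=> t _; have ? := dN t; apply: der_eq; [der|rewrite /=; ring].
      move=> t _; rewrite mulr_ge0 ?expR_ge0 // subr_ge0.
      exact: le_trans (ler_norm _) (hN t).
    by rewrite Nx0 mul0r oppr0 oppr_ge0 pmulr_lle0 // expR_gt0.
  have : N x * expR ((1 + K) * x) <= N x0 * expR ((1 + K) * x0).
    apply: (@der_ge0_le _ x x0 (fun t => N t * expR ((1 + K) * t))
      (fun t => ((1 + K) * N t + N1 t) * expR ((1 + K) * t))) => //.
      by move=> t _; have ? := dN t; apply: der_eq; [der|rewrite /=; ring].
    move=> t _; rewrite mulr_ge0 ?expR_ge0 // -[N1 t]opprK subr_ge0.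
    by rewrite (le_trans (ler_norm _)) // normrN.
  by rewrite Nx0 mul0r pmulr_lle0 // expR_gt0.
apply/funext => x; apply/eqP; rewrite -subr_eq0 -sqrf_eq0.
have := N0 x; rewrite /N => /eqP; rewrite paddr_eq0 ?sqr_ge0 //.
by case/andP.
Qed.

End Profile.

Section HalfWave.
Context {R : realType}.
Implicit Types (c A l L s x : R) (phi : R -> R).

Lemma periodic_int L u : Defs.periodic L u ->
  forall (k : int) (x : R), u (x + k%:~R * L) = u x.
Proof.
move=> per; have nat (n : nat) y : u (y + n%:R * L) = u y.
  elim: n y => [|n IH] y; first by rewrite mul0r addr0.
  by rewrite -natr1 mulrDl mul1r addrA per IH.
move=> [n|n] x; first exact: nat.
by rewrite NegzE mulrNz mulNr -[in RHS](subrK (n.+1%:~R * L) x); apply/esym/nat.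
Qed.

Lemma periodic_reduce L x : 0 < L ->
  exists k : int, 0 <= x + k%:~R * L < L.
Proof.
move=> L0; exists (- Num.floor (x / L)).
have := Num.Theory.floor_itv (x / L).
rewrite ler_pdivlMr // ltr_pdivrMr // mulrNz mulNr.
by rewrite intrD mulrDl mul1r; lra.
Qed.

Lemma periodic_bounded L u : 0 < L -> Defs.periodic L u -> continuous u ->
  exists2 M, 0 < M & forall x, `|u x| <= M.
Proof.
move=> L0 per cu; have [|M M0 hM] := @cont_bounded R 0 L u.
  by move=> x _; exact: cu.
exists M => // x; have [k /andP[xk0 xkL]] := periodic_reduce x L0.
by rewrite -(periodic_int per k) hM // xk0 ltW.
Qed.

(** The wave between two consecutive extrema. Which of them is the maximum is
    left open: the sign of [phi l - phi 0] records it, so that reflection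
    exchanges the two ends. *)
Record half_wave c A l phi phi1 : Prop := HalfWave {
  hw_l : 0 < l;
  hw_profile : profile c A phi phi1;
  hw_crit0 : phi1 0 = 0;
  hw_critl : phi1 l = 0;
  hw_mono : forall x, 0 < x < l -> 0 < (phi l - phi 0) * phi1 x;
  hw_force0 : force c A (phi 0) != 0;
  hw_forcel : force c A (phi l) != 0
}.

Lemma half_wave_reflect c A l phi phi1 : half_wave c A l phi phi1 ->
  half_wave c A l (fun x => phi (l - x)) (fun x => - phi1 (l - x)).
Proof.
move=> [l0 [gt1 d d1] c0 cl mono f0 fl]; split; rewrite ?subrr ?subr0 //.
- split=> // x; first by apply: der_eq; [der|rewrite /=; ring].
  by apply: der_eq; [der|rewrite /=; ring].
- by rewrite cl oppr0.
- by rewrite c0 oppr0.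
- move=> x /andP[x0 xl]; have := mono (l - x).
  rewrite subr_gt0 xl gtrBl x0 => /(_ isT).
  by rewrite mulrN -mulNr opprB.
Qed.

Lemma cont_pos_right (a : R) (h : R -> R) : {for a, continuous h} -> 0 < h a ->
  exists2 d : R, 0 < d & forall x, a <= x <= a + d -> 0 < h x.
Proof.
move=> ch h0; have /cvgrPdist_lt := ch => /(_ _ h0) [e /= e0 he].
exists (e / 2); first by rewrite divr_gt0.
move=> x /andP[ax xe]; have := he x.
rewrite /ball_ /= => hh; have : `|a - x| < e.
  by rewrite distrC ger0_norm ?subr_ge0 //; lra.
by move=> /hh; rewrite ltr_norml; lra.
Qed.

Lemma profile_cont c A phi phi1 : profile c A phi phi1 -> continuous phi.
Proof. by move=> p; apply: cont_der (pr_der p). Qed.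

Lemma profile_cont1 c A phi phi1 : profile c A phi phi1 -> continuous phi1.
Proof. by move=> p; apply: cont_der (pr_der1 p). Qed.

Lemma profile_cont_force c A phi phi1 : profile c A phi phi1 ->
  continuous (fun x => force c A (phi x)).
Proof.
move=> p x; have d := pr_der p x.
apply: (@der_continuous _ (fun x => force c A (phi x)) _ _).
by apply: der_comp d; apply: der_force; exact: profile_gt0 p.
Qed.

Lemma profile_cont_force1 c A phi phi1 : profile c A phi phi1 ->
  continuous (fun x => force1 c (phi x)).
Proof.
move=> p x; have d := pr_der p x.
apply: (@der_continuous _ (fun x => force1 c (phi x)) _ _).
by apply: der_comp d; apply: der_force1; exact: profile_gt0 p.
Qed.

(** The force pushes the profile away from its value at an extremum, towards
    the other one. *)
Lemma half_wave_force0 c A l phi phi1 : half_wave c A l phi phi1 ->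
  (phi l - phi 0) * force c A (phi 0) < 0.
Proof.
move=> [l0 p c0 cl mono f0 fl].
set d := phi l - phi 0.
have d0 : d != 0.
  have := mono (l / 2); rewrite -/d => h; apply: contraTneq (h _) => [->|].
    by rewrite mul0r ltxx.
  by lra.
rewrite lt_neqAle mulf_neq0 //= leNgt; apply/negP => pos.
have [|e e0 he] := @cont_pos_right 0 (fun x => d * force c A (phi x)) _ pos.
  by apply: cvgM; [exact: cvg_cst|exact: (profile_cont_force p)].
pose x := Num.min e (l / 2).
have x0 : 0 < x by rewrite lt_min e0 /=; lra.
have xe : x <= e by rewrite ge_min lexx.
have xl : x < l by rewrite gt_min; apply/orP; right; lra.
have := mono x; rewrite x0 xl -/d => /(_ isT).
rewrite ltNge => /negP; apply.
have : - (d * phi1 0) <= - (d * phi1 x).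
  apply: (@der_ge0_le _ 0 x (fun t => - (d * phi1 t))
    (fun t => d * force c A (phi t))); first exact: ltW.
    by move=> t _; have ? := pr_der1 p t; apply: der_eq; [der|rewrite /=; ring].
  move=> t /andP[t0 tx]; apply/ltW/he; rewrite t0 add0r /=.
  exact: le_trans tx xe.
by rewrite c0 mulr0 oppr0 oppr_ge0.
Qed.

Lemma half_wave_forcel c A l phi phi1 : half_wave c A l phi phi1 ->
  0 < (phi l - phi 0) * force c A (phi l).
Proof.
move=> /half_wave_reflect /half_wave_force0.
by rewrite subrr subr0 -oppr_gt0 -mulNr opprB.
Qed.

Lemma half_wave_between c A l phi phi1 x : half_wave c A l phi phi1 ->
  0 < x < l -> 0 < (phi x - phi 0) * (phi l - phi x).
Proof.
move=> [l0 p c0 cl mono f0 fl] /andP[x0 xl].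
set d := phi l - phi 0.
have dphi t : has_deriv (fun t => d * phi t) t (d * phi1 t).
  by have ? := pr_der p t; apply: der_eq; [der|rewrite /=; ring].
have h0 : d * phi 0 < d * phi x.
  apply: (@der_gt0_lt _ 0 x (fun t => d * phi t) (fun t => d * phi1 t)) => //.
  by move=> t /andP[t0 tx]; apply: mono; rewrite t0 (lt_trans tx).
have hl : d * phi x < d * phi l.
  apply: (@der_gt0_lt _ x l (fun t => d * phi t) (fun t => d * phi1 t)) => //.
  by move=> t /andP[t0 tx]; apply: mono; rewrite tx (lt_trans x0).
have : 0 < (d * phi x - d * phi 0) * (d * phi l - d * phi x).
  by rewrite mulr_gt0 // subr_gt0.
rewrite -!mulrBr mulrACA -expr2 pmulr_rgt0 // exprn_even_gt0 //=.
by apply: contraTneq h0 => ->; rewrite !mul0r ltxx.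
Qed.

(** An even profile with minimal period [L] is monotone on a half period: a
    critical point inside would be a centre of symmetry, hence would produce a
    smaller period. *)
Lemma even_profile_half_wave c A L phi phi1 : profile c A phi phi1 ->
  is_min_period L phi -> (forall x, phi (- x) = phi x) ->
  half_wave c A (L / 2) phi phi1 /\ Defs.periodic L phi1 /\
  (forall x, phi1 (- x) = - phi1 x).
Proof.
move=> p [L0 per min] even.
have per1 : Defs.periodic L phi1.
  move=> x; apply: der_unique (pr_der p x).
  have e : (fun t => phi (t + L)) = phi by apply/funext => t; rewrite per.
  rewrite -e; have ? := pr_der p (x + L).
  by apply: der_eq; [der|rewrite /=; ring].
have odd1 x : phi1 (- x) = - phi1 x.
  rewrite -[LHS]opprK; congr (- _); apply: der_unique (pr_der p x).
  have e : (fun t => phi (- t)) = phi by apply/funext => t; rewrite even.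
  rewrite -[X in has_deriv X]e; have ? := pr_der p (- x).
  by apply: der_eq; [der|rewrite /=; ring].
have c0 : phi1 0 = 0 by have := odd1 0; rewrite oppr0; lra.
have cl : phi1 (L / 2) = 0.
  have := odd1 (L / 2); rewrite -per1 (_ : - (L / 2) + L = L / 2); lra.
have [M M0 hM] := periodic_bounded L0 per (profile_cont p).
have leM x : phi x <= M by rewrite (le_trans (ler_norm _)).
have nocrit x : 0 < x < L / 2 -> phi1 x != 0.
  move=> /andP[x0 xl]; apply/eqP => cx.
  (* the reflection about a critical point solves the same Cauchy problem *)
  pose z t := phi (2 * x - t).
  have pz : profile c A z (fun t => - phi1 (2 * x - t)).
    rewrite /z; split=> t; first exact: pr_gt1 p _.
      by have ? := pr_der p (2 * x - t); apply: der_eq; [der|rewrite /=; ring].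
    by have ? := pr_der1 p (2 * x - t); apply: der_eq; [der|rewrite /=; ring].
  have e : phi = z.
    apply: (profile_unique (M := M) (x0 := x) p pz leM).
    - by move=> t; exact: leM.
    - by rewrite /z; congr phi; ring.
    - by rewrite (_ : 2 * x - x = x) ?cx ?oppr0 //; ring.
  have : L <= 2 * x.
    apply: min; first lra.
    move=> t; rewrite -[RHS]even [in RHS]e /z; congr phi; ring.
  by lra.
have noeq y : phi1 y = 0 -> force c A (phi y) != 0.
  move=> cy; apply/eqP => fy.
  (* a critical point without force is an equilibrium *)
  have pz : profile c A (fun=> phi y) (fun=> 0).
    split=> t; first exact: pr_gt1 p _.
      exact: der_cst.
    by rewrite fy oppr0; exact: der_cst.
  have e : phi = fun=> phi y.
    by apply: (profile_unique (M := M) (x0 := y) p pz leM).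
  have : L <= L / 2 by apply: min; [lra|move=> t; rewrite e].
  by lra.
split=> //; split=> //; first lra; last 2 first.
- exact: noeq.
- exact: noeq.
move=> x /andP[x0 xl].
have same y z : 0 < y < L / 2 -> 0 < z < L / 2 -> 0 < phi1 y -> 0 < phi1 z.
  wlog yz : y z / y <= z => [hw|].
    case/orP: (le_total y z) => h hy hz py; first exact: (hw y z).
    rewrite lt_neqAle eq_sym nocrit //= leNgt; apply/negP => nz.
    have [||w /andP[? ?] w0] := @intermediate _ z y phi1 0 h.
    - by move=> t _; exact: (profile_cont1 p).
    - by rewrite (ltW nz) (ltW py).
    by have := nocrit w; rewrite w0 eqxx => /(_ ltac:(lra)).
  move=> /andP[y0 yl] /andP[z0 zl] py.
  rewrite lt_neqAle eq_sym nocrit ?z0 //= leNgt; apply/negP => nz.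
  have [||w /andP[? ?] w0] := @intermediate _ y z phi1 0 yz.
  - by move=> t _; exact: (profile_cont1 p).
  - by rewrite (ltW nz) (ltW py) orbT.
  by have := nocrit w; rewrite w0 eqxx => /(_ ltac:(lra)).
have [||w w_in e] := @mean_value _ 0 (L / 2) phi phi1; first lra.
  by move=> t _; exact: pr_der p t.
rewrite e subr0 -mulrA mulrCA pmulr_rgt0; last lra.
have xin : 0 < x < L / 2 by rewrite x0.
case: (ltgtP (phi1 w) 0) => [nw|pw|zw]; last by have := nocrit w w_in; rewrite zw eqxx.
  rewrite nmulr_rgt0 // lt_neqAle nocrit //= leNgt; apply/negP => px.
  by have := same x w xin w_in px; rewrite ltNge (ltW nw).
by rewrite pmulr_rgt0 //; exact: (same w x).
Qed.

End HalfWave.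

(** * The comparison oscillator on a half period *)

Section Comparison.
Context {R : realType}.
Implicit Types (c A l L s x : R) (phi : R -> R).

(** The square of the velocity is a function [R s] of the value [s] of the wave
    that vanishes at the two extrema [a] and [b]. The comparison oscillator is
    obtained by replacing [R s] by [(s - a) * (b - s) * wsum s ^ 2], where the
    affine function [wsum] is the one for which the derivatives at [a] and [b]
    agree too. Its two parts [ucoord a b] and [ucoord b a] vanish at [b] and [a];
    the motion is sinusoidal in these projective coordinates. *)
Definition amp c A (a b : R) : R := Num.sqrt (- 2 * force c A a / (b - a)).
Definition ucoord c A (a b s : R) : R := amp c A a b * ((b - s) / (b - a)).
Definition wsum c A (a b s : R) : R := ucoord c A a b s + ucoord c A b a s.
Definition freq c A (a b : R) : R := Num.sqrt (amp c A a b * amp c A b a).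

(** The coefficients for which the polynomial [quad] below equals
    [force * al] at [a] and [force * be] at [b]; the singularities of the
    completed square at the extrema then cancel. *)
Definition sigma (a b al be : R) : R := (b - a) * (be - al) / 4.
Definition tau (a b al be : R) : R := - ((b - a) * (al + be) / 4).

(** In the angle of the comparison oscillator this is
    [sigma cos (2 theta) + tau cos theta], up to the Jacobian. *)
Definition quad c A (a b al be s : R) : R :=
  let U := ucoord c A a b s in let V := ucoord c A b a s in
  sigma a b al be * (U ^+ 2 - 6 * U * V + V ^+ 2)
  + tau a b al be * (U ^+ 2 - V ^+ 2).

Definition quad1 c A (a b al be s : R) : R :=
  let U := ucoord c A a b s in let V := ucoord c A b a s in
  let U1 := - amp c A a b / (b - a) in let V1 := amp c A b a / (b - a) in
  sigma a b al be * (2 * U * U1 - 6 * (U1 * V + U * V1) + 2 * V * V1)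
  + tau a b al be * (2 * U * U1 - 2 * V * V1).

(** In the angle of the comparison oscillator, with
    [cos theta = (U - V) / (U + V)] and [sin theta = 2 n / (U + V)], this is a
    multiple of the primitive of
    [(sigma cos (2 theta) + tau cos theta)^2 / (sin theta)^2
     + 2 sigma^2 + tau^2] which has no constant term at the end points. *)
Definition barrier c A (a b al be s : R) : R :=
  let U := ucoord c A a b s in let V := ucoord c A b a s in
  let n := Num.sqrt (U * V) in
  let sg := sigma a b al be in let ta := tau a b al be in
  4 * freq c A a b / (b - a) ^+ 2 *
  (- (sg ^+ 2 + ta ^+ 2) * (U - V) / (2 * n) - sg * ta * (U + V) / n
   - (sg ^+ 2 * (U - V) / (U + V) + 2 * sg * ta) * (4 * n) / (U + V)).

Lemma ucoordC c A a b s : ucoord c A b a s = amp c A b a * ((s - a) / (b - a)).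
Proof.
by rewrite /ucoord -[a - s]opprB -[a - b]opprB invrN mulrNN.
Qed.

Lemma freqC c A a b : freq c A a b = freq c A b a.
Proof. by rewrite /freq mulrC. Qed.

Lemma quadC c A a b al be s : quad c A a b al be s = quad c A b a be al s.
Proof. by rewrite /quad /sigma /tau; field. Qed.

Lemma barrierC c A a b al be s :
  barrier c A a b al be s = - barrier c A b a be al s.
Proof.
rewrite /barrier /= (freqC c A b a) (mulrC (ucoord c A b a s)).
rewrite (addrC (ucoord c A b a s) (ucoord c A a b s)).
rewrite (_ : (a - b) ^+ 2 = (b - a) ^+ 2); last by ring.
rewrite (_ : sigma b a be al = sigma a b al be); last by rewrite /sigma; ring.
rewrite (_ : tau b a be al = - tau a b al be); last by rewrite /tau; ring.
ring.
Qed.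

Section Wave.
Variables (c A l : R) (phi phi1 : R -> R).
Hypothesis hw : half_wave c A l phi phi1.
Let a := phi 0.
Let b := phi l.
Let f := force c A.
Let U := ucoord c A a b.
Let V := ucoord c A b a.
Let lam := wsum c A a b.
Let om := freq c A a b.
Let n x := Num.sqrt (U (phi x) * V (phi x)).

Let d_neq0 : b - a != 0.
Proof.
by have := half_wave_force0 hw; apply: contraTneq => ->; rewrite mul0r ltxx.
Qed.

Let amp0 : 0 < - 2 * f a / (b - a).
Proof.
have := half_wave_force0 hw; rewrite -/a -/b => h.
rewrite (_ : _ / _ = 2 * (- ((b - a) * f a)) / (b - a) ^+ 2); last by field.
by rewrite divr_gt0 ?exprn_even_gt0 //= mulr_gt0 // oppr_gt0.
Qed.

Let amp1 : 0 < - 2 * f b / (a - b).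
Proof.
have := half_wave_forcel hw; rewrite -/a -/b => h.
have dn : a - b != 0 by rewrite -opprB oppr_eq0.
rewrite (_ : _ / _ = 2 * ((b - a) * f b) / (b - a) ^+ 2); last first.
  by field; rewrite d_neq0.
by rewrite divr_gt0 ?exprn_even_gt0 //= mulr_gt0.
Qed.

Let Ap : 0 < amp c A a b. Proof. by rewrite sqrtr_gt0. Qed.
Let Bp : 0 < amp c A b a. Proof. by rewrite sqrtr_gt0. Qed.
Let omp : 0 < om. Proof. by rewrite sqrtr_gt0 mulr_gt0. Qed.
Let om2 : om ^+ 2 = amp c A a b * amp c A b a.
Proof. by rewrite sqr_sqrtr // ltW // mulr_gt0. Qed.
Let Asqr : amp c A a b ^+ 2 = - 2 * f a / (b - a).
Proof. by rewrite sqr_sqrtr // ltW. Qed.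
Let Bsqr : amp c A b a ^+ 2 = 2 * f b / (b - a).
Proof.
have dn : a - b != 0 by rewrite -opprB oppr_eq0.
by rewrite sqr_sqrtr ?ltW // /f; field; rewrite d_neq0.
Qed.

Lemma der_ucoord (a' b' s : R) : b' - a' != 0 ->
  has_deriv (ucoord c A a' b') s (- amp c A a' b' / (b' - a')).
Proof. by move=> h; rewrite /ucoord; apply: der_eq; [der|rewrite /=; field]. Qed.

Lemma der_ucoordC (a' b' s : R) : b' - a' != 0 ->
  has_deriv (ucoord c A b' a') s (amp c A b' a' / (b' - a')).
Proof.
move=> h; have -> : ucoord c A b' a' = (fun s => amp c A b' a' * ((s - a') / (b' - a'))).
  by apply/funext => t; rewrite ucoordC.
by apply: der_eq; [der|rewrite /=; field].
Qed.

Lemma der_quad (a' b' al be s : R) : b' - a' != 0 ->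
  has_deriv (quad c A a' b' al be) s (quad1 c A a' b' al be s).
Proof.
move=> h; have ? := der_ucoord s h; have ? := der_ucoordC s h.
by rewrite /quad /quad1; apply: der_eq; [der|rewrite /=; field].
Qed.

Lemma quad_left al be : quad c A a b al be a = f a * al.
Proof.
have U0 : ucoord c A a b a = amp c A a b by rewrite /ucoord divff ?mulr1.
have V0 : ucoord c A b a a = 0 by rewrite /ucoord subrr mul0r mulr0.
rewrite /quad /= U0 V0 /sigma /tau.
rewrite (_ : _ + _ = - (b - a) * al / 2 * amp c A a b ^+ 2); last by field.
by rewrite Asqr; field.
Qed.

(** Conservation of energy, with the constant read off at the extremum. *)
Lemma wave_energy x :
  phi1 x ^+ 2 = 2 * (force_prim c A a - force_prim c A (phi x)).
Proof.
have p := hw_profile hw.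
have : phi1 x ^+ 2 + 2 * force_prim c A (phi x)
  = phi1 0 ^+ 2 + 2 * force_prim c A (phi 0).
  apply: (@der0_eq _ x 0 (fun x => phi1 x ^+ 2 + 2 * force_prim c A (phi x))).
  move=> t _; have ? := pr_der p t; have ? := pr_der1 p t.
  have ? := der_force_prim c A (profile_gt0 t p).
  by apply: der_eq; [der|rewrite /=; ring].
by rewrite (hw_crit0 hw) expr0n /= -/a; lra.
Qed.

Let phi_in x : 0 < x < l -> 0 < (phi x - a) / (b - a) < 1.
Proof.
move=> xl; have := half_wave_between hw xl; rewrite -/a -/b => h.
have e : (b - a) * (phi x - a) = (phi x - a) ^+ 2 + (phi x - a) * (b - phi x) by ring.
have e' : (b - a) * (b - phi x) = (b - phi x) ^+ 2 + (phi x - a) * (b - phi x) by ring.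
have d2 : 0 < (b - a) ^+ 2 by rewrite exprn_even_gt0.
apply/andP; split.
  rewrite (_ : _ / _ = (b - a) * (phi x - a) / (b - a) ^+ 2); last by field.
  by rewrite divr_gt0 // e ltr_wpDl ?sqr_ge0.
rewrite -subr_gt0 (_ : 1 - _ = (b - a) * (b - phi x) / (b - a) ^+ 2); last by field.
by rewrite divr_gt0 // e' ltr_wpDl ?sqr_ge0.
Qed.

Let UVp x : 0 < x < l -> 0 < U (phi x) /\ 0 < V (phi x).
Proof.
move=> /phi_in /andP[t0 t1]; split; rewrite /U /V.
  rewrite /ucoord (_ : (b - phi x) / (b - a) = 1 - (phi x - a) / (b - a)); last by field.
  by rewrite mulr_gt0 // subr_gt0.
by rewrite ucoordC mulr_gt0.
Qed.

(** The comparison oscillator has the same turning points and the same forces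
    there, but less kinetic energy in between. This is Hermite interpolation:
    its kinetic energy is a quartic polynomial with negative leading
    coefficient, while the fourth derivative of the kinetic energy of the
    profile is positive. *)
Lemma kinetic_compare : exists2 C, 0 < C & forall x, 0 < x < l ->
  let q := (phi x - a) * (b - phi x) in
  q * lam (phi x) ^+ 2 <= phi1 x ^+ 2 <= q * lam (phi x) ^+ 2 + C * q ^+ 2.
Proof.
have p := hw_profile hw.
pose q := (amp c A b a - amp c A a b) / (b - a).
exists ((4 + 24 * q ^+ 2) / 24).
  by rewrite divr_gt0 // ltr_wpDr // mulr_ge0 // sqr_ge0.
move=> x xl /=; have := half_wave_between hw xl; rewrite -/a -/b => bet.
have dlam s : has_deriv lam s q.
  have ? := der_ucoord s d_neq0; have ? := der_ucoordC s d_neq0.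
  by rewrite /lam /wsum; apply: der_eq; [der|rewrite /q; field].
pose w s := (s - a) * (b - s).
have dw s : has_deriv w s (a + b - 2 * s).
  by rewrite /w; apply: der_eq; [der|rewrite /=; ring].
pose D0 s := 2 * (force_prim c A a - force_prim c A s) - w s * lam s ^+ 2.
pose D1 s := - 2 * f s - ((a + b - 2 * s) * lam s ^+ 2 + 2 * q * (w s * lam s)).
pose D2 s := - 2 * force1 c s - (- 2 * lam s ^+ 2 + 4 * q * ((a + b - 2 * s) * lam s)
  + 2 * q ^+ 2 * w s).
pose D3 s := - 4 * s^-1 - (- 12 * q * lam s + 6 * q ^+ 2 * (a + b - 2 * s)).
pose D4 s := 4 / s ^+ 2 + 24 * q ^+ 2.
pose lo := Num.min a b; pose hi := Num.max a b.
have lo1 : 1 < lo by rewrite lt_min !(pr_gt1 p).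
have s_gt1 s : lo <= s <= hi -> 1 < s by move=> /andP[ls _]; exact: lt_le_trans ls.
have d0 s : lo <= s <= hi -> has_deriv D0 s (D1 s).
  move=> /s_gt1 /gt1_gt0 s0; have ? := der_force_prim c A s0.
  by rewrite /D0 /D1 /f; apply: der_eq; [der|rewrite /=; ring].
have d1 s : lo <= s <= hi -> has_deriv D1 s (D2 s).
  move=> /s_gt1 /gt1_gt0 s0; have ? := der_force c A s0.
  by rewrite /D1 /D2 /f; apply: der_eq; [der|rewrite /=; ring].
have d2 s : lo <= s <= hi -> has_deriv D2 s (D3 s).
  move=> /s_gt1 /gt1_gt0 s0; have ? := der_force1 c s0.
  by rewrite /D2 /D3; apply: der_eq; [der|rewrite /=; ring].
have d3 s : lo <= s <= hi -> has_deriv D3 s (D4 s).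
  move=> /s_gt1 /gt1_gt0 s0; have sn : s != 0 by rewrite gt_eqF.
  by rewrite /D3 /D4; apply: der_eq; [der|rewrite /=; field].
have lam_a : lam a ^+ 2 = - 2 * f a / (b - a).
  by rewrite -Asqr /lam /wsum /ucoord subrr mul0r mulr0 addr0 divff ?mulr1.
have lam_b : lam b ^+ 2 = 2 * f b / (b - a).
  by rewrite -Bsqr /lam /wsum (ucoordC c A a b) /ucoord subrr mul0r mulr0 add0r divff ?mulr1.
have [Ra Rb] : D0 a = 0 /\ D0 b = 0.
  split; first by rewrite /D0 /w !subrr mul0r mulr0 mul0r subrr.
  rewrite /D0 -/b -(wave_energy l) (hw_critl hw) expr0n /w subrr mulr0 mul0r.
  by rewrite subrr.
have [Sa Sb] : D1 a = 0 /\ D1 b = 0.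
  by split; rewrite /D1 ?lam_a ?lam_b /w; field.
have [hlo hhi] : (D0 lo = 0 /\ D1 lo = 0) /\ (D0 hi = 0 /\ D1 hi = 0).
  by rewrite /lo /hi; case: (leP a b).
have ins : lo < phi x < hi.
  have /andP[] := phi_in xl; set t := _ / _ => t0 t1.
  have -> : phi x = a + t * (b - a) by rewrite /t divfK // addrC subrK.
  have t1' : 0 < 1 - t by rewrite subr_gt0.
  rewrite /lo /hi; case: (leP a b) => ab.
    have d0' : 0 < b - a by rewrite lt_neqAle eq_sym d_neq0 subr_ge0.
    by have := mulr_gt0 t0 d0'; have := mulr_gt0 t1' d0'; move=> ? ?; apply/andP; split; lra.
  have d0' : 0 < a - b by rewrite subr_gt0.
  by have := mulr_gt0 t0 d0'; have := mulr_gt0 t1' d0'; move=> ? ?; apply/andP; split; lra.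
have wE s : ((s - lo) * (hi - s)) ^+ 2 = w s ^+ 2.
  by rewrite /w /lo /hi; case: (leP a b) => _; ring.
have [xi /andP[lxi xih]] := hermite_error d0 d1 d2 d3 hlo.1 hhi.1 hlo.2 hhi.2 ins.
rewrite wE {1}/D0 -(wave_energy x) -/(w (phi x)) => e.
have xi1 : 1 < xi by exact: lt_trans lxi.
have D4_ge0 : 0 <= D4 xi.
  by apply: addr_ge0; [apply: divr_ge0|apply: mulr_ge0]; rewrite ?sqr_ge0.
have D4_le : D4 xi <= 4 + 24 * q ^+ 2.
  rewrite /D4 lerD2r ler_pdivrMr ?exprn_gt0 ?(gt1_gt0 xi1) //.
  by rewrite ler_peMr // exprn_ege1 // ltW.
have h1 : 0 <= D4 xi / 24 * w (phi x) ^+ 2.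
  by rewrite mulr_ge0 ?sqr_ge0 // divr_ge0.
have h2 : D4 xi / 24 * w (phi x) ^+ 2 <= (4 + 24 * q ^+ 2) / 24 * w (phi x) ^+ 2.
  by rewrite ler_wpM2r ?sqr_ge0 // ler_wpM2r ?invr_ge0.
by apply/andP; split; lra.
Qed.

Lemma hw_neq : b - a != 0. Proof. exact: d_neq0. Qed.
Lemma hw_amp0 : 0 < amp c A a b. Proof. exact: Ap. Qed.
Lemma hw_amp1 : 0 < amp c A b a. Proof. exact: Bp. Qed.
Lemma hw_sqr0 : amp c A a b ^+ 2 = - 2 * f a / (b - a). Proof. exact: Asqr. Qed.
Lemma hw_freq : 0 < om. Proof. exact: omp. Qed.
Lemma hw_freq2 : om ^+ 2 = amp c A a b * amp c A b a. Proof. exact: om2. Qed.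
Lemma hw_in x : 0 < x < l -> 0 < (phi x - a) / (b - a) < 1.
Proof. exact: phi_in. Qed.
Lemma hw_ucoord x : 0 < x < l -> 0 < U (phi x) /\ 0 < V (phi x).
Proof. exact: UVp. Qed.

End Wave.
End Comparison.

Section HalfForm.
Context {R : realType}.
Implicit Types (c A l s x : R) (phi v : R -> R).

Lemma small_of_der0 (G : R -> R) : has_deriv G 0 0 -> G 0 = 0 ->
  forall e, 0 < e -> exists2 d, 0 < d & forall x, 0 < x < d -> `|G x| <= e * x.
Proof.
move=> dG G0 e e0; have [dG1 dG2] := dG.
have h : h^-1 *: (G (h *: 1 + 0) - G 0) @[h --> 0^'] --> 'D_1 G 0 by exact: dG1.
rewrite dG2 in h; move: h => /cvgrPdist_le /(_ e e0) [d /= d0 hd].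
exists d => // x /andP[x0 xd].
have := hd x; rewrite /ball_ /= sub0r normrN gtr0_norm // => /(_ xd).
rewrite gt_eqF // => /(_ isT); rewrite sub0r normrN G0 subr0 addr0.
rewrite /GRing.scale /= mulr1 normrM normfV (gtr0_norm x0).
by rewrite mulrC ler_pdivrMr.
Qed.

(** The boundary term of the completed square, with its singularity at the end
    points removed by the barrier. *)
Definition defect c A l phi (phi1 : R -> R) v x : R :=
  let r := quad c A (phi 0) (phi l) (v 0) (v l) in
  (- force c A (phi x) * v x ^+ 2 + 2 * v x * r (phi x)) / phi1 x
  - barrier c A (phi 0) (phi l) (v 0) (v l) (phi x).

Lemma defect_reflect c A l phi phi1 v x :
  defect c A l (fun x => phi (l - x)) (fun x => - phi1 (l - x))
    (fun x => v (l - x)) x = - defect c A l phi phi1 v (l - x).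
Proof.
rewrite /defect /= subrr subr0 quadC barrierC invrN.
by move: (barrier _ _ _ _ _ _ _) (quad _ _ _ _ _ _ _) (force _ _ _) => p q r; ring.
Qed.

Section Wave.
Variables (c A l : R) (phi phi1 : R -> R).
Hypothesis hw : half_wave c A l phi phi1.
Let a := phi 0.
Let b := phi l.
Let f := force c A.
Let U x := ucoord c A a b (phi x).
Let V x := ucoord c A b a (phi x).
Let om := freq c A a b.
Let n x := Num.sqrt (U x * V x).
(* the ratio of the velocities of the profile and of the comparison oscillator *)
Let mu x := phi1 x * om / ((b - a) * n x * (U x + V x)).

Let dn0 : b - a != 0. Proof. exact: hw_neq hw. Qed.
Let d2 : 0 < (b - a) ^+ 2. Proof. by rewrite exprn_even_gt0. Qed.
Let Ap : 0 < amp c A a b. Proof. exact: hw_amp0 hw. Qed.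
Let Bp : 0 < amp c A b a. Proof. exact: hw_amp1 hw. Qed.
Let omp : 0 < om. Proof. exact: hw_freq hw. Qed.
Let om2 : om ^+ 2 = amp c A a b * amp c A b a. Proof. exact: hw_freq2 hw. Qed.

Let UV x : 0 < x < l -> 0 < U x /\ 0 < V x. Proof. by move=> xl; have [] := hw_ucoord hw xl. Qed.

Let n2 x : 0 < x < l -> n x ^+ 2 = U x * V x.
Proof. by move=> /UV[u w]; rewrite sqr_sqrtr // ltW // mulr_gt0. Qed.

Let n_gt0 x : 0 < x < l -> 0 < n x.
Proof. by move=> /UV[u w]; rewrite sqrtr_gt0 mulr_gt0. Qed.

Let UVq x : U x * V x = om ^+ 2 / (b - a) ^+ 2 * ((phi x - a) * (b - phi x)).
Proof. by rewrite om2 /U /V (ucoordC c A a b) /ucoord; field. Qed.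

Let UVom x : amp c A a b * V x + amp c A b a * U x = om ^+ 2.
Proof. by rewrite om2 /U /V (ucoordC c A a b) /ucoord; field. Qed.

Let dU x : has_deriv U x (- amp c A a b / (b - a) * phi1 x).
Proof.
have ? := pr_der (hw_profile hw) x; have ? := der_ucoord c A (phi x) dn0.
by rewrite /U; apply: der_eq; [der|rewrite mulrC].
Qed.

Let dV x : has_deriv V x (amp c A b a / (b - a) * phi1 x).
Proof.
have ? := pr_der (hw_profile hw) x; have ? := der_ucoordC c A (phi x) dn0.
by rewrite /V; apply: der_eq; [der|rewrite mulrC].
Qed.

(** By [kinetic_compare] the wave is faster than the oscillator, and the excess
    is of second order in the velocity, since the velocity is itself of the order
    of the square root of [(phi - a) * (b - phi)]. *)
Lemma mu_bounds : exists2 C, 0 < C & forall x, 0 < x < l ->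
  1 <= mu x <= 1 + C * phi1 x ^+ 2.
Proof.
have [C C0 hC] := kinetic_compare hw.
pose k := Num.min (amp c A a b) (amp c A b a).
have k0 : 0 < k by rewrite lt_min Ap.
exists (C / k ^+ 4); first by rewrite divr_gt0 // exprn_gt0.
move=> x xl; have [U0 V0] := UV xl; have n0 := n_gt0 xl.
have /= := hC x xl; rewrite -/a -/b /wsum -/(U x) -/(V x).
set q := (phi x - a) * (b - phi x); set lam := U x + V x; set p := phi1 x.
move=> /andP[h1 h2].
have lam0 : 0 < lam by rewrite addr_gt0.
have q0 : 0 < q by exact: half_wave_between hw xl.
have qn : n x ^+ 2 = om ^+ 2 / (b - a) ^+ 2 * q by rewrite n2 // UVq.
have mu2 : mu x ^+ 2 = p ^+ 2 / (q * lam ^+ 2).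
  rewrite /mu -/p -/lam expr_div_n !exprMn qn; field.
  by rewrite dn0 !gt_eqF.
have mu0 : 0 < mu x.
  have pd : 0 < (b - a) * p by have := hw_mono hw xl.
  rewrite /mu -/p -/lam (_ : _ / _ = (b - a) * p * om / ((b - a) ^+ 2 * n x * lam)).
    apply: divr_gt0; first exact: mulr_gt0.
    by apply: mulr_gt0 => //; exact: mulr_gt0.
  by field; rewrite dn0 !gt_eqF.
have ql0 : 0 < q * lam ^+ 2 by rewrite mulr_gt0 // exprn_gt0.
have mu1 : 1 <= mu x.
  rewrite -(@ler_pXn2r _ 2) ?nnegrE ?ler01 ?(ltW mu0) // expr1n mu2.
  by rewrite ler_pdivlMr // mul1r.
rewrite mu1 /=.
have klam : k <= lam.
  have [/andP[t0 t1]] := hw_in hw xl; rewrite -/a -/b in t0 t1 *.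
  set t := _ / _ in t0 t1.
  have e : lam = amp c A a b * (1 - t) + amp c A b a * t.
    by rewrite /lam /U /V (ucoordC c A a b) /ucoord /t; field.
  have kA : k <= amp c A a b by rewrite ge_min lexx.
  have kB : k <= amp c A b a by rewrite ge_min lexx orbT.
  have s1 : 0 < 1 - t by rewrite subr_gt0.
  have g1 : k * (1 - t) <= amp c A a b * (1 - t) by rewrite ler_pM2r.
  have g2 : k * t <= amp c A b a * t by rewrite ler_pM2r.
  by rewrite e; lra.
have h3 : mu x ^+ 2 <= 1 + C * (p ^+ 2 / k ^+ 4).
  have e1 : mu x ^+ 2 <= 1 + C * (q / lam ^+ 2).
    rewrite mu2 ler_pdivrMr //; apply: le_trans h2 _.
    by rewrite le_eqVlt; apply/orP; left; apply/eqP; field; rewrite gt_eqF.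
  apply: le_trans e1 _; rewrite lerD2l ler_pM2l //.
  rewrite ler_pdivrMr ?exprn_gt0 //.
  have l2 : q * lam ^+ 2 * lam ^+ 2 <= p ^+ 2 * lam ^+ 2 by rewrite ler_pM2r ?exprn_gt0.
  have k2 : k ^+ 2 <= lam ^+ 2 by rewrite lerXn2r // nnegrE ltW.
  have k4 : k ^+ 4 <= lam ^+ 2 * lam ^+ 2.
    by rewrite (exprD k 2 2) ler_pM // sqr_ge0.
  rewrite mulrAC ler_pdivlMr ?exprn_gt0 //.
  by apply: le_trans l2; rewrite -mulrA ler_pM2l.
have : mu x <= mu x ^+ 2 by rewrite expr2 ler_peMl // ltW.
by move=> /le_trans /(_ h3); rewrite [C / _ * _]mulrAC mulrA.
Qed.

(** Along the comparison oscillator the derivative of the barrier would be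
    [r ^ 2 / velocity ^ 2] plus a positive multiple of [2 * sg ^ 2 + ta ^ 2]. The
    wave is faster by the factor [mu >= 1], which increases the derivative of the
    barrier and decreases [r ^ 2 / phi1 ^ 2]. *)
Lemma barrier_deriv al be x : 0 < x < l ->
  exists2 B1, has_deriv (fun x => barrier c A a b al be (phi x)) x B1 &
    quad c A a b al be (phi x) ^+ 2 / phi1 x ^+ 2
    + om ^+ 2 / 2 * (al ^+ 2 + be ^+ 2) <= B1.
Proof.
move=> xl; have [U0 V0] := UV xl; have n0 := n_gt0 xl; have nE := n2 xl.
have [C _ /(_ x xl) /andP[mu1 _]] := mu_bounds.
have lam0 : 0 < U x + V x by rewrite addr_gt0.
pose sg := sigma a b al be; pose ta := tau a b al be.
pose r := quad c A a b al be (phi x).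
pose B1 := 4 * om ^+ 2 * mu x / (b - a) ^+ 2 *
  (r ^+ 2 / (4 * (U x + V x) ^+ 2 * n x ^+ 2) + 2 * sg ^+ 2 + ta ^+ 2).
exists B1.
  have dn : has_deriv n x
      (phi1 x / (b - a) * (amp c A b a * U x - amp c A a b * V x) / (2 * n x)).
    have ? := dU x; have ? := dV x.
    have ? : has_deriv (@Num.sqrt R) (U x * V x) (2 * n x)^-1.
      by apply: is_derive1_sqrt; rewrite mulr_gt0.
    apply: (@der_eq _ (fun x => Num.sqrt (U x * V x))); first by der.
    by rewrite /=; field; rewrite dn0 gt_eqF.
  rewrite /barrier /= -/sg -/ta -/om.
  apply: (@der_eq _ (fun x => 4 * om / (b - a) ^+ 2 *
    (- (sg ^+ 2 + ta ^+ 2) * (U x - V x) / (2 * n x) - sg * ta * (U x + V x) / n x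
     - (sg ^+ 2 * (U x - V x) / (U x + V x) + 2 * sg * ta) * (4 * n x) / (U x + V x)))).
    have ? := dU x; have ? := dV x.
    have ? : U x + V x != 0 by rewrite gt_eqF.
    have ? : 2 * n x != 0 by rewrite gt_eqF // mulr_gt0.
    have ? : n x != 0 by rewrite gt_eqF.
    by der.
  rewrite /B1 /r /quad /= -/(U x) -/(V x) -/sg -/ta /mu.
  have := UVom x; set Q := amp c A b a * U x => PQ.
  have EB : amp c A b a = Q / U x by rewrite /Q mulfK // gt_eqF.
  have EA : amp c A a b = (om ^+ 2 - Q) / V x.
    by rewrite -PQ addrK mulfK // gt_eqF.
  have Ew : V x = n x ^+ 2 / U x by rewrite nE mulrAC divff ?mul1r // gt_eqF.
  have z : 0 < U x * U x + n x ^+ 2 by rewrite addr_gt0 ?exprn_gt0 // mulr_gt0.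
  by rewrite EA EB /= Ew; field; rewrite dn0 !gt_eqF.
have r2 : r ^+ 2 / phi1 x ^+ 2
    = om ^+ 2 / (b - a) ^+ 2 * (r ^+ 2 / ((U x + V x) ^+ 2 * n x ^+ 2)) / mu x ^+ 2.
  have p0 : phi1 x != 0.
    have := hw_mono hw xl; rewrite -/a -/b => h.
    by apply: contraTneq h => ->; rewrite mulr0 ltxx.
  by rewrite /mu; field; rewrite p0 dn0 !gt_eqF.
rewrite -/r r2 /B1.
set X := r ^+ 2 / ((U x + V x) ^+ 2 * n x ^+ 2).
have X0 : 0 <= X.
  by apply: divr_ge0; [exact: sqr_ge0|apply: mulr_ge0; exact: sqr_ge0].
rewrite (_ : r ^+ 2 / (4 * (U x + V x) ^+ 2 * n x ^+ 2) = X / 4); last first.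
  by rewrite /X; field; rewrite !gt_eqF.
have s2 : (b - a) ^+ 2 / 8 * (al ^+ 2 + be ^+ 2) <= 2 * sg ^+ 2 + ta ^+ 2.
  rewrite /sg /ta /sigma /tau -subr_ge0.
  rewrite (_ : _ - _ = (b - a) ^+ 2 / 16 * (al - be) ^+ 2); last by field.
  by apply: mulr_ge0; [apply: divr_ge0|]; rewrite ?sqr_ge0.
set Y := 2 * sg ^+ 2 + ta ^+ 2 in s2 *.
have k0 : 0 < om ^+ 2 / (b - a) ^+ 2 by rewrite divr_gt0 ?d2 // exprn_gt0.
rewrite (_ : 4 * om ^+ 2 * mu x / (b - a) ^+ 2 * (X / 4 + 2 * sg ^+ 2 + ta ^+ 2)
  = om ^+ 2 / (b - a) ^+ 2 * (mu x * X + 4 * mu x * Y)); last by rewrite /Y; field.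
rewrite (_ : _ + _ = om ^+ 2 / (b - a) ^+ 2 *
  (X / mu x ^+ 2 + 4 * ((b - a) ^+ 2 / 8 * (al ^+ 2 + be ^+ 2)))); last first.
  by field; rewrite dn0 gt_eqF // (lt_le_trans _ mu1).
rewrite ler_pM2l //; apply: lerD.
  rewrite ler_pdivrMr ?exprn_gt0 ?(lt_le_trans _ mu1) //.
  rewrite (_ : mu x * X * mu x ^+ 2 = X * mu x ^+ 3); last by ring.
  by rewrite ler_peMr // exprn_ege1.
have Y0 : 0 <= Y by rewrite /Y; have := sqr_ge0 sg; have := sqr_ge0 ta; lra.
rewrite -(mulrA 4 (mu x)) ler_pM2l //; apply: le_trans s2 _.
by rewrite ler_peMl.
Qed.

Lemma quad_le al be x : 0 < x < l ->
  `|quad c A a b al be (phi x)| <=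
  `|b - a| * (amp c A a b + amp c A b a) ^+ 2 * (`|al| + `|be|).
Proof.
move=> xl; have [U0 V0] := UV xl.
have [/andP[t0 t1]] := hw_in hw xl; rewrite -/a -/b in t0 t1 *.
set t := _ / _ in t0 t1.
have UA : U x <= amp c A a b.
  have -> : U x = amp c A a b * (1 - t) by rewrite /U /ucoord /t; field.
  by rewrite ler_piMr ?(ltW Ap) // gerBl ltW.
have VB : V x <= amp c A b a.
  have -> : V x = amp c A b a * t by rewrite /V (ucoordC c A a b).
  by rewrite ler_piMr ?(ltW Bp) // ltW.
rewrite /quad /= -/(U x) -/(V x) /sigma /tau.
set S := amp c A a b + amp c A b a.
have SS : (U x + V x) ^+ 2 <= S ^+ 2.
  by rewrite lerXn2r ?nnegrE ?addr_ge0 ?(ltW U0) ?(ltW V0) ?(ltW Ap) ?(ltW Bp) // lerD.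
have UV0 : 0 < U x * V x by rewrite mulr_gt0.
have UU0 := sqr_ge0 (U x); have VV0 := sqr_ge0 (V x); have D0 := sqr_ge0 (U x - V x).
have s1 : `|U x ^+ 2 - 6 * U x * V x + V x ^+ 2| <= 2 * S ^+ 2.
  by rewrite ler_norml; apply/andP; split; lra.
have s2 : `|U x ^+ 2 - V x ^+ 2| <= S ^+ 2.
  by rewrite ler_norml; apply/andP; split; lra.
rewrite (_ : _ + _ = (b - a) * ((be - al) * (U x ^+ 2 - 6 * U x * V x + V x ^+ 2) / 4
  - (al + be) * (U x ^+ 2 - V x ^+ 2) / 4)); last by field.
rewrite normrM -[leRHS]mulrA ler_pM2l ?normr_gt0 //.
apply: le_trans (ler_normB _ _) _; rewrite !normrM !normfV (ger0_norm (ler0n _ 4)).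
have p1 : `|be - al| * `|U x ^+ 2 - 6 * U x * V x + V x ^+ 2|
    <= (`|al| + `|be|) * (2 * S ^+ 2).
  by apply: ler_pM => //; rewrite [leRHS]addrC ler_normB.
have p2 : `|al + be| * `|U x ^+ 2 - V x ^+ 2| <= (`|al| + `|be|) * S ^+ 2.
  by apply: ler_pM => //; exact: ler_normD.
have : 0 <= (`|al| + `|be|) * S ^+ 2 by rewrite mulr_ge0 ?sqr_ge0 ?addr_ge0.
by move: p1 p2; lra.
Qed.

(* the contexts of the estimates below are long, and few hypotheses matter *)
Tactic Notation "lra" "from" hyp_list(hs) :=
  clear - hs hw a b f U V om n mu dn0 d2 Ap Bp omp om2 UV n2 n_gt0 UVq UVom dU dV; lra.

(** At the extremum the numerator of the boundary term and the corresponding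
    term of the barrier agree to first order (the function [G] below has a double
    zero), while the velocity vanishes only to first order. *)
Lemma defect_left v (v10 : R) : has_deriv v 0 v10 -> forall e, 0 < e ->
  exists2 d, 0 < d & forall x, 0 < x < d -> x < l ->
    `|defect c A l phi phi1 v x| <= e.
Proof.
move=> dv e e0.
pose al := v 0; pose be := v l.
pose sg := sigma a b al be; pose ta := tau a b al be.
pose r := quad c A a b al be.
pose X x := - (sg ^+ 2 + ta ^+ 2) * (U x - V x) / 2 - sg * ta * (U x + V x).
pose G x := - f (phi x) * v x ^+ 2 + 2 * v x * r (phi x)
  - 4 / (b - a) * (U x + V x) * X x.
have c0 := hw_crit0 hw; have l0 := hw_l hw; have p := hw_profile hw.
have ra : r a = f a * al by have := quad_left hw al be.
have U0E : U 0 = amp c A a b.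
  by rewrite /U -/a /ucoord divff ?mulr1.
have V0E : V 0 = 0 by rewrite /V -/a /ucoord subrr mul0r mulr0.
have fa : f a = - (b - a) / 2 * amp c A a b ^+ 2.
  by rewrite (hw_sqr0 hw) -/a -/b /f; field.
have G0 : G 0 = 0.
  rewrite /G /X -/a -/al U0E V0E ra fa /sg /ta /sigma /tau; field.
  exact: dn0.
have dG : has_deriv G 0 0.
  have ? := dU 0; have ? := dV 0; have ? := pr_der p 0.
  have ? : has_deriv f (phi 0) (force1 c (phi 0)).
    by apply: der_force; exact: profile_gt0 p.
  have ? : has_deriv r (phi 0) (quad1 c A a b al be (phi 0)) by exact: der_quad.
  rewrite /G /X; apply: der_eq; first by der.
  by rewrite /= c0 -/a -/al ra; field; exact: dn0.
have [C C0 hmu] := mu_bounds.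
pose S := amp c A a b + amp c A b a.
have S0 : 0 < S by rewrite addr_gt0.
pose Q := sg ^+ 2 + ta ^+ 2.
have Q0 : 0 <= Q by rewrite addr_ge0 ?sqr_ge0.
pose k := Num.min (amp c A a b) (amp c A b a).
have k0 : 0 < k by rewrite lt_min Ap.
pose K := C * (4 / `|b - a| * S ^+ 2 * Q) + 16 * om ^+ 2 / (`|b - a| ^+ 3 * k ^+ 2) * (2 * Q).
have dn1 : 0 < `|b - a| by rewrite normr_gt0.
have K0 : 0 <= K.
  have g1 : 0 <= 4 / `|b - a| by apply: divr_ge0.
  have g2 : 0 <= S ^+ 2 by exact: sqr_ge0.
  have g3 : 0 <= 16 * om ^+ 2 / (`|b - a| ^+ 3 * k ^+ 2).
    apply: divr_ge0; first by apply: mulr_ge0; rewrite ?sqr_ge0.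
    by apply: mulr_ge0; [exact: exprn_ge0|exact: sqr_ge0].
  apply: addr_ge0; first by apply: mulr_ge0; [exact: ltW|do 2?apply: mulr_ge0].
  by apply: mulr_ge0 => //; exact: mulr_ge0.
(* [n] is [phi1 / mu] up to a factor bounded above and below, and [mu - 1] is of
   order [phi1 ^ 2] *)
have bound x : 0 < x < l ->
    `|defect c A l phi phi1 v x| <= `|G x| / `|phi1 x| + K * `|phi1 x|.
  move=> xl; have [Ux Vx] := UV xl; have nx := n_gt0 xl.
  have lam0 : 0 < U x + V x by rewrite addr_gt0.
  have p0 : phi1 x != 0.
    have := hw_mono hw xl; rewrite -/a -/b => h.
    by apply: contraTneq h => ->; rewrite mulr0 ltxx.
  have p1 : 0 < `|phi1 x| by rewrite normr_gt0.
  have /andP[mu1 mu2] := hmu x xl.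
  have mu0 : 0 < mu x by exact: lt_le_trans mu1.
  pose Y := sg ^+ 2 * (U x - V x) / (U x + V x) + 2 * sg * ta.
  have nE : n x = phi1 x * om / ((b - a) * mu x * (U x + V x)).
    rewrite /mu; field; rewrite p0 dn0 !gt_eqF //.
  have E : defect c A l phi phi1 v x =
      (G x + (mu x - 1) * (- (4 / (b - a) * (U x + V x) * X x))) / phi1 x
      + phi1 x * (16 * om ^+ 2 / ((b - a) ^+ 3 * (U x + V x) ^+ 2 * mu x) * Y).
    rewrite /defect /barrier /= -/a -/b -/al -/be -/sg -/ta -/om -/(U x) -/(V x) -/(n x).
    rewrite -/(f (phi x)) -/(r (phi x)) /G /X /Y nE; field.
    by rewrite p0 dn0 !gt_eqF.
  have [/andP[t0 t1]] := hw_in hw xl; rewrite -/a -/b in t0 t1 *.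
  set t := _ / _ in t0 t1.
  have lamE : U x + V x = amp c A a b * (1 - t) + amp c A b a * t.
    by rewrite /U /V (ucoordC c A a b) /ucoord /t; field.
  have kA : k <= amp c A a b by rewrite ge_min lexx.
  have kB : k <= amp c A b a by rewrite ge_min lexx orbT.
  have s1 : 0 < 1 - t by rewrite subr_gt0.
  have lamk : k <= U x + V x by rewrite lamE; nra.
  have lamS : U x + V x <= S by rewrite lamE /S; nra.
  have st : `|2 * sg * ta| <= Q.
    by rewrite ler_norml /Q; apply/andP; split;
      [have := sqr_ge0 (sg + ta)|have := sqr_ge0 (sg - ta)]; lra from.
  have D1 : `|U x - V x| <= U x + V x.
    by rewrite ler_norml; apply/andP; split; lra from Ux Vx.
  have hX : `|X x| <= (U x + V x) * Q.
    rewrite /X; apply: le_trans (ler_normB _ _) _.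
    rewrite (_ : sg * ta * (U x + V x) = 2 * sg * ta * ((U x + V x) / 2)); last by field.
    rewrite -mulrA mulNr normrN (normrM (_ + _)) (ger0_norm Q0).
    rewrite (normrM (2 * sg * ta)) (normrM (U x - V x)).
    rewrite (ger0_norm (_ : 0 <= (U x + V x) / 2)); last by lra from Ux Vx.
    rewrite (ger0_norm (_ : 0 <= (2 : R)^-1)) //.
    have g1 : Q * (`|U x - V x| / 2) <= Q * ((U x + V x) / 2).
      by rewrite ler_wpM2l // ler_pM2r.
    have g2 : `|2 * sg * ta| * ((U x + V x) / 2) <= Q * ((U x + V x) / 2).
      by rewrite ler_wpM2r //; lra from Ux Vx.
    by lra from g1 g2.
  have hY : `|Y| <= 2 * Q.
    rewrite /Y; apply: le_trans (ler_normD _ _) _.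
    have g1 : `|sg ^+ 2 * (U x - V x) / (U x + V x)| <= sg ^+ 2.
      rewrite -mulrA normrM (ger0_norm (sqr_ge0 _)) ler_piMr ?sqr_ge0 //.
      by rewrite normrM normfV (gtr0_norm lam0) ler_pdivrMr // mul1r.
    have := sqr_ge0 ta; move: g1 st; rewrite /Q; lra from.
  rewrite E; apply: le_trans (ler_normD _ _) _.
  rewrite normrM normfV [X in _ + X <= _]normrM.
  have h1 : `|(mu x - 1) * - (4 / (b - a) * (U x + V x) * X x)|
      <= C * phi1 x ^+ 2 * (4 / `|b - a| * S ^+ 2 * Q).
    rewrite normrM; apply: ler_pM => //.
      by rewrite ger0_norm ?subr_ge0 // lerBlDl.
    rewrite normrN !normrM normfV (ger0_norm (ler0n _ 4)) (gtr0_norm lam0).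
    rewrite -!mulrA ler_pM2l // ler_pM2l ?invr_gt0 //.
    apply: le_trans (_ : (U x + V x) * ((U x + V x) * Q) <= _).
      by rewrite ler_pM2l.
    rewrite (_ : (U x + V x) * ((U x + V x) * Q) = (U x + V x) ^+ 2 * Q); last by ring.
    rewrite (mulrA S) -(expr2 S).
    by rewrite ler_wpM2r // lerXn2r // nnegrE ltW.
  have h2 : `|16 * om ^+ 2 / ((b - a) ^+ 3 * (U x + V x) ^+ 2 * mu x) * Y|
      <= 16 * om ^+ 2 / (`|b - a| ^+ 3 * k ^+ 2) * (2 * Q).
    rewrite normrM; apply: ler_pM => //.
    rewrite normrM normfV (ger0_norm (_ : 0 <= 16 * om ^+ 2)); last first.
      by rewrite mulr_ge0 ?sqr_ge0.
    rewrite ler_pM2l ?mulr_gt0 ?exprn_gt0 //.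
    have g3 : 0 < `|b - a| ^+ 3 by rewrite exprn_gt0.
    have l2 : 0 < (U x + V x) ^+ 2 * mu x by rewrite mulr_gt0 ?exprn_gt0.
    have -> : `|(b - a) ^+ 3 * (U x + V x) ^+ 2 * mu x|
        = `|b - a| ^+ 3 * ((U x + V x) ^+ 2 * mu x).
      by rewrite -mulrA normrM (gtr0_norm l2) normrX.
    rewrite lef_pV2 ?posrE; [|by apply: mulr_gt0|by apply: mulr_gt0 => //; rewrite exprn_gt0].
    rewrite ler_pM2l //.
    have kk : k ^+ 2 <= (U x + V x) ^+ 2 by rewrite lerXn2r // nnegrE ltW.
    by apply: le_trans kk _; rewrite ler_peMr ?sqr_ge0.
  have h3 : `|G x + (mu x - 1) * - (4 / (b - a) * (U x + V x) * X x)| / `|phi1 x|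
      <= `|G x| / `|phi1 x| + C * (4 / `|b - a| * S ^+ 2 * Q) * `|phi1 x|.
    rewrite ler_pdivrMr // [leRHS]mulrDl divfK ?gt_eqF //.
    apply: le_trans (ler_normD _ _) _; rewrite lerD2l; apply: le_trans h1 _.
    rewrite -(@real_normK _ (phi1 x)) ?num_real //.
    by rewrite le_eqVlt; apply/orP; left; apply/eqP; ring.
  have h4 : `|phi1 x| * `|16 * om ^+ 2 / ((b - a) ^+ 3 * (U x + V x) ^+ 2 * mu x) * Y|
      <= `|phi1 x| * (16 * om ^+ 2 / (`|b - a| ^+ 3 * k ^+ 2) * (2 * Q)).
    by rewrite ler_pM2l.
  by move: h3 h4; rewrite /K; lra from.
(* the velocity is comparable with x near the extremum *)
have fa0 : 0 < `|f a| by rewrite normr_gt0; exact: hw_force0 hw.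
have [||d1 d10 hd1] := @cont_pos_right R 0 (fun x => `|f (phi x)| - `|f a| / 2).
- apply: cvgB; last exact: cvg_cst.
  by apply: cvg_norm; exact: (profile_cont_force p).
- by rewrite -/a; lra.
have vel x : 0 < x < d1 -> `|f a| / 2 * x <= `|phi1 x|.
  move=> /andP[x0 xd].
  have [|z /andP[z0 zx] ez] := @mean_value _ 0 x phi1 (fun x => - f (phi x)) x0.
    by move=> t _; exact: pr_der1 p t.
  have : 0 < `|f (phi z)| - `|f a| / 2.
    by apply: hd1; rewrite (ltW z0) add0r (le_trans (ltW zx) (ltW xd)).
  rewrite c0 !subr0 in ez; rewrite ez normrM normrN (gtr0_norm x0) subr_gt0.
  by move=> h; rewrite ler_pM2r // ltW.
pose e1 := e * `|f a| / 4.
have e10 : 0 < e1 by rewrite /e1 divr_gt0 // mulr_gt0.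
have [d2' d20 hd2] := small_of_der0 dG G0 e10.
have [||d3 d30 hd3] := @cont_pos_right R 0 (fun x => e / 2 - K * `|phi1 x|).
- apply: cvgB; first exact: cvg_cst.
  by apply: cvgM; [exact: cvg_cst|apply: cvg_norm; exact: (profile_cont1 p)].
- by rewrite c0 normr0 mulr0 subr0 divr_gt0.
exists (Num.min d1 (Num.min d2' d3)); first by rewrite !lt_min d10 d20.
move=> x /andP[x0]; rewrite !lt_min => /andP[xd1 /andP[xd2 xd3]] xl.
have := bound x; rewrite x0 xl => /(_ isT) /le_trans; apply.
have b2 : K * `|phi1 x| <= e / 2.
  by rewrite ltW // -subr_gt0; apply: hd3; rewrite (ltW x0) add0r ltW.
have v0 : 0 < `|phi1 x|.
  apply: lt_le_trans (vel x _); first by rewrite mulr_gt0 // divr_gt0.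
  by rewrite x0.
have b1 : `|G x| / `|phi1 x| <= e / 2.
  rewrite ler_pdivrMr //; apply: le_trans (hd2 x _) _; first by rewrite x0.
  have := vel x; rewrite x0 xd1 => /(_ isT) h.
  have : e / 2 * (`|f a| / 2 * x) <= e / 2 * `|phi1 x| by rewrite ler_pM2l // divr_gt0.
  by rewrite /e1; lra from.
by lra from b1 b2.
Qed.

End Wave.
End HalfForm.

Section HalfSquare.
Context {R : realType}.
Implicit Types (c A l s x : R) (phi v : R -> R).

(** The integrand obtained after completing the square; its last term
    vanishes for functions orthogonal to [1] and to the profile. *)
Definition half_integrand c A l phi v (v1 : R -> R) x : R :=
  v1 x ^+ 2 - force1 c (phi x) * v x ^+ 2
  + 2 * v x * quad1 c A (phi 0) (phi l) (v 0) (v l) (phi x).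

Lemma cont_quad1 c A a b al be phi : continuous phi ->
  continuous (fun x => quad1 c A a b al be (phi x)).
Proof. by move=> cphi; rewrite /quad1 /ucoord; cont. Qed.

Lemma cont_half_integrand c A l phi phi1 v v1 : profile c A phi phi1 ->
  continuous v -> continuous v1 -> continuous (half_integrand c A l phi v v1).
Proof.
move=> p cv cv1; have ? := profile_cont p; have ? := profile_cont_force1 p.
have ? : continuous (fun x => quad1 c A (phi 0) (phi l) (v 0) (v l) (phi x)).
  by apply: cont_quad1; exact: profile_cont p.
rewrite /half_integrand.
apply: cont_add; first by apply: cont_add; [cont|apply: cont_opp; apply: cont_mul; [assumption|cont]].
by apply: cont_mul; [cont|assumption].
Qed.

Lemma itg_le_bound a b g M : a <= b -> continuous g ->
  (forall x, a <= x <= b -> `|g x| <= M) -> `|itg a b g| <= M * (b - a).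
Proof.
move=> ab cg hg; rewrite -(itg_cst M ab) ler_norml; apply/andP; split.
  rewrite -itgN; last by apply: cont_itgable; exact: cont_cst.
  apply: le_itg; [apply: cont_itgable; exact: cont_cst|exact: cont_itgable|].
  by move=> x /hg; rewrite ler_norml => /andP[].
apply: le_itg; [exact: cont_itgable|apply: cont_itgable; exact: cont_cst|].
by move=> x /hg; rewrite ler_norml => /andP[].
Qed.

(** The part of the form collected up to the point [x], corrected by the
    boundary term. *)
Definition half_potential c A l phi (phi1 : R -> R) v (v1 : R -> R) x : R :=
  itg 0 x (half_integrand c A l phi v v1) - defect c A l phi phi1 v x.

Section Wave.
Variables (c A l : R) (phi phi1 : R -> R).
Hypothesis hw : half_wave c A l phi phi1.
Let a := phi 0.
Let b := phi l.
Let f := force c A.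
Let om := freq c A a b.
Let l0 : 0 < l. Proof. exact: hw_l hw. Qed.
Let p := hw_profile hw.

Let vel0 x : 0 < x < l -> phi1 x != 0.
Proof.
move=> xl; have h := hw_mono hw xl.
by apply: contraTneq h => ->; rewrite mulr0 ltxx.
Qed.

(** Completing the square: differentiating the boundary term [defect] produces
    all terms of the quadratic form except a perfect square, the gain in the
    boundary values coming from [barrier_deriv]. Hence the potential increases;
    it runs from [0] to the value of the form since [defect] tends to [0] at both
    ends. *)
Lemma half_square v v1 : (forall x, has_deriv v x (v1 x)) -> continuous v1 ->
  let r := quad c A a b (v 0) (v l) in
  let Psi := half_potential c A l phi phi1 v v1 in
  forall x, 0 < x < l ->
    0 <= Psi x <= itg 0 l (half_integrand c A l phi v v1) /\
    exists2 D, has_deriv Psi x D &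
      (v1 x - (r (phi x) - f (phi x) * v x) / phi1 x) ^+ 2
      + om ^+ 2 / 2 * (v 0 ^+ 2 + v l ^+ 2) <= D.
Proof.
move=> dv cv1 r.
pose g := half_integrand c A l phi v v1.
pose Psi x := itg 0 x g - defect c A l phi phi1 v x.
have cg : continuous g by apply: cont_half_integrand p _ cv1; exact: cont_der dv.
have der x : 0 < x < l -> exists2 D, has_deriv Psi x D &
      (v1 x - (r (phi x) - f (phi x) * v x) / phi1 x) ^+ 2
      + om ^+ 2 / 2 * (v 0 ^+ 2 + v l ^+ 2) <= D.
  move=> xl; have x0 : 0 < x by case/andP: xl.
  have [B1 dB hB] := barrier_deriv hw (v 0) (v l) xl.
  have dI := itg_primitive cg x0.
  have pn := vel0 xl.
  have ? := dv x; have ? := pr_der p x; have ? := pr_der1 p x.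
  have ? : has_deriv f (phi x) (force1 c (phi x)).
    by apply: der_force; exact: profile_gt0 p.
  have ? : has_deriv r (phi x) (quad1 c A a b (v 0) (v l) (phi x)).
    by apply: der_quad; exact: hw_neq hw.
  have dE : has_deriv (fun x => (- f (phi x) * v x ^+ 2 + 2 * v x * r (phi x)) / phi1 x) x
      (((2 * v1 x * r (phi x) + 2 * v x * quad1 c A a b (v 0) (v l) (phi x) * phi1 x
       - force1 c (phi x) * phi1 x * v x ^+ 2 - 2 * f (phi x) * v x * v1 x) * phi1 x
       + (- f (phi x) * v x ^+ 2 + 2 * v x * r (phi x)) * f (phi x)) / phi1 x ^+ 2).
    by apply: der_eq; [der|rewrite /= -/(f (phi x)); field].
  eexists.
    rewrite /Psi /defect /=; apply: der_add dI _; apply: der_opp.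
    by apply: der_add dE _; apply: der_opp; exact: dB.
  rewrite -/a -/b -/r -/om in hB *.
  rewrite /g /half_integrand -/a -/b -subr_ge0.
  set Q1 := quad1 _ _ _ _ _ _ _.
  rewrite (_ : _ - _ = B1 - (r (phi x) ^+ 2 / phi1 x ^+ 2
    + om ^+ 2 / 2 * (v 0 ^+ 2 + v l ^+ 2))); first by rewrite subr_ge0.
  by field.
have mono x y : 0 < x -> x <= y -> y < l -> Psi x <= Psi y.
  move=> x0 xy yl; apply: (@der_ge0_le _ x y Psi (fun t => derive1 Psi t) xy).
    move=> t /andP[xt ty]; have [|D dD _] := der t.
      by rewrite (lt_le_trans x0 xt) (le_lt_trans ty yl).
    by rewrite (der_derive1 dD).
  move=> t /andP[xt ty]; have [|D dD hD] := der t.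
    by rewrite (lt_le_trans x0 xt) (le_lt_trans ty yl).
  rewrite (der_derive1 dD); apply: le_trans hD.
  by rewrite addr_ge0 ?sqr_ge0 // mulr_ge0 ?addr_ge0 ?sqr_ge0 // divr_ge0 ?sqr_ge0.
have [M M0 hM] := @cont_bounded _ 0 l g (fun x _ => cg x).
have low x : 0 < x < l -> 0 <= Psi x.
  move=> /andP[x0 xl]; rewrite -oppr_le0; apply/ler_addgt0Pl => e e0; rewrite addr0.
  have e2 : 0 < e / 2 by rewrite divr_gt0.
  have [d d0 hd] := defect_left hw (dv 0) e2.
  pose y := Num.min x (Num.min (d / 2) (e / (2 * M))).
  have y0 : 0 < y by rewrite !lt_min x0 !divr_gt0 // mulr_gt0.
  have yx : y <= x by rewrite ge_min lexx.
  have yd : y < d.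
    by rewrite !gt_min; apply/orP; right; apply/orP; left; lra.
  have ye : M * y <= e / 2.
    have : y <= e / (2 * M) by rewrite !ge_min lexx !orbT.
    move=> /(ler_wpM2l (ltW M0)) => h; apply: le_trans h _.
    by rewrite le_eqVlt; apply/orP; left; apply/eqP; field; rewrite gt_eqF.
  have yl : y < l by exact: le_lt_trans xl.
  have h1 : `|defect c A l phi phi1 v y| <= e / 2 by apply: hd; rewrite ?y0.
  have h2 : `|itg 0 y g| <= M * (y - 0).
    apply: itg_le_bound cg _; first exact: ltW.
    by move=> t /andP[t0 ty]; apply: hM; rewrite t0 (le_trans ty (ltW yl)).
  have := mono y x y0 yx xl; move: h1 h2; rewrite subr0 !ler_norml {1}/Psi.
  by move=> /andP[? ?] /andP[? ?] ?; lra.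
have high x : 0 < x < l -> Psi x <= itg 0 l g.
  move=> /andP[x0 xl]; apply/ler_addgt0Pr => e e0.
  have e2 : 0 < e / 2 by rewrite divr_gt0.
  have dvr : has_deriv (fun t => v (l - t)) 0 (- v1 l).
    by apply: der_eq; [der|rewrite /= subr0; ring].
  have [d d0 hd] := defect_left (half_wave_reflect hw) dvr e2.
  pose y := Num.min (l - x) (Num.min (d / 2) (e / (2 * M))).
  have y0 : 0 < y by rewrite !lt_min subr_gt0 xl !divr_gt0 // mulr_gt0.
  have yx' : y <= l - x by rewrite ge_min lexx.
  have yx : x <= l - y by lra.
  have yd : y < d.
    by rewrite !gt_min; apply/orP; right; apply/orP; left; lra.
  have ye : M * y <= e / 2.
    have : y <= e / (2 * M) by rewrite !ge_min lexx !orbT.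
    move=> /(ler_wpM2l (ltW M0)) => h; apply: le_trans h _.
    by rewrite le_eqVlt; apply/orP; left; apply/eqP; field; rewrite gt_eqF.
  have yl : y < l by lra.
  have h1 : `|defect c A l phi phi1 v (l - y)| <= e / 2.
    by rewrite -normrN -defect_reflect; apply: hd; rewrite ?y0.
  have h2 : `|itg (l - y) l g| <= M * (l - (l - y)).
    apply: itg_le_bound cg _; first by rewrite gerBl ltW.
    by move=> t /andP[t0 ty]; apply: hM; rewrite ty andbT (le_trans _ t0) // subr_ge0 ltW.
  have h3 : itg 0 l g = itg 0 (l - y) g + itg (l - y) l g.
    by apply: itg_split; rewrite ?subr_ge0 ?gerBl ?(ltW yl) ?(ltW y0) //; exact: cont_itgable.
  have := mono x (l - y) x0 yx; rewrite ltrBlDr ltrDl y0 => /(_ isT).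
  move: h1 h2; rewrite !ler_norml h3 {2}/Psi.
  by move=> /andP[? ?] /andP[? ?] ?; lra.
move=> Psi' x xl; split; first by rewrite [Psi' x](_ : _ = Psi x) // low //= high.
exact: der.
Qed.

End Wave.
End HalfSquare.

(** * Coercivity of the second variation on smooth functions *)

Section Coercivity.
Context {R : realType}.
Implicit Types (c A l s x : R) (phi v : R -> R).

Lemma der_le_move (F G : R -> R) x y :
  (forall t, Num.min x y <= t <= Num.max x y ->
    exists dF dG, [/\ has_deriv F t dF, has_deriv G t dG & `|dF| <= dG]) ->
  `|F x - F y| <= `|G x - G y|.
Proof.
wlog xy : x y / x <= y => [hwlog|].
  case/orP: (le_total x y) => xy h; first exact: hwlog.
  by rewrite (distrC (F x)) (distrC (G x)); apply: hwlog => // t; rewrite minC maxC; exact: h.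
rewrite (min_idPl xy) (max_idPr xy) => h.
have dd t : x <= t <= y -> [/\ has_deriv F t (derive1 F t), has_deriv G t (derive1 G t)
    & `|derive1 F t| <= derive1 G t].
  by move=> /h [dF [dG [h1 h2 h3]]]; rewrite (der_derive1 h1) (der_derive1 h2).
have h1 : G x - F x <= G y - F y.
  apply: (@der_ge0_le _ x y (fun t => G t - F t) (fun t => derive1 G t - derive1 F t)) => //.
    by move=> t /dd[? ? _]; der.
  by move=> t /dd[_ _]; rewrite ler_norml subr_ge0 => /andP[].
have h2 : G x + F x <= G y + F y.
  apply: (@der_ge0_le _ x y (fun t => G t + F t) (fun t => derive1 G t + derive1 F t)) => //.
    by move=> t /dd[? ? _]; der.
  by move=> t /dd[_ _]; rewrite ler_norml => /andP[? ?]; lra.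
rewrite (distrC (G x)) (@ger0_norm _ (G y - G x)); last lra.
by rewrite ler_norml; apply/andP; split; lra.
Qed.

Section Wave.
Variables (c A l : R) (phi phi1 : R -> R).
Hypothesis hw : half_wave c A l phi phi1.
Let a := phi 0.
Let b := phi l.
Let f := force c A.
Let om := freq c A a b.
Let l0 : 0 < l. Proof. exact: hw_l hw. Qed.
Let p := hw_profile hw.
Let om0 : 0 < om. Proof. exact: hw_freq hw. Qed.

Let vel0 x : 0 < x < l -> 0 < `|phi1 x|.
Proof.
move=> xl; have h := hw_mono hw xl; rewrite normr_gt0.
by apply: contraTneq h => ->; rewrite mulr0 ltxx.
Qed.

(* the contexts of the estimates below are long, and few hypotheses matter *)
Tactic Notation "lra" "from" hyp_list(hs) :=
  clear - hs hw a b f om l0 p om0 vel0; lra.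

Definition half_form v v1 := itg 0 l (half_integrand c A l phi v v1).

(** The growth of the potential over the middle third of the half period. *)
Lemma half_form_ends v v1 : (forall x, has_deriv v x (v1 x)) -> continuous v1 ->
  om ^+ 2 * l / 6 * (v 0 ^+ 2 + v l ^+ 2) <= half_form v v1.
Proof.
move=> dv cv1; have hP := half_square hw dv cv1; set Psi := half_potential _ _ _ _ _ _ _ in hP.
have L0 : 0 < l := l0.
pose k := om ^+ 2 / 2 * (v 0 ^+ 2 + v l ^+ 2).
have in3 : 0 < l / 3 < l by apply/andP; split; lra.
have in23 : 0 < 2 * l / 3 < l by apply/andP; split; lra.
have [/andP[q0 _] _] := hP _ in3; have [/andP[_ q1] _] := hP _ in23.
have : Psi (l / 3) - k * (l / 3) <= Psi (2 * l / 3) - k * (2 * l / 3).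
  apply: (@der_ge0_le _ _ _ (fun x => Psi x - k * x) (fun x => derive1 Psi x - k)).
  - by lra.
  - move=> x /andP[x0 xl]; have [|_ [D dD _]] := hP x; first by apply/andP; split; lra.
    by rewrite (der_derive1 dD); apply: der_eq; [der|rewrite /=; ring].
  - move=> x /andP[x0 xl]; have [|_ [D dD hD]] := hP x; first by apply/andP; split; lra.
    by rewrite (der_derive1 dD) subr_ge0; apply: le_trans hD; rewrite lerDr sqr_ge0.
have -> : om ^+ 2 * l / 6 * (v 0 ^+ 2 + v l ^+ 2) = k * (2 * l / 3) - k * (l / 3).
  by rewrite /k; field.
by move: q0 q1; rewrite -/(half_form v v1) => ? ?; lra.
Qed.

(** The barrier of the constant function [1]. It blows up no faster than
    [1 / phi1], because the defect of a constant is bounded by [half_square]. *)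
Lemma inverse_square_primitive : exists T K e, [/\ 0 < e, 0 < K,
  forall x, 0 < x < l -> exists2 D, has_deriv T x D & e / phi1 x ^+ 2 <= D &
  forall x, 0 < x < l -> `|phi1 x| * `|T x| <= K].
Proof.
have L0 : 0 < l := l0.
pose r := quad c A a b 1 1.
pose T x := barrier c A a b 1 1 (phi x).
have cr : continuous (fun x => r (phi x)).
  have ? := profile_cont p; rewrite /r /quad /ucoord.
  by cont.
have cf := profile_cont_force p; have cp := profile_cont1 p.
have c1 : continuous (fun x => r (phi x) ^+ 2 + om ^+ 2 * phi1 x ^+ 2).
  by apply: cont_add; [apply: cont_exp; exact: cr|cont].
have c2 : continuous (fun x => - f (phi x) + 2 * r (phi x)).
  by apply: cont_add; [exact: cont_opp cf|apply: cont_mul; [exact: cont_cst|exact: cr]].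
have [||e e0 he] := @cont_pos_min R 0 l
    (fun x => r (phi x) ^+ 2 + om ^+ 2 * phi1 x ^+ 2) (ltW l0).
- by move=> x _; exact: c1.
- move=> x /andP[]; rewrite le_eqVlt => /predU1P[<- _|x0].
    rewrite (hw_crit0 hw) /r (quad_left hw) mulr1 expr0n mulr0 addr0.
    by rewrite exprn_even_gt0 //; exact: hw_force0 hw.
  rewrite le_eqVlt => /predU1P[->|xl].
    rewrite (hw_critl hw) /r quadC.
    have := quad_left (half_wave_reflect hw) 1 1; rewrite /= subrr subr0 => ->.
    rewrite mulr1 expr0n mulr0 addr0.
    by rewrite exprn_even_gt0 //; exact: hw_forcel hw.
  have v2 : 0 < phi1 x ^+ 2 by rewrite exprn_even_gt0 //= -normr_gt0 vel0 // x0.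
  by rewrite ltr_wpDl ?sqr_ge0 // mulr_gt0 // exprn_gt0.
have hP := half_square hw (fun x => der_cst 1 x) (@cont_cst R 0).
set g := half_integrand _ _ _ _ _ _ in hP.
have cg : continuous g.
  by apply: cont_half_integrand p _ _; exact: cont_cst.
set S := itg 0 l g in hP.
have S0 : 0 <= S.
  have [|/andP[h1 h2] _] := hP (l / 2); first by apply/andP; split; lra.
  exact: le_trans h1 h2.
have [|M1 M10 hM1] := @cont_bounded R 0 l (fun x => - f (phi x) + 2 * r (phi x)).
  by move=> x _; exact: c2.
have [|M2 M20 hM2] := @cont_bounded R 0 l phi1.
  by move=> x _; exact: cp.
have [M3 M30 hM3] : exists2 M, 0 < M & forall x, 0 < x < l ->
    `|defect c A l phi phi1 (fun=> 1) x| <= M.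
  have [|M M0 hM] := @cont_bounded R 0 l g; first by move=> x _; exact: cg.
  exists (S + M * l); first by rewrite ltr_wpDl // mulr_gt0.
  move=> x xl; have [/andP[h1 h2] _] := hP x xl.
  have : `|itg 0 x g| <= M * (x - 0).
    case/andP: xl => x0 xl; apply: itg_le_bound cg _; first exact: ltW.
    by move=> t /andP[t0 tx]; apply: hM; rewrite t0 (le_trans tx) ?ltW.
  have : M * x <= M * l by rewrite ler_pM2l // ltW //; case/andP: xl.
  move: h1 h2; rewrite /half_potential -/g subr0 !ler_norml.
  by move=> ? ? ? /andP[? ?]; apply/andP; split; lra.
exists T, (M1 + M2 * M3), e; split=> //.
- by rewrite addr_gt0 // mulr_gt0.
- move=> x xl; have [D dD hD] := barrier_deriv hw 1 1 xl.
  exists D => //; apply: le_trans hD.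
  rewrite -/a -/b -/om -/(r (phi x)).
  have v0 : 0 < phi1 x ^+ 2 by rewrite exprn_even_gt0 //= -normr_gt0 vel0.
  rewrite ler_pdivrMr // mulrDl divfK ?gt_eqF //.
  rewrite expr1n (_ : om ^+ 2 / 2 * (1 + 1) = om ^+ 2); last by field.
  by apply: he; case/andP: xl => /ltW -> /ltW ->.
move=> x xl; have xl' : 0 <= x <= l by case/andP: xl => /ltW -> /ltW ->.
have v0 := vel0 xl; have vn : phi1 x != 0 by rewrite -normr_gt0.
have E : phi1 x * T x = - f (phi x) + 2 * r (phi x)
    - phi1 x * defect c A l phi phi1 (fun=> 1) x.
  rewrite /defect /= expr1n !mulr1 -/a -/b -/(r (phi x)) -/(T x) -/(f (phi x)).
  by field.
rewrite -normrM E; apply: le_trans (ler_normB _ _) _.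
by rewrite normrM lerD ?hM1 // ler_pM // ?hM2 ?hM3.
Qed.

(** The quotient [v / phi1] has derivative [m / phi1 + r / phi1 ^ 2], where [m]
    is the expression squared in [half_square]. By Young's inequality this is at
    most the derivative of a combination [G] of the potential and of the
    primitive of [1 / phi1 ^ 2]; multiplied by [phi1] the variation of [G] stays
    bounded up to the extrema. *)
Lemma half_control : exists2 K, 0 < K & forall v v1,
  (forall x, has_deriv v x (v1 x)) -> continuous v1 ->
  forall sg, 0 < sg -> half_form v v1 <= sg ^+ 2 ->
  forall x, 0 < x < l -> `|v x - v (l / 2) / phi1 (l / 2) * phi1 x| <= K * sg.
Proof.
have L0 : 0 < l := l0.
have mid : 0 < l / 2 < l by apply/andP; split; lra.
have [T [KT [e [e0 KT0 dT hT]]]] := inverse_square_primitive.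
have [|Mp Mp0 hMp] := @cont_bounded R 0 l phi1.
  by move=> x _; exact: (profile_cont1 p).
pose c0 := om ^+ 2 * l / 6.
have c00 : 0 < c0 by rewrite /c0 divr_gt0 // mulr_gt0 // exprn_gt0.
pose q := c0^-1 + 1.
have q0 : 0 < q by rewrite addr_gt0 // invr_gt0.
pose CR := `|b - a| * (amp c A a b + amp c A b a) ^+ 2.
have CR0 : 0 <= CR by rewrite mulr_ge0 ?sqr_ge0.
pose ro := CR * (q + q).
have ro0 : 0 <= ro by rewrite mulr_ge0 // addr_ge0 // ltW.
pose kap := (2^-1 + ro) / e.
have kap0 : 0 < kap by rewrite divr_gt0 // ltr_wpDr // invr_gt0.
pose KK := Mp / 2 + kap * (KT + Mp * `|T (l / 2)|).
have KK0 : 0 < KK.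
  rewrite /KK addr_gt0 ?divr_gt0 // mulr_gt0 // ltr_wpDr //.
  by rewrite mulr_ge0 // ltW.
exists KK => // v v1 dv cv1 sg sg0 hS x xl.
have hP := half_square hw dv cv1; set Psi := half_potential _ _ _ _ _ _ _ in hP.
have ends := half_form_ends dv cv1; rewrite -/c0 in ends.
have small y : y ^+ 2 <= v 0 ^+ 2 + v l ^+ 2 -> `|y| <= q * sg.
  move=> hy; rewrite -(@ler_pXn2r _ 2) ?nnegrE ?mulr_ge0 ?(ltW q0) ?(ltW sg0) //.
  rewrite real_normK ?num_real // exprMn.
  have h1 : c0 * y ^+ 2 <= sg ^+ 2.
    by apply: le_trans hS; apply: le_trans ends; rewrite ler_pM2l.
  have h2 : y ^+ 2 <= c0^-1 * sg ^+ 2 by rewrite mulrC ler_pdivlMr // mulrC.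
  apply: le_trans h2 _; rewrite ler_pM2r ?exprn_gt0 //.
  have : 0 < c0^-1 by rewrite invr_gt0.
  by rewrite /q; set z := c0^-1 => z0; have := sqr_ge0 z; lra.
have al_le : `|v 0| <= q * sg by apply: small; rewrite lerDl sqr_ge0.
have be_le : `|v l| <= q * sg by apply: small; rewrite lerDr sqr_ge0.
pose r := quad c A a b (v 0) (v l).
have r_le y : 0 < y < l -> `|r (phi y)| <= ro * sg.
  move=> yl; apply: le_trans (quad_le hw _ _ yl) _.
  by rewrite -/a -/b -/CR /ro -mulrA ler_wpM2l // mulrDl lerD.
pose F y := v y / phi1 y.
pose G y := (2 * sg)^-1 * Psi y + kap * sg * T y.
have dF y : 0 < y < l -> has_deriv F y
    ((v1 y - (r (phi y) - f (phi y) * v y) / phi1 y) / phi1 y + r (phi y) / phi1 y ^+ 2).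
  move=> yl; have p0 : phi1 y != 0 by rewrite -normr_gt0 vel0.
  have ? := dv y; have ? := pr_der1 p y.
  by rewrite /F; apply: der_eq; [der|rewrite /= -/(f (phi y)); field].
have move_le : `|F x - F (l / 2)| <= `|G x - G (l / 2)|.
  apply: der_le_move => y /andP[ym yM].
  have yl : 0 < y < l.
    case/andP: xl => x0 xl; case/andP: mid => m0 ml; apply/andP; split.
      by apply: lt_le_trans ym; rewrite lt_min x0.
    by apply: le_lt_trans yM _; rewrite gt_max xl.
  have [_ [DP dP hDP]] := hP y yl; have [DT dTy hDT] := dT y yl.
  exists ((v1 y - (r (phi y) - f (phi y) * v y) / phi1 y) / phi1 y + r (phi y) / phi1 y ^+ 2),
    ((2 * sg)^-1 * DP + kap * sg * DT); split.
  - exact: dF.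
  - by rewrite /G; apply: der_eq; [der|rewrite /=; ring].
  set m := v1 y - _.
  have p2 : 0 < phi1 y ^+ 2 by rewrite exprn_even_gt0 //= -normr_gt0 vel0.
  have g1 : `|m / phi1 y| <= (2 * sg)^-1 * m ^+ 2 + sg / 2 * (phi1 y ^+ 2)^-1.
    rewrite -exprVn (_ : m ^+ 2 = sg * sg * (m / sg) ^+ 2); last by field; rewrite gt_eqF.
    rewrite normrM (_ : `|m| = sg * `|m / sg|); last first.
      by rewrite normrM normfV (gtr0_norm sg0) mulrCA divff ?mulr1 // gt_eqF.
    rewrite -(@real_normK _ (m / sg)) ?num_real // -(@real_normK _ (phi1 y)^-1) ?num_real //.
    set P := `|m / sg|; set Q := `|(phi1 y)^-1|.
    rewrite (_ : (2 * sg)^-1 * (sg * sg * P ^+ 2) = sg / 2 * P ^+ 2); last first.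
      by field; rewrite gt_eqF.
    have := mulr_ge0 (ltW sg0) (sqr_ge0 (P - Q)); lra from.
  have g2 : `|r (phi y) / phi1 y ^+ 2| <= ro * sg * (phi1 y ^+ 2)^-1.
    by rewrite normrM normfV (gtr0_norm p2) ler_pM2r ?invr_gt0 ?r_le.
  have g3 : (2 * sg)^-1 * m ^+ 2 <= (2 * sg)^-1 * DP.
    rewrite ler_pM2l ?invr_gt0 ?mulr_gt0 //; apply: le_trans hDP.
    by rewrite lerDl mulr_ge0 ?addr_ge0 ?sqr_ge0 // divr_ge0 ?sqr_ge0.
  have g4 : kap * sg * (e / phi1 y ^+ 2) <= kap * sg * DT.
    by rewrite ler_pM2l // mulr_gt0.
  have g5 : kap * sg * (e / phi1 y ^+ 2) = (sg / 2 + ro * sg) * (phi1 y ^+ 2)^-1.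
    have pn : phi1 y != 0 by rewrite -normr_gt0 vel0.
    by rewrite /kap; field; rewrite pn gt_eqF.
  by apply: le_trans (ler_normD _ _) _; rewrite g5 in g4; lra from g1 g2 g3 g4.
have [/andP[hx1 hx2] _] := hP x xl; have [/andP[hm1 hm2] _] := hP _ mid.
rewrite -/(half_form v v1) in hx2 hm2.
have px0 : 0 < `|phi1 x| by exact: vel0.
have px1 : `|phi1 x| <= Mp.
  by apply: hMp; case/andP: xl => /ltW -> /ltW ->.
have ks : 0 < kap * sg by rewrite mulr_gt0.
have G_le : `|phi1 x| * `|G x - G (l / 2)| <= KK * sg.
  have g1 : `|G x - G (l / 2)| <= sg / 2 + kap * sg * (`|T x| + `|T (l / 2)|).
    rewrite /G (_ : _ - _ = (2 * sg)^-1 * (Psi x - Psi (l / 2))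
      + kap * sg * (T x - T (l / 2))); last by ring.
    apply: le_trans (ler_normD _ _) _; apply: lerD.
      rewrite normrM gtr0_norm ?invr_gt0 ?mulr_gt0 //.
      apply: (@le_trans _ _ ((2 * sg)^-1 * sg ^+ 2)).
        rewrite ler_pM2l ?invr_gt0 ?mulr_gt0 // ler_norml.
        by apply/andP; split; lra from hx1 hx2 hm1 hm2 hS.
      by rewrite le_eqVlt; apply/orP; left; apply/eqP; field; rewrite gt_eqF.
    by rewrite normrM (gtr0_norm ks) (ler_pM2l ks) ler_normB.
  apply: (@le_trans _ _ (`|phi1 x| * (sg / 2 + kap * sg * (`|T x| + `|T (l / 2)|)))).
    by rewrite ler_pM2l.
  have g2 := hT x xl.
  have g3 : `|phi1 x| * (sg / 2) <= Mp * (sg / 2) by rewrite ler_pM2r // divr_gt0.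
  have g4 : kap * sg * (`|phi1 x| * `|T x|) <= kap * sg * KT.
    by rewrite ler_pM2l // mulr_gt0.
  have g5 : kap * sg * (`|phi1 x| * `|T (l / 2)|) <= kap * sg * (Mp * `|T (l / 2)|).
    by rewrite (ler_pM2l ks) ler_wpM2r.
  by rewrite /KK; lra from g2 g3 g4 g5.
apply: le_trans G_le; apply: le_trans (_ : `|phi1 x| * `|F x - F (l / 2)| <= _).
  rewrite -normrM /F le_eqVlt; apply/orP; left; apply/eqP; congr (`| _ |).
  have n1 : phi1 x != 0 by rewrite -normr_gt0.
  have n2 : phi1 (l / 2) != 0 by rewrite -normr_gt0 vel0.
  by field; rewrite ?n1 ?n2.
by rewrite ler_pM2l.
Qed.

End Wave.
End Coercivity.

Section FullPeriod.
Context {R : realType}.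
Implicit Types (c A l s x : R) (phi v : R -> R).

Lemma cont_bound_closed l M (g : R -> R) : 0 < l -> continuous g ->
  (forall x, 0 < x < l -> `|g x| <= M) -> forall x, 0 <= x <= l -> `|g x| <= M.
Proof.
move=> l0 cg hg x /andP[]; rewrite le_eqVlt => /predU1P[<- _|x0].
  apply: (@cont_le_right _ 0 l (fun x => `|g x|) (fun=> M)) => //.
    by apply: cvg_norm; exact: cg.
  exact: cvg_cst.
rewrite le_eqVlt => /predU1P[->|xl]; last by apply: hg; rewrite x0.
rewrite -[l in g l]subr0.
apply: (@cont_le_right _ 0 l (fun x => `|g (l - x)|) (fun=> M)) => //.
- by apply: (@cont_norm _ (fun x => g (l - x))); cont.
- exact: cvg_cst.
- by move=> y /andP[y0 yl]; apply: hg; apply/andP; split; lra.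
Qed.

(** The derivative of a quadratic polynomial is affine, so the term that it
    contributes to the form only involves the mean of [v] and its projection on
    the wave: these are the two constraints. *)
Lemma quad1_affine c A a b al be s : b - a != 0 ->
  quad1 c A a b al be s = al * quad1 c A a b 1 0 0 + be * quad1 c A a b 0 1 0
    + (al * (quad1 c A a b 1 0 1 - quad1 c A a b 1 0 0)
       + be * (quad1 c A a b 0 1 1 - quad1 c A a b 0 1 0)) * s.
Proof.
by move=> h; rewrite /quad1 /= !(ucoordC c A a b) /ucoord /sigma /tau; field.
Qed.

Section Wave.
Variables (c A l : R) (phi phi1 : R -> R).
Hypothesis hw : half_wave c A l phi phi1.
Hypothesis even : forall x, phi (- x) = phi x.
Hypothesis per : Defs.periodic (l + l) phi.
Let a := phi 0.
Let b := phi l.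
Let om := freq c A a b.
Let l0 : 0 < l. Proof. exact: hw_l hw. Qed.
Let p := hw_profile hw.
Let L := l + l.
Let nab : b - a != 0. Proof. exact: hw_neq hw. Qed.
Let om0 : 0 < om. Proof. exact: hw_freq hw. Qed.

(* the contexts of the estimates below are long, and few hypotheses matter *)
Tactic Notation "lra" "from" hyp_list(hs) :=
  clear - hs hw even per a b om l0 p L nab om0; lra.

Definition form v v1 :=
  itg 0 L (fun x => v1 x ^+ 2 - force1 c (phi x) * v x ^+ 2).

Lemma form_fold v v1 : (forall x, has_deriv v x (v1 x)) -> continuous v1 ->
  Defs.periodic L v -> Defs.periodic L v1 ->
  half_form c A l phi v v1 + half_form c A l phi (fun x => v (- x)) (fun x => - v1 (- x))
  = form v v1
    + 2 * itg 0 L (fun x => v x * quad1 c A a b (v 0) (v l) (phi x)).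
Proof.
move=> dv cv1 pv pv1; have cv := cont_der dv.
have cphi := profile_cont p; have cf := profile_cont_force1 p.
have cq : continuous (fun x => quad1 c A a b (v 0) (v l) (phi x)) by exact: cont_quad1.
pose g := half_integrand c A l phi v v1.
have cg : continuous g by apply: cont_half_integrand p _ _.
have vl : v (- l) = v l by rewrite -pv /L addrA addNr add0r.
have -> : form v v1 + 2 * itg 0 L (fun x => v x * quad1 c A a b (v 0) (v l) (phi x))
    = itg 0 L g.
  rewrite -itgZ; last by apply: cont_itgable; exact: cont_mul.
  rewrite /form -itgD.
  - by apply: eq_itg => x _; rewrite /g /half_integrand -/a -/b; ring.
  - apply: cont_itgable; apply: cont_add; first by cont.
    by apply: cont_opp; apply: cont_mul; [exact: cf|cont].
  - by apply: cont_itgable; apply: cont_mul; [cont|exact: cont_mul].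
rewrite [RHS]itg_fold //.
  congr (_ + _); apply: eq_itg => x _.
  by rewrite /g /half_integrand sqrrN oppr0 vl even.
move=> x; rewrite /g /half_integrand -/L.
by rewrite [phi (_ + _)]per pv pv1.
Qed.

(** On each half period [v] is close to a multiple of [phi1], which the second
    variation annihilates. The value at [l / 2] determines the multiple on the first
    half; the two multiples are tied by the mean of [v], since the integral of
    [phi1] over a half period is [phi l - phi 0]. *)
Lemma form_coercive : exists kap C, [/\ 0 < kap, 0 <= C & forall v v1,
  (forall x, has_deriv v x (v1 x)) -> continuous v1 ->
  Defs.periodic L v -> Defs.periodic L v1 ->
  kap * itg 0 L (fun x => v x ^+ 2) <= form v v1
    + C * (itg 0 L v ^+ 2 + itg 0 L (fun x => v x * phi x) ^+ 2 + v (l / 2) ^+ 2)].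
Proof.
have L0 : 0 < l := l0.
have LL0 : 0 < L by rewrite /L addr_gt0.
have [K K0 hK] := half_control hw.
have [|Mp Mp0 hMp] := @cont_bounded R 0 l phi1.
  by move=> x _; exact: (profile_cont1 p).
have mid : 0 < l / 2 < l by apply/andP; split; lra.
have pm : phi1 (l / 2) != 0.
  by have h := hw_mono hw mid; apply: contraTneq h => ->; rewrite mulr0 ltxx.
pose c0 := om ^+ 2 * l / 6.
have c00 : 0 < c0 by rewrite /c0 divr_gt0 // mulr_gt0 // exprn_gt0.
pose Q := `|quad1 c A a b 1 0 0| + `|quad1 c A a b 0 1 0|
  + `|quad1 c A a b 1 0 1 - quad1 c A a b 1 0 0|
  + `|quad1 c A a b 0 1 1 - quad1 c A a b 0 1 0|.
have Q0 : 0 <= Q by rewrite !addr_ge0.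
pose C1 := 4 * Q ^+ 2 / c0.
have C10 : 0 <= C1 by rewrite divr_ge0 ?(ltW c00) // mulr_ge0 ?sqr_ge0.
pose d2 := (b - a) ^+ 2.
have d20 : 0 < d2 by rewrite exprn_even_gt0.
pose m2 := phi1 (l / 2) ^+ 2.
have m20 : 0 < m2 by rewrite exprn_even_gt0.
pose B1 := l * (2 * Mp ^+ 2 * (12 * K ^+ 2 * l ^+ 2 / d2) + 4 * K ^+ 2).
pose B2 := l * (2 * Mp ^+ 2 * (4 / m2 + 3 / d2)).
have B10 : 0 < B1.
  have j1 : 0 < K ^+ 2 by rewrite exprn_gt0.
  have j2 : 0 <= l ^+ 2 / d2 by apply: divr_ge0; [exact: sqr_ge0|exact: ltW].
  have j3 : 0 <= K ^+ 2 * (l ^+ 2 / d2) by rewrite mulr_ge0 // ltW.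
  have j4 : 0 <= Mp ^+ 2 * (K ^+ 2 * (l ^+ 2 / d2)) by rewrite mulr_ge0 ?sqr_ge0.
  by rewrite /B1 mulr_gt0 //; lra.
have i1 : 0 < 4 / m2 by rewrite divr_gt0.
have i2 : 0 < 3 / d2 by rewrite divr_gt0.
have B20 : 0 <= B2.
  apply: mulr_ge0; first exact: ltW.
  by apply: mulr_ge0; [apply: mulr_ge0; rewrite ?sqr_ge0|apply: addr_ge0; exact: ltW].
exists (2 * B1)^-1, (C1 + B2 / (2 * B1)); split.
- by rewrite invr_gt0 mulr_gt0.
- by rewrite addr_ge0 // divr_ge0 // ltW // mulr_gt0.
move=> v v1 dv cv1 pv pv1; have cv := cont_der dv.
set V2 := itg 0 L (fun x => v x ^+ 2); set I1 := itg 0 L v.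
set I2 := itg 0 L (fun x => v x * phi x).
pose w x := v (- x); pose w1 x := - v1 (- x).
have dw x : has_deriv w x (w1 x).
  by have ? := dv (- x); rewrite /w /w1; apply: der_eq; [der|rewrite /=; ring].
have cw : continuous w by exact: cont_der dw.
have cw1 : continuous w1 by rewrite /w1; cont.
have fold := form_fold dv cv1 pv pv1; rewrite -/w -/w1 in fold.
have w0E : w 0 = v 0 by rewrite /w oppr0.
have wlE : w l = v l by rewrite /w -pv /L addrA addNr add0r.
set Sp := half_form _ _ _ _ v v1 in fold.
set Sm := half_form _ _ _ _ w w1 in fold.
have ep : c0 * (v 0 ^+ 2 + v l ^+ 2) <= Sp by exact: (half_form_ends hw).
have em : c0 * (v 0 ^+ 2 + v l ^+ 2) <= Sm.
  by have := half_form_ends hw dw cw1; rewrite w0E wlE.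
pose e0 := v 0 * quad1 c A a b 1 0 0 + v l * quad1 c A a b 0 1 0.
pose e1 := v 0 * (quad1 c A a b 1 0 1 - quad1 c A a b 1 0 0)
  + v l * (quad1 c A a b 0 1 1 - quad1 c A a b 0 1 0).
have qE : itg 0 L (fun x => v x * quad1 c A a b (v 0) (v l) (phi x)) = e0 * I1 + e1 * I2.
  have ? := profile_cont p.
  rewrite /I1 /I2 -!itgZ; [|apply: cont_itgable; cont|apply: cont_itgable; cont].
  rewrite -itgD; [|apply: cont_itgable; cont|apply: cont_itgable; cont].
  by apply: eq_itg => x _; rewrite (quad1_affine _ _ _ _ _ nab) /e0 /e1; ring.
pose n2 := v 0 ^+ 2 + v l ^+ 2.
have n20 : 0 <= n2 by rewrite addr_ge0 ?sqr_ge0.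
have cross : 2 * (e0 * I1 + e1 * I2) <= c0 * n2 + C1 * (I1 ^+ 2 + I2 ^+ 2).
  pose P := `|v 0| + `|v l|; pose N := `|I1| + `|I2|.
  have P0 : 0 <= P by rewrite addr_ge0.
  have N0 : 0 <= N by rewrite addr_ge0.
  have P2 : P ^+ 2 <= 2 * n2.
    rewrite /P /n2 -(@real_normK _ (v 0)) ?num_real // -(@real_normK _ (v l)) ?num_real //.
    by have := sqr_ge0 (`|v 0| - `|v l|); lra from.
  have N2 : N ^+ 2 <= 2 * (I1 ^+ 2 + I2 ^+ 2).
    rewrite /N -(@real_normK _ I1) ?num_real // -(@real_normK _ I2) ?num_real //.
    by have := sqr_ge0 (`|I1| - `|I2|); lra from.
  have le_e (z1 z2 q1 q2 : R) : `|q1| + `|q2| <= Q -> `|z1 * q1 + z2 * q2| <= Q * (`|z1| + `|z2|).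
    move=> hq; apply: le_trans (ler_normD _ _) _; rewrite !normrM.
    have h1 : `|q1| <= Q by apply: le_trans hq; rewrite lerDl.
    have h2 : `|q2| <= Q by apply: le_trans hq; rewrite lerDr.
    have := ler_wpM2l (normr_ge0 z1) h1; have := ler_wpM2l (normr_ge0 z2) h2; lra from.
  have E0 : `|e0| <= Q * P.
    by apply: le_e; rewrite /Q -[leRHS]addrA lerDl addr_ge0.
  have E1 : `|e1| <= Q * P.
    by apply: le_e; rewrite /Q -[leRHS]addrA lerDr addr_ge0.
  have h1 : e0 * I1 + e1 * I2 <= Q * P * N.
    apply: le_trans (ler_norm _) _; apply: le_trans (ler_normD _ _) _.
    rewrite !normrM /N mulrDr.
    by apply: lerD; rewrite ler_wpM2r.
  have h2 : 2 * (Q * P * N) <= c0 / 2 * P ^+ 2 + 2 * Q ^+ 2 / c0 * N ^+ 2.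
    rewrite -subr_ge0 (_ : _ - _ = (c0 * P - 2 * Q * N) ^+ 2 / (2 * c0)).
      by rewrite divr_ge0 ?sqr_ge0 // mulr_ge0 // ltW.
    by field; rewrite gt_eqF.
  have h3 : c0 / 2 * P ^+ 2 <= c0 / 2 * (2 * n2) by rewrite ler_wpM2l // divr_ge0 // ltW.
  have h4 : 2 * Q ^+ 2 / c0 * N ^+ 2 <= 2 * Q ^+ 2 / c0 * (2 * (I1 ^+ 2 + I2 ^+ 2)).
    by rewrite ler_wpM2l // divr_ge0 ?(ltW c00) // mulr_ge0 ?sqr_ge0.
  have -> : C1 * (I1 ^+ 2 + I2 ^+ 2) = 2 * Q ^+ 2 / c0 * (2 * (I1 ^+ 2 + I2 ^+ 2)).
    by rewrite /C1; field; rewrite gt_eqF.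
  by lra from h1 h2 h3 h4.
pose NN := form v v1 + C1 * (I1 ^+ 2 + I2 ^+ 2).
rewrite qE in fold; rewrite -/n2 in ep em.
have c0n : 0 <= c0 * n2 by rewrite mulr_ge0 // ltW.
have SpN : Sp <= 2 * NN by rewrite /NN; lra from ep em cross fold c0n.
have SmN : Sm <= 2 * NN by rewrite /NN; lra from ep em cross fold c0n.
have NN0 : 0 <= NN by lra from ep SpN c0n.
(* [e] makes the bound on the half forms positive, as [half_control] requires *)
pose k := v (l / 2) / phi1 (l / 2); pose k' := w (l / 2) / phi1 (l / 2).
have main e : 0 < e -> V2 <= B1 * (2 * NN + e) + B2 * (I1 ^+ 2 + v (l / 2) ^+ 2).
  move=> e_gt0; pose sg := Num.sqrt (2 * NN + e).
  have sgp : 0 < 2 * NN + e by rewrite ltr_wpDl // mulr_ge0.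
  have sg0 : 0 < sg by rewrite sqrtr_gt0.
  have sg2 : sg ^+ 2 = 2 * NN + e by rewrite sqr_sqrtr // ltW.
  have cp1 := profile_cont1 p.
  have hp : forall x, 0 <= x <= l -> `|v x - k * phi1 x| <= K * sg.
    apply: cont_bound_closed => //; first by cont.
    by apply: (hK v v1 dv cv1 sg sg0); rewrite -/Sp sg2; lra from SpN e_gt0.
  have hm : forall x, 0 <= x <= l -> `|w x - k' * phi1 x| <= K * sg.
    apply: cont_bound_closed => //; first by cont.
    by apply: (hK w w1 dw cw1 sg sg0); rewrite -/Sm sg2; lra from SmN e_gt0.
  have phiI : itg 0 l phi1 = b - a.
    by apply: (@itg_der _ 0 l phi phi1) => //; [exact: ltW|move=> x _; exact: pr_der p x].
  have sp : `|itg 0 l v - k * (b - a)| <= K * sg * l.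
    rewrite -phiI -itgZ -?itgB; try by apply: cont_itgable; cont.
    rewrite -[l in K * sg * l]subr0; apply: itg_le_bound => //; [exact: ltW|cont].
  have sm : `|itg 0 l w - k' * (b - a)| <= K * sg * l.
    rewrite -phiI -itgZ -?itgB; try by apply: cont_itgable; cont.
    rewrite -[l in K * sg * l]subr0; apply: itg_le_bound => //; [exact: ltW|cont].
  have I1E : I1 = itg 0 l v + itg 0 l w by exact: itg_fold.
  have V2E : V2 = itg 0 l (fun x => v x ^+ 2) + itg 0 l (fun x => w x ^+ 2).
    rewrite /V2 /L itg_fold //; first by cont.
    by move=> x; rewrite pv.
  have sq (u : R -> R) (j : R) : continuous u ->
      (forall x, 0 <= x <= l -> `|u x - j * phi1 x| <= K * sg) ->
      itg 0 l (fun x => u x ^+ 2) <= (2 * Mp ^+ 2 * j ^+ 2 + 2 * (K * sg) ^+ 2) * l.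
    move=> cu hu; rewrite -[l in _ * l]subr0 -itg_cst ?(ltW l0) //.
    apply: le_itg; [apply: cont_itgable; cont|apply: cont_itgable; exact: cont_cst|].
    move=> x xl; have h1 : (u x - j * phi1 x) ^+ 2 <= (K * sg) ^+ 2.
      rewrite -(@real_normK _ (u x - _)) ?num_real // lerXn2r ?nnegrE ?hu //.
      by rewrite mulr_ge0 // ltW.
    have h2 : phi1 x ^+ 2 <= Mp ^+ 2.
      rewrite -(@real_normK _ (phi1 x)) ?num_real // lerXn2r ?nnegrE ?hMp //.
      exact: ltW.
    have h3 : j ^+ 2 * phi1 x ^+ 2 <= j ^+ 2 * Mp ^+ 2 by rewrite ler_wpM2l ?sqr_ge0.
    have := sqr_ge0 (u x - 2 * j * phi1 x); lra from h1 h2 h3.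
  have V2_le : V2 <= l * (2 * Mp ^+ 2 * (k ^+ 2 + k' ^+ 2) + 4 * K ^+ 2 * sg ^+ 2).
    have := sq _ _ cv hp; have := sq _ _ cw hm; rewrite V2E; lra from.
  have kk' : k' ^+ 2 <= 3 * (I1 ^+ 2 / d2) + 3 * k ^+ 2 + 12 * K ^+ 2 * l ^+ 2 / d2 * sg ^+ 2.
    have h1 : `|k' * (b - a)| <= `|I1| + `|k * (b - a)| + 2 * (K * sg * l).
      rewrite (_ : k' * (b - a) = I1 - k * (b - a) - (itg 0 l v - k * (b - a))
        - (itg 0 l w - k' * (b - a))); last by rewrite I1E; ring.
      apply: le_trans (ler_normB _ _) _; apply: le_trans (lerD (ler_normB _ _) (lexx _)) _.
      apply: le_trans (lerD (lerD (ler_normB _ _) (lexx _)) (lexx _)) _.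
      by lra from sp sm.
    have h2 : (k' * (b - a)) ^+ 2 <= 3 * I1 ^+ 2 + 3 * (k * (b - a)) ^+ 2
        + 12 * (K * sg * l) ^+ 2.
      rewrite -(@real_normK _ (k' * _)) ?num_real // -(@real_normK _ I1) ?num_real //.
      rewrite -(@real_normK _ (k * _)) ?num_real //.
      set X := `|k' * (b - a)| in h1 *; set Y := `|I1| in h1 *.
      set Z := `|k * (b - a)| in h1 *; set W := K * sg * l in h1 *.
      have X0 : 0 <= X by exact: normr_ge0.
      have Y0 : 0 <= Y by exact: normr_ge0.
      have Z0 : 0 <= Z by exact: normr_ge0.
      have W0 : 0 <= W by rewrite /W !mulr_ge0 // ltW.
      have h3 : X ^+ 2 <= (Y + Z + 2 * W) ^+ 2.
        by rewrite lerXn2r // nnegrE !addr_ge0 // mulr_ge0.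
      have := sqr_ge0 (Y - Z); have := sqr_ge0 (Y - 2 * W); have := sqr_ge0 (Z - 2 * W).
      lra from h3.
    rewrite exprMn -/d2 in h2.
    rewrite -(ler_pM2r d20); apply: le_trans h2 _.
    rewrite le_eqVlt; apply/orP; left; apply/eqP; rewrite [(k * _) ^+ 2]exprMn -/d2.
    by field; rewrite gt_eqF.
  have kE : k ^+ 2 = v (l / 2) ^+ 2 / m2 by rewrite /k /m2 expr_div_n.
  have h5 : 2 * Mp ^+ 2 * (k ^+ 2 + k' ^+ 2) <= 2 * Mp ^+ 2 * (4 * k ^+ 2 + 3 * (I1 ^+ 2 / d2)
      + 12 * K ^+ 2 * l ^+ 2 / d2 * sg ^+ 2).
    by rewrite ler_wpM2l ?mulr_ge0 ?sqr_ge0 //; lra from kk' Mp0.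
  apply: le_trans V2_le _.
  have -> : B1 * (2 * NN + e) + B2 * (I1 ^+ 2 + v (l / 2) ^+ 2)
    = l * (2 * Mp ^+ 2 * (4 * k ^+ 2 + 3 * (I1 ^+ 2 / d2)
      + 12 * K ^+ 2 * l ^+ 2 / d2 * sg ^+ 2) + 4 * K ^+ 2 * sg ^+ 2)
      + l * (2 * Mp ^+ 2 * (4 * (I1 ^+ 2 / m2) + 3 * (v (l / 2) ^+ 2 / d2))).
    by rewrite /B1 /B2 -sg2 kE; field; rewrite !gt_eqF.
  have h6 : 0 <= l * (2 * Mp ^+ 2 * (4 * (I1 ^+ 2 / m2) + 3 * (v (l / 2) ^+ 2 / d2))).
    have j1 : 0 <= I1 ^+ 2 / m2 by apply: divr_ge0; [exact: sqr_ge0|exact: ltW].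
    have j2 : 0 <= v (l / 2) ^+ 2 / d2 by apply: divr_ge0; [exact: sqr_ge0|exact: ltW].
    apply: mulr_ge0; first exact: ltW.
    apply: mulr_ge0; [apply: mulr_ge0; rewrite ?sqr_ge0 //|lra from j1 j2].
  have h7 : l * (2 * Mp ^+ 2 * (k ^+ 2 + k' ^+ 2) + 4 * K ^+ 2 * sg ^+ 2) <=
    l * (2 * Mp ^+ 2 * (4 * k ^+ 2 + 3 * (I1 ^+ 2 / d2)
      + 12 * K ^+ 2 * l ^+ 2 / d2 * sg ^+ 2) + 4 * K ^+ 2 * sg ^+ 2).
    by rewrite ler_pM2l // lerD2r.
  by lra from h6 h7.
have : V2 <= B1 * (2 * NN) + B2 * (I1 ^+ 2 + v (l / 2) ^+ 2).
  apply/ler_addgt0Pr => e e_gt0; have := main (e / B1) (divr_gt0 e_gt0 B10).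
  by rewrite mulrDr [B1 * (e / B1)]mulrC divfK ?gt_eqF // => h; lra from h.
move=> h; have h' : (2 * B1)^-1 * V2 <= (2 * B1)^-1 * (B1 * (2 * NN)
    + B2 * (I1 ^+ 2 + v (l / 2) ^+ 2)).
  by rewrite ler_pM2l // invr_gt0 mulr_gt0.
apply: le_trans h' _.
have -> : (2 * B1)^-1 * (B1 * (2 * NN) + B2 * (I1 ^+ 2 + v (l / 2) ^+ 2))
  = NN + B2 / (2 * B1) * (I1 ^+ 2 + v (l / 2) ^+ 2) by field; rewrite gt_eqF.
have z1 : 0 <= C1 * v (l / 2) ^+ 2 by rewrite mulr_ge0 ?sqr_ge0.
have z2 : 0 <= B2 / (2 * B1) * I2 ^+ 2.
  by rewrite mulr_ge0 ?sqr_ge0 // divr_ge0 // mulr_ge0 // ltW.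
by rewrite /NN; lra from z1 z2.
Qed.

End Wave.
End FullPeriod.

Section AntisymmetricForm.
Context {R : realType}.
Implicit Types (c A l s x k y : R) (phi v : R -> R).

(** Completing the square with the tangent, which is regular on an interval
    shorter than half the period [2 pi / k]. *)
Lemma wirtinger_dirichlet k l y v (v1 : R -> R) : 0 < k -> 0 < l -> k * l < pi ->
  (forall x, has_deriv v x (v1 x)) -> continuous v1 -> v y = 0 -> v (y + l) = 0 ->
  0 <= itg y (y + l) (fun x => v1 x ^+ 2 - k ^+ 2 * v x ^+ 2).
Proof.
move=> k0 l0 kl dv cv1 v0 vl; have cv := cont_der dv.
set g := fun x => v1 x ^+ 2 - _.
have cg : continuous g by rewrite /g; cont.
pose H x := itg (y - 1) x g.
have dH x : y <= x -> has_deriv H x (g x).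
  by move=> yx; apply: itg_primitive => //; lra.
pose t x := k * (x - (y + l / 2)).
have cos0 x : y <= x <= y + l -> 0 < cos (t x).
  move=> /andP[yx xl]; apply: cos_gt0_pihalf.
  have h1 : k * (x - y) <= k * l by rewrite ler_pM2l //; lra.
  have h2 : 0 <= k * (x - y) by rewrite mulr_ge0 ?subr_ge0 // ltW.
  by rewrite /t; apply/andP; split; lra.
pose W x := H x + k * v x ^+ 2 * (sin (t x) * (cos (t x))^-1).
have : W y <= W (y + l).
  apply: (@der_ge0_le _ y (y + l) W
    (fun x => (v1 x + k * v x * (sin (t x) / cos (t x))) ^+ 2)).
  - by rewrite lerDl ltW.
  - move=> x xl; have cn : cos (t x) != 0 by rewrite gt_eqF // cos0.
    have ? := dH x ltac:(by case/andP: xl); have ? := dv x.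
    have ? : has_deriv t x k by rewrite /t; apply: der_eq; [der|rewrite /=; ring].
    rewrite /W; apply: der_eq; first by der.
    rewrite /= /g; move: (cos (t x)) (sin (t x)) cn => C S cn; field.
    exact: cn.
  - by move=> x _; exact: sqr_ge0.
rewrite /W v0 vl expr0n /= mulr0 !mul0r !addr0 => h.
have -> : itg y (y + l) g = H (y + l) - H y.
  apply: itg_der => //; first by rewrite lerDl ltW.
  by move=> x /andP[yx _]; exact: dH.
by rewrite subr_ge0.
Qed.

(** Two zeros half a period apart are created by subtracting a common value of
    [v] at two points half a period apart. *)
Lemma wirtinger_periodic k l v v1 : 0 < k -> 0 < l -> k * l < pi ->
  (forall x, has_deriv v x (v1 x)) -> continuous v1 ->
  Defs.periodic (l + l) v -> Defs.periodic (l + l) v1 ->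
  k ^+ 2 * (itg 0 (l + l) (fun x => v x ^+ 2) - itg 0 (l + l) v ^+ 2 / (l + l))
  <= itg 0 (l + l) (fun x => v1 x ^+ 2).
Proof.
move=> k0 l0 kl dv cv1 pv pv1; have cv := cont_der dv.
set L := l + l; have L0 : 0 < L by rewrite addr_gt0.
have [||x0 _ ex0] := @intermediate _ 0 l (fun x => v x - v (x + l)) 0 (ltW l0).
- move=> x _; have cx : continuous (fun x => v x - v (x + l)) by cont.
  exact: cx.
- rewrite add0r -[v (l + l)]/(v L) (_ : v L = v 0); last by rewrite -(pv 0) add0r.
  by case: (lerP (v 0) (v l)) => h; apply/orP; [left|right]; apply/andP; split; lra.
have {}ex0 : v (x0 + l) = v x0 by lra.
set d := v x0 in ex0.
pose w x := v x - d.
have dw x : has_deriv w x (v1 x).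
  by have ? := dv x; rewrite /w; apply: der_eq; [der|rewrite /=; ring].
have cw : continuous w by exact: cont_der dw.
pose g x := v1 x ^+ 2 - k ^+ 2 * w x ^+ 2.
have cg : continuous g by rewrite /g; cont.
have h1 : 0 <= itg x0 (x0 + l) g.
  by apply: wirtinger_dirichlet; rewrite // /w ?ex0 subrr.
have h2 : 0 <= itg (x0 + l) (x0 + l + l) g.
  apply: wirtinger_dirichlet; rewrite // /w ?ex0 ?subrr //.
  by rewrite -addrA pv subrr.
have pg : Defs.periodic L g by move=> x; rewrite /g /w pv pv1.
have : 0 <= itg 0 L g.
  rewrite -(itg_period x0 cg pg L0) itg_shift_zero //.
  rewrite (@itg_split _ x0 (x0 + l)); [|lra|rewrite /L; lra|exact: cont_itgable].
  by rewrite addrA addr_ge0.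
have -> : itg 0 L g = itg 0 L (fun x => v1 x ^+ 2)
    - k ^+ 2 * (itg 0 L (fun x => v x ^+ 2) - 2 * d * itg 0 L v + d ^+ 2 * L).
  have e : d ^+ 2 * L = itg 0 L (fun=> d ^+ 2) by rewrite itg_cst ?subr0 // ltW.
  rewrite e -[2 * d * _]itgZ -?itgB -?itgD -?itgZ -?itgB;
    try by apply: cont_itgable; cont.
  by apply: eq_itg => x _; rewrite /g /w; ring.
set V1 := itg 0 L _; set V2 := itg 0 L _; set I := itg 0 L v => h.
have sq : 0 <= d ^+ 2 * L - 2 * d * I + I ^+ 2 / L.
  rewrite (_ : _ + _ = (d * L - I) ^+ 2 / L); last by field; rewrite gt_eqF.
  by rewrite divr_ge0 ?sqr_ge0 // ltW.
have : 0 <= k ^+ 2 * (d ^+ 2 * L - 2 * d * I + I ^+ 2 / L) by rewrite mulr_ge0 ?sqr_ge0.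
by lra.
Qed.

Section Wave.
Variables (c A l : R) (phi phi1 : R -> R).
Hypothesis hw : half_wave c A l phi phi1.
Let l0 : 0 < l. Proof. exact: hw_l hw. Qed.
Let p := hw_profile hw.
Let L := l + l.

(** Sturm comparison of the derivative of the profile with a sine. *)
Lemma half_period_short k : 0 < k -> k ^+ 2 = 2 - c -> k * l < pi.
Proof.
move=> k0 k2; rewrite ltNge; apply/negP => h.
pose d := phi l - phi 0.
have [z [z0 zl zE]] : exists z : R, [/\ 0 < z, z <= l & k * z = pi].
  exists (pi / k); split; first by rewrite divr_gt0 // pi_gt0.
    by rewrite ler_pdivrMr // mulrC.
  by rewrite mulrC divfK // gt_eqF.
pose N x := - (d * (- force c A (phi x) * sin (k * x) - k * phi1 x * cos (k * x))).
have : N 0 < N z.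
  apply: (@der_gt0_lt _ 0 z N
    (fun x => (force1 c (phi x) - k ^+ 2) * (d * phi1 x) * sin (k * x)) z0).
    move=> x _; have ? := pr_der p x; have ? := pr_der1 p x.
    have ? : has_deriv (force c A) (phi x) (force1 c (phi x)).
      by apply: der_force; exact: profile_gt0 p.
    by rewrite /N; apply: der_eq; [der|rewrite /= -/(force c A _); ring].
  move=> x /andP[x0 xz]; apply: mulr_gt0; first apply: mulr_gt0.
  - rewrite /force1 k2 subr_gt0.
    rewrite (_ : ln (phi x ^+ 2) + 2 - c = ln (phi x ^+ 2) + (2 - c)); last by ring.
    by rewrite ltrDr ln_gt0 // exprn_egt1 // (pr_gt1 p).
  - by apply: (hw_mono hw); rewrite x0 (lt_le_trans xz).
  - apply: sin_gt0_pi; rewrite -zE ltr_pM2l // xz andbT.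
    exact: mulr_gt0.
rewrite /N (hw_crit0 hw) mulr0 sin0 !(mulr0, mul0r) subrr mulr0 oppr0.
rewrite zE sinpi cospi mulr0 mulrN1 opprK add0r.
rewrite oppr_gt0 mulrCA pmulr_rlt0 // ltNge => /negP; apply.
move: zl; rewrite le_eqVlt => /predU1P[->|zl]; first by rewrite (hw_critl hw) mulr0.
by apply/ltW/(hw_mono hw); rewrite z0.
Qed.

Definition form2 v v1 :=
  itg 0 L (fun x => v1 x ^+ 2 + (c + ln (phi x ^+ 2)) * v x ^+ 2).

Lemma cont_ln_profile : continuous (fun x => ln (phi x ^+ 2)).
Proof.
have h := profile_cont_force1 p.
rewrite (_ : (fun x => ln (phi x ^+ 2)) = (fun x => force1 c (phi x) + (c - 2))).
  by apply: cont_add; [exact: h|exact: cont_cst].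
by apply/funext => x; rewrite /force1; ring.
Qed.

(** For [c >= 1] the potential is positive. For [c < 1] the half period is
    shorter than [pi / sqrt (2 - c)], so that on functions of mean zero the
    kinetic term is at least [2 - c] times the mass. *)
Lemma form2_coercive : exists C, 0 <= C /\ forall v v1,
  (forall x, has_deriv v x (v1 x)) -> continuous v1 ->
  Defs.periodic L v -> Defs.periodic L v1 ->
  itg 0 L (fun x => v x ^+ 2) <= form2 v v1 + C * itg 0 L v ^+ 2.
Proof.
have L0 : 0 < L by rewrite addr_gt0.
have ln0 x : 0 <= ln (phi x ^+ 2).
  by rewrite ln_ge0 // exprn_ege1 // ltW // (pr_gt1 p).
have cln := cont_ln_profile.
case: (leP 1 c) => c1.
  exists 0; split=> // v v1 dv cv1 pv pv1; have cv := cont_der dv.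
  rewrite mul0r addr0 /form2; apply: le_itg; [apply: cont_itgable; cont| |].
    apply: cont_itgable; apply: cont_add; first by cont.
    by apply: cont_mul; [apply: cont_add; [exact: cont_cst|exact: cln]|cont].
  move=> x _; have := mulr_ge0 (_ : 0 <= c - 1 + ln (phi x ^+ 2)) (sqr_ge0 (v x)).
  by have := sqr_ge0 (v1 x); have := ln0 x; move=> h1 h2 /(_ ltac:(lra)); lra.
pose k := Num.sqrt (2 - c).
have k0 : 0 < k by rewrite sqrtr_gt0; lra.
have k2 : k ^+ 2 = 2 - c by rewrite sqr_sqrtr //; lra.
exists ((2 - c) / L); split; first by apply: divr_ge0; [lra|exact: ltW].
move=> v v1 dv cv1 pv pv1; have cv := cont_der dv.
have := wirtinger_periodic k0 l0 (half_period_short k0 k2) dv cv1 pv pv1.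
rewrite k2 -/L; set V1 := itg 0 L (fun x => v1 x ^+ 2).
set V2 := itg 0 L (fun x => v x ^+ 2); set I := itg 0 L v => h.
have : V1 + c * V2 <= form2 v v1.
  rewrite /V1 /V2 -itgZ -?itgD; try by apply: cont_itgable; cont.
  apply: le_itg; first by apply: cont_itgable; cont.
    apply: cont_itgable; apply: cont_add; first by cont.
    by apply: cont_mul; [apply: cont_add; [exact: cont_cst|exact: cln]|cont].
  by move=> x _; have := mulr_ge0 (ln0 x) (sqr_ge0 (v x)); lra.
have : 0 <= V2 by apply: itg_ge0 => x _; exact: sqr_ge0.
have -> : (2 - c) / L * I ^+ 2 = (2 - c) * (I ^+ 2 / L) by ring.
by lra.
Qed.

End Wave.
End AntisymmetricForm.

(** * Square-integrable functions and trigonometric smoothing *)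

Section SquareIntegrable.
Context {R : realType}.
Implicit Types (a b k x y L : R) (f g h v : R -> R).
Local Notation mu := (@lebesgue_measure R).

Lemma itgable_measurable a b f : itgable a b f -> measurable_fun `[a, b] f.
Proof. by move=> /measurable_int /measurable_realfun.measurable_EFinP. Qed.

Lemma le_itgable a b f g : measurable_fun `[a, b] f -> itgable a b g ->
  (forall x, a <= x <= b -> `|f x| <= g x) -> itgable a b f.
Proof.
move=> mf gi fg; apply: le_integrable gi => //.
  exact/measurable_realfun.measurable_EFinP.
move=> x /=; rewrite in_itv /= => xab; rewrite lee_fin.
exact: le_trans (fg x xab) (ler_norm _).
Qed.

Lemma cont_measurable a b f : continuous f -> measurable_fun `[a, b] f.
Proof. by move=> cf; apply: itgable_measurable; exact: cont_itgable. Qed.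

Lemma itgableM_cont a b f h : itgable a b f -> continuous h ->
  itgable a b (fun x => f x * h x).
Proof.
move=> fi ch; have [|M M0 hM] := @cont_bounded R a b h; first by move=> x _; exact: ch.
have nfi : itgable a b (fun x => M * `|f x|).
  by apply: itgableZ; exact: (integrable_norm fi).
apply: le_itgable nfi _.
  apply: measurable_realfun.measurable_funM; first exact: itgable_measurable.
  exact: cont_measurable.
by move=> x xab; rewrite normrM mulrC ler_wpM2r // hM.
Qed.

Lemma eq_itgable a b f g : (forall x, f x = g x) -> itgable a b f -> itgable a b g.
Proof. by move=> /funext ->. Qed.

Definition sq_itgable a b g :=
  measurable_fun `[a, b] g /\ itgable a b (fun x => g x ^+ 2).

Lemma sq_itgableM a b f g : sq_itgable a b f -> sq_itgable a b g ->
  itgable a b (fun x => f x * g x).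
Proof.
move=> [mf fi] [mg gi]; apply: le_itgable (itgableD fi gi) _.
  exact: measurable_realfun.measurable_funM.
move=> x _; rewrite normrM -(@real_normK _ (f x)) ?num_real //.
rewrite -(@real_normK _ (g x)) ?num_real //.
have := sqr_ge0 (`|f x| - `|g x|); have := sqr_ge0 (`|f x| + `|g x|).
by lra.
Qed.

Lemma cont_sq_itgable a b f : continuous f -> sq_itgable a b f.
Proof.
move=> cf; split; first exact: cont_measurable.
by apply: cont_itgable; cont.
Qed.

Lemma sq_itgable_itgable a b g : sq_itgable a b g -> itgable a b g.
Proof.
move=> sg; have := sq_itgableM sg (cont_sq_itgable a b (@cont_cst R 1)).
by apply: eq_itgable => x; rewrite mulr1.
Qed.

Lemma sq_itgableD a b f g : sq_itgable a b f -> sq_itgable a b g ->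
  sq_itgable a b (fun x => f x + g x).
Proof.
move=> sf sg; have [mf fi] := sf; have [mg gi] := sg; split.
  exact: measurable_realfun.measurable_funD.
have := itgableD (itgableD fi gi) (itgableZ 2 (sq_itgableM sf sg)).
by apply: eq_itgable => x; ring.
Qed.

Lemma sq_itgableZ a b k f : sq_itgable a b f -> sq_itgable a b (fun x => k * f x).
Proof.
move=> [mf fi]; split.
  by apply: measurable_realfun.measurable_funM => //; exact: cont_measurable (@cont_cst R k).
by have := itgableZ (k ^+ 2) fi; apply: eq_itgable => x; ring.
Qed.

Lemma sq_itgableB a b f g : sq_itgable a b f -> sq_itgable a b g ->
  sq_itgable a b (fun x => f x - g x).
Proof.
move=> sf sg; have := sq_itgableD sf (sq_itgableZ (-1) sg).
rewrite (_ : (fun _ => _) = (fun x => f x - g x)) //.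
by apply/funext => x; rewrite mulN1r.
Qed.

Lemma sq_itgable_cauchy a b f g : sq_itgable a b f -> sq_itgable a b g ->
  itg a b (fun x => f x * g x) ^+ 2
  <= itg a b (fun x => f x ^+ 2) * itg a b (fun x => g x ^+ 2).
Proof.
by move=> sf sg; apply: cauchy_schwarz; [case: sf|case: sg|exact: sq_itgableM].
Qed.

Lemma L2per_sq L g : L2per L g -> sq_itgable 0 L g.
Proof. by move=> [_ mg gi]; split=> //; exact: measurable_funTS. Qed.

End SquareIntegrable.

Section Trigonometric.
Context {R : realType}.
Variable L : R.
Hypothesis L0 : 0 < L.
Implicit Types (x y : R) (a b f g h v : R -> R) (K : R -> R -> R).

Let om : R := 2 * pi / L.
Let omL : om * L = pi + pi.
Proof. by rewrite /om divfK ?gt_eqF // mulr_natl mulr2n. Qed.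
Let om0 : 0 < om.
Proof. by rewrite divr_gt0 // mulr_gt0 // pi_gt0. Qed.

(** Trigonometric polynomials. This class is closed under differentiation, so
    its members are test functions, and it contains the smoothing kernels. *)
Inductive trig : (R -> R) -> Prop :=
| trig_cst k : trig (fun _ => k)
| trig_cos : trig (fun x => cos (om * x))
| trig_sin : trig (fun x => sin (om * x))
| trig_add f g : trig f -> trig g -> trig (fun x => f x + g x)
| trig_mul f g : trig f -> trig g -> trig (fun x => f x * g x).

Lemma trig_der f : trig f -> exists2 g, trig g & forall x, has_deriv f x (g x).
Proof.
elim=> {f} [k|||f g _ [f1 tf df] _ [g1 tg dg]|f g tf [f1 tf1 df] tg [g1 tg1 dg]].
- by exists (fun=> 0); [exact: trig_cst|move=> x; exact: der_cst].
- exists (fun x => - om * sin (om * x)).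
    by apply: (@trig_mul (fun=> - om)); [exact: trig_cst|exact: trig_sin].
  by move=> x; apply: der_eq; [der|rewrite /=; ring].
- exists (fun x => om * cos (om * x)).
    by apply: (@trig_mul (fun=> om)); [exact: trig_cst|exact: trig_cos].
  by move=> x; apply: der_eq; [der|rewrite /=; ring].
- exists (fun x => f1 x + g1 x); first exact: trig_add.
  by move=> x; apply: der_add.
- exists (fun x => f x * g1 x + g x * f1 x); last by move=> x; apply: der_mul.
  by apply: trig_add; exact: trig_mul.
Qed.

Lemma trig_cont f : trig f -> continuous f.
Proof. by move=> /trig_der[g _ dg]; exact: cont_der dg. Qed.

Lemma trig_periodic f : trig f -> Defs.periodic L f.
Proof.
elim=> {f} [k|||f g _ pf _ pg|f g _ pf _ pg] x //.
- by rewrite mulrDr omL addrA cosDpi cosDpi opprK.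
- by rewrite mulrDr omL addrA sinDpi sinDpi opprK.
- by rewrite pf pg.
- by rewrite pf pg.
Qed.

Lemma trig_test f : trig f -> test_fun L f.
Proof.
move=> tf; split; first exact: trig_periodic.
have tn n : trig (derive1n n f).
  elim: n => [//|n /trig_der[g tg dg]].
  rewrite derive1nS (_ : derive1 _ = g) //; apply/funext => x.
  exact: der_derive1 (dg x).
by move=> n x; have [g _ dg] := trig_der (tn n); have [] := dg x.
Qed.

(** Kernels that are finite sums of products; for these the differentiation
    under the integral and the exchange of integrals are finite sums. *)
Inductive sep : (R -> R -> R) -> Prop :=
| sep_prod a b : trig a -> trig b -> sep (fun x y => a x * b y)
| sep_add K1 K2 : sep K1 -> sep K2 -> sep (fun x y => K1 x y + K2 x y).

Lemma sep_mul K1 K2 : sep K1 -> sep K2 -> sep (fun x y => K1 x y * K2 x y).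
Proof.
move=> s1 s2; elim: s1 => {K1} [a b ta tb|K1 K1' _ h1 _ h1'].
  elim: s2 => {K2} [a' b' ta' tb'|K2 K2' _ h2 _ h2'].
    rewrite (_ : (fun _ _ => _) = (fun x y => (a x * a' x) * (b y * b' y))).
      by apply: sep_prod; exact: trig_mul.
    by apply/funext => x; apply/funext => y; rewrite mulrACA.
  rewrite (_ : (fun _ _ => _) = (fun x y => a x * b y * K2 x y + a x * b y * K2' x y)).
    exact: sep_add.
  by apply/funext => x; apply/funext => y; rewrite mulrDr.
rewrite (_ : (fun _ _ => _) = (fun x y => K1 x y * K2 x y + K1' x y * K2 x y)).
  exact: sep_add.
by apply/funext => x; apply/funext => y; rewrite mulrDl.
Qed.

Lemma sep_trig_r K x : sep K -> trig (K x).
Proof.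
elim=> {K} [a b ta tb|K1 K2 _ t1 _ t2]; last exact: trig_add.
by apply: trig_mul => //; exact: trig_cst.
Qed.

Lemma sep_swap K : sep K -> sep (fun x y => K y x).
Proof.
elim=> {K} [a b ta tb|K1 K2 _ t1 _ t2]; last exact: sep_add.
rewrite (_ : (fun _ _ => _) = (fun x y => b x * a y)); first exact: sep_prod.
by apply/funext => x; apply/funext => y; rewrite mulrC.
Qed.

Definition conv K v x := itg 0 L (fun y => v y * K x y).

Lemma sep_itgable K v x : sep K -> itgable 0 L v -> itgable 0 L (fun y => v y * K x y).
Proof. by move=> sK iv; apply: itgableM_cont iv _; exact/trig_cont/sep_trig_r. Qed.

Lemma conv_add K1 K2 v : sep K1 -> sep K2 -> itgable 0 L v ->
  conv (fun x y => K1 x y + K2 x y) v = (fun x => conv K1 v x + conv K2 v x).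
Proof.
move=> s1 s2 iv; apply/funext => x; rewrite /conv -itgD; try exact: sep_itgable.
by apply: eq_itg => y _; rewrite mulrDr.
Qed.

Lemma conv_prod a b v : trig b -> itgable 0 L v ->
  conv (fun x y => a x * b y) v = (fun x => a x * itg 0 L (fun y => v y * b y)).
Proof.
move=> tb iv; apply/funext => x; rewrite /conv -itgZ.
  by apply: eq_itg => y _; ring.
by apply: itgableM_cont iv _; exact: trig_cont.
Qed.

Lemma conv_trig K v : sep K -> itgable 0 L v -> trig (conv K v).
Proof.
move=> sK iv; elim: sK => {K} [a b ta tb|K1 K2 s1 t1 s2 t2].
  by rewrite conv_prod //; apply: trig_mul => //; exact: trig_cst.
by rewrite conv_add //; exact: trig_add.
Qed.

Lemma conv_der K : sep K -> exists2 K1, sep K1 &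
  (forall x y, has_deriv (fun x => K x y) x (K1 x y)) /\
  forall v, itgable 0 L v -> forall x, has_deriv (conv K v) x (conv K1 v x).
Proof.
elim=> {K} [a b ta tb|K1 K2 s1 [K1' t1 [d1 h1]] s2 [K2' t2 [d2 h2]]].
  have [a1 ta1 da] := trig_der ta.
  exists (fun x y => a1 x * b y); first exact: sep_prod.
  split=> [x y|v iv x]; first by have ? := da x; apply: der_eq; [der|rewrite /=; ring].
  rewrite !conv_prod //; have ? := da x.
  by apply: der_eq; [der|rewrite /=; ring].
exists (fun x y => K1' x y + K2' x y); first exact: sep_add.
split=> [x y|v iv x]; first by apply: (@der_add _ (K1^~ y) (K2^~ y)).
by rewrite !conv_add //; apply: der_add; [exact: h1|exact: h2].
Qed.

(** For one product both sides are the product of the two integrals. *)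
Lemma conv_fubini K f g : sep K -> itgable 0 L f -> itgable 0 L g ->
  itg 0 L (fun x => f x * conv K g x)
  = itg 0 L (fun y => g y * conv (fun y x => K x y) f y).
Proof.
move=> sK fi gi; elim: sK => {K} [a b ta tb|K1 K2 s1 h1 s2 h2].
  rewrite (conv_prod a tb gi).
  have -> : (fun y x => a x * b y) = (fun y x => b y * a x).
    by apply/funext => x; apply/funext => y; rewrite mulrC.
  rewrite (conv_prod b ta fi).
  set B := itg 0 L (fun y => g y * b y); set A := itg 0 L (fun y => f y * a y).
  have -> : itg 0 L (fun x => f x * (a x * B)) = B * A.
    rewrite -itgZ; last by apply: itgableM_cont fi _; exact: trig_cont.
    by apply: eq_itg => x _; ring.
  have -> : itg 0 L (fun y => g y * (b y * A)) = A * B.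
    rewrite -itgZ; last by apply: itgableM_cont gi _; exact: trig_cont.
    by apply: eq_itg => x _; ring.
  exact: mulrC.
have c1 := trig_cont (conv_trig s1 gi); have c2 := trig_cont (conv_trig s2 gi).
have c3 := trig_cont (conv_trig (sep_swap s1) fi).
have c4 := trig_cont (conv_trig (sep_swap s2) fi).
rewrite (conv_add s1 s2 gi).
have -> : conv (fun y x => K1 x y + K2 x y) f
    = (fun y => conv (fun y x => K1 x y) f y + conv (fun y x => K2 x y) f y).
  exact: (conv_add (sep_swap s1) (sep_swap s2) fi).
have -> : itg 0 L (fun x => f x * (conv K1 g x + conv K2 g x))
    = itg 0 L (fun x => f x * conv K1 g x) + itg 0 L (fun x => f x * conv K2 g x).
  by rewrite -itgD; [apply: eq_itg => x _; rewrite mulrDr|exact: itgableM_cont|exact: itgableM_cont].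
rewrite h1 h2 -itgD; [|exact: itgableM_cont|exact: itgableM_cont].
by apply: eq_itg => x _; rewrite mulrDr.
Qed.

End Trigonometric.

Section Modulus.
Context {R : realType}.
Implicit Types (L x y e : R) (v : R -> R).

Lemma segment_modulus L v e : continuous v -> 0 < e ->
  exists2 d, 0 < d & forall x y, 0 <= x <= L -> `|x - y| < d -> `|v x - v y| <= e.
Proof.
move=> cv e0; have /compact_near_coveringP cov := @segment_compact R 0 L.
have e2 : 0 < e / 2 by rewrite divr_gt0.
have [x xL|d d0 hd] := cov R (0 : R)^'+
    (fun d x => forall y, `|x - y| < d -> `|v x - v y| <= e) _.
- have /cvgrPdist_le /(_ _ e2) [r /= r0 hr] := cv x.
  have r2 : 0 < r / 2 by rewrite divr_gt0.
  exists (ball x (r / 2), [set d | d < r / 2]) => /=.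
    split; first exact: nbhsx_ballx.
    exact: nbhs_right_lt.
  move=> [z d] /= [zx dr] y zy.
  have h1 : `|v x - v z| <= e / 2.
    by apply: hr; rewrite /ball_ /= (lt_trans zx) // ltr_pdivrMr // ltr_pMr // ltr1n.
  have h2 : `|v x - v y| <= e / 2.
    apply: hr; rewrite /ball_ /= -(subrK z x) -addrA (le_lt_trans (ler_normD _ _)) //.
    have : `|x - z| < r / 2 by [].
    by have := lt_trans zy dr; lra.
  rewrite -(subrK (v x) (v z)) -addrA (le_trans (ler_normD _ _)) // distrC.
  by lra.
exists (d / 2); first by rewrite divr_gt0.
move=> x y xL xy; have d2 : 0 < d / 2 by rewrite divr_gt0.
have b : `|0 - d / 2| < d by rewrite sub0r normrN gtr0_norm //; lra.
by have := hd (d / 2) b d2 x; rewrite /= in_itv /=; exact.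
Qed.

End Modulus.

Section Kernel.
Context {R : realType}.
Variable L : R.
Hypothesis L0 : 0 < L.
Implicit Types (x y t e : R) (f g h v : R -> R).

Let om : R := 2 * pi / L.
Let omL : om * L = pi + pi.
Proof. by rewrite /om divfK ?gt_eqF // mulr_natl mulr2n. Qed.
Let om0 : 0 < om.
Proof. by rewrite divr_gt0 // mulr_gt0 // pi_gt0. Qed.

Let cosL t : cos (om * (t + L)) = cos (om * t).
Proof. by rewrite mulrDr omL addrA cosDpi cosDpi opprK. Qed.

(** Up to a constant, the distance to the period lattice is controlled from
    below by [1 - cos]. *)
Lemma periodic_modulus v e : continuous v -> Defs.periodic L v -> 0 < e ->
  exists2 C, 0 <= C & forall x y, `|v x - v y| <= e + C * (1 - cos (om * (x - y))).
Proof.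
move=> cv pv e0; have [d d0 hd] := segment_modulus L cv e0.
have [M M0 hM] := periodic_bounded L0 pv cv.
have om_in t : 0 < t -> t <= L / 2 -> cos (om * t) < 1.
  move=> t0 tL; rewrite lt_neqAle cos_le1 andbT; apply/eqP => c1.
  have tpi : om * t <= pi.
    have : om * t <= om * (L / 2) by rewrite ler_pM2l.
    by rewrite mulrA omL; lra.
  have s0 : sin (om * t) = 0 by apply: cos1sin0; rewrite c1 normr1.
  move: tpi; rewrite le_eqVlt => /predU1P[epi|tpi].
    by move: c1; rewrite epi cospi; lra.
  have : 0 < sin (om * t) by apply: sin_gt0_pi; rewrite tpi andbT mulr_gt0.
  by rewrite s0 ltxx.
have [m m0 hm] : exists2 m, 0 < m & forall t, d <= t <= L / 2 -> m <= 1 - cos (om * t).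
  case: (leP d (L / 2)) => dL; last first.
    by exists 1 => // t /andP[dt tL]; move: (le_trans dt tL); rewrite leNgt dL.
  have cc : continuous (fun t => 1 - cos (om * t)) by cont.
  apply: cont_pos_min => // [t _|t /andP[dt tL]]; first exact: cc.
  by rewrite subr_gt0 om_in // (lt_le_trans d0).
exists (2 * M / m); first by rewrite divr_ge0 ?mulr_ge0 // ltW.
move=> x y.
have c1 t : 0 <= 1 - cos (om * t) by rewrite subr_ge0 cos_le1.
have C0 : 0 <= 2 * M / m by rewrite divr_ge0 ?mulr_ge0 // ltW.
have cint (k : int) t : cos (om * (t + k%:~R * L)) = cos (om * t).
  exact: (@periodic_int _ L (fun t => cos (om * t)) cosL).
have [k /andP[xk0 xkL]] := periodic_reduce x L0.
have [j /andP[yj0 yjL]] := periodic_reduce (y - (x + k%:~R * L) + L / 2) L0.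
pose x' := x + k%:~R * L; pose y' := y + j%:~R * L.
have -> : cos (om * (x - y)) = cos (om * (x' - y')).
  rewrite /x' /y' (_ : x + _ - _ = (x - y) + (k - j)%:~R * L) ?cint //.
  by rewrite intrB; ring.
rewrite -(periodic_int pv k x) -(periodic_int pv j y) -/x' -/y'.
have dist : `|x' - y'| <= L / 2.
  by rewrite /x' /y' ler_norml; apply/andP; split; lra.
case: (ltP `|x' - y'| d) => [xyd|dxy].
  apply: le_trans (hd x' y' _ xyd) _; first by rewrite /x' xk0 ltW.
  by rewrite lerDl mulr_ge0.
have h1 : m <= 1 - cos (om * (x' - y')).
  have -> : cos (om * (x' - y')) = cos (om * `|x' - y'|).
    by rewrite -[LHS]cos_norm normrM (gtr0_norm om0).
  by apply: hm; rewrite dxy.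
have h2 : `|v x' - v y'| <= 2 * M.
  by apply: le_trans (ler_normB _ _) _; have := hM x'; have := hM y'; lra.
have h3 : 2 * M / m * m <= 2 * M / m * (1 - cos (om * (x' - y'))) by rewrite ler_wpM2l.
rewrite divfK ?gt_eqF // in h3.
by lra.
Qed.

Let h t := (1 + cos (om * t)) / 2.
Let c n := itg 0 L (fun t => h t ^+ n).

Let h_cont n : continuous (fun t => h t ^+ n).
Proof. by rewrite /h; cont. Qed.

Let h_ge0 t : 0 <= h t.
Proof. by rewrite /h divr_ge0 //; have := cos_geN1 (om * t); lra. Qed.

(** The recursion of Wallis: the difference is the integral of a derivative. *)
Let cS n : (2 * n%:R + 2) * c n.+1 = (2 * n%:R + 1) * c n.
Proof.
have zero F f : continuous f -> (forall t, has_deriv F t (f t)) -> F L = F 0 ->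
    itg 0 L f = 0.
  by move=> cf dF FL; rewrite (itg_der (ltW L0) cf (fun x _ => dF x)) FL subrr.
have sL : sin (om * L) = sin (om * 0).
  by rewrite omL mulr0 sin0 sinDpi sinpi oppr0.
have itgc (g : R -> R) : continuous g -> itgable 0 L g by exact: cont_itgable.
case: n => [|n].
  have z : itg 0 L (fun t => om * cos (om * t)) = 0.
    apply: (zero (fun t => sin (om * t))) => //; first by cont.
    by move=> t; apply: der_eq; [der|rewrite /=; ring].
  have z' : itg 0 L (fun t => cos (om * t)) = 0.
    move: z; rewrite itgZ; last by apply: itgc; cont.
    by move/eqP; rewrite mulf_eq0 gt_eqF //= => /eqP.
  have -> : c 1 = 2^-1 * (c 0 + itg 0 L (fun t => cos (om * t))).
    rewrite /c -itgD; [|exact: itgc|by apply: itgc; cont].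
    rewrite -itgZ; last by apply: itgc; rewrite /h; cont.
    by apply: eq_itg => t _; rewrite /h expr1 expr0; field.
  by rewrite z'; field.
have dh t : has_deriv h t (- (om / 2 * sin (om * t))).
  by rewrite /h; apply: der_eq; [der|rewrite /=; field].
have z : itg 0 L (fun t => om * ((2 * n.+1%:R + 2) * h t ^+ n.+2
    - (2 * n.+1%:R + 1) * h t ^+ n.+1)) = 0.
  apply: (zero (fun t => sin (om * t) * h t ^+ n.+1)).
  - apply: cont_mul; first exact: cont_cst.
    apply: cont_add; first by apply: cont_mul; [exact: cont_cst|exact: h_cont].
    by apply: cont_opp; apply: cont_mul; [exact: cont_cst|exact: h_cont].
  - move=> t; have ? := dh t; apply: der_eq; first by der.
    rewrite /= (_ : cos (om * t) = 2 * h t - 1); last by rewrite /h; field.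
    have s2 : sin (om * t) ^+ 2 = 4 * h t * (1 - h t).
      by rewrite sin2cos2 /h; field.
    rewrite (_ : _ + _ = om * ((2 * h t - 1) * h t ^+ n.+1)
      - om / 2 * n.+1%:R * h t ^+ n * sin (om * t) ^+ 2); last by field.
    by rewrite s2 [h t ^+ n.+2]exprS [h t ^+ n.+1]exprS; field.
  - by rewrite sL mulr0 sin0 !mul0r.
move: z; rewrite itgZ; last first.
  apply: itgc; apply: cont_add; first by apply: cont_mul; [exact: cont_cst|exact: h_cont].
  by apply: cont_opp; apply: cont_mul; [exact: cont_cst|exact: h_cont].
move/eqP; rewrite mulf_eq0 gt_eqF //= itgB; try by apply: itgableZ; exact: itgc.
by rewrite !itgZ ?subr_eq0; [move=> /eqP| exact: itgc|exact: itgc].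
Qed.

Let c_gt0 n : 0 < c n.
Proof.
elim: n => [|n IH].
  have -> : c 0 = itg 0 L (fun=> 1) by apply: eq_itg => t _; rewrite expr0.
  by rewrite itg_cst ?(ltW L0) // mul1r subr0.
have : 0 < (2 * n%:R + 2) * c n.+1.
  by rewrite cS mulr_gt0 // ltr_wpDl // mulr_ge0.
by rewrite pmulr_rgt0 // ltr_wpDl // mulr_ge0.
Qed.

(** The normalized powers [cos ^ (2 n)] of half the angle: nonnegative
    trigonometric kernels that concentrate on the diagonal. *)
Definition kernel n x y : R := h (x - y) ^+ n / c n.

Lemma kernel_sep n : sep L (kernel n).
Proof.
have cst k : sep L (fun _ _ => k).
  have e : (fun _ _ : R => k) = (fun _ _ => k * 1) by rewrite mulr1.
  by rewrite e; apply: (@sep_prod _ L (fun=> k) (fun=> 1)); exact: trig_cst.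
have scos : sep L (fun x y => cos (om * (x - y))).
  have -> : (fun x y => cos (om * (x - y))) = (fun x y => cos (om * x) * cos (om * y)
      + sin (om * x) * sin (om * y)).
    by apply/funext => x; apply/funext => y; rewrite mulrBr cosB.
  by apply: sep_add; apply: sep_prod; first [exact: trig_cos|exact: trig_sin].
have sh : sep L (fun x y => h (x - y)).
  by apply: sep_mul; [apply: sep_add; [exact: cst|exact: scos]|exact: cst].
have shn : sep L (fun x y => h (x - y) ^+ n).
  elim: n => [|n IH].
    have -> : (fun x y => h (x - y) ^+ 0) = (fun _ _ => 1).
      by apply/funext => x; apply/funext => y; rewrite expr0.
    exact: cst.
  have -> : (fun x y => h (x - y) ^+ n.+1) = (fun x y => h (x - y) * h (x - y) ^+ n).
    by apply/funext => x; apply/funext => y; rewrite exprS.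
  exact: sep_mul.
by apply: sep_mul.
Qed.

Lemma kernel_ge0 n x y : 0 <= kernel n x y.
Proof. by rewrite divr_ge0 ?exprn_ge0 // ltW. Qed.

Lemma kernel_sym n x y : kernel n x y = kernel n y x.
Proof. by rewrite /kernel /h -[x - y]opprB mulrN cosN. Qed.

Let kernel_shift (u : R -> R) x : continuous u -> Defs.periodic L u ->
  (forall t, u (- t) = u t) -> itg 0 L (fun y => u (x - y)) = itg 0 L u.
Proof.
move=> cu pu eu; rewrite -(itg_period (- x) cu pu L0).
by apply: eq_itg => y _; rewrite -eu opprB.
Qed.

Let h_per n : Defs.periodic L (fun t => h t ^+ n).
Proof. by move=> t; rewrite /h cosL. Qed.

Let h_even n t : h (- t) ^+ n = h t ^+ n.
Proof. by rewrite /h mulrN cosN. Qed.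

Lemma kernel_mass n x : itg 0 L (kernel n x) = 1.
Proof.
have -> : itg 0 L (kernel n x) = (c n)^-1 * itg 0 L (fun y => h (x - y) ^+ n).
  rewrite -itgZ; last first.
    by apply: cont_itgable; apply: (@cont_comp _ (fun t => h t ^+ n)); [exact: h_cont|cont].
  by apply: eq_itg => y _; rewrite /kernel mulrC.
rewrite (@kernel_shift (fun t => h t ^+ n)) //.
by rewrite mulVf // gt_eqF.
Qed.

(** The integrand is twice the difference of two consecutive kernels, up to
    normalization, so the recursion for [c] computes it. *)
Lemma kernel_moment n x :
  itg 0 L (fun y => (1 - cos (om * (x - y))) * kernel n x y) = n.+1%:R^-1.
Proof.
pose u t := 2 * (h t ^+ n - h t ^+ n.+1).
have -> : itg 0 L (fun y => (1 - cos (om * (x - y))) * kernel n x y)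
    = (c n)^-1 * itg 0 L (fun y => u (x - y)).
  rewrite -itgZ; last first.
    by apply: cont_itgable; rewrite /u /h; cont.
  by apply: eq_itg => y _; rewrite /kernel /u exprS /h; field; rewrite gt_eqF.
rewrite kernel_shift.
- rewrite /u itgZ; last first.
    by apply: cont_itgable; rewrite /h; cont.
  rewrite itgB; try by apply: cont_itgable; exact: h_cont.
  rewrite -/(c n) -/(c n.+1).
  have n0 : 0 < 2 * n%:R + 2 :> R by rewrite ltr_wpDl // mulr_ge0.
  have -> : c n.+1 = (2 * n%:R + 1) * c n / (2 * n%:R + 2).
    by rewrite -cS mulrC mulKf // gt_eqF.
  rewrite -natr1; field.
  rewrite (gt_eqF (c_gt0 n)) (gt_eqF n0) /=.
  by rewrite gt_eqF // ltr_wpDl.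
- by rewrite /u /h; cont.
- by move=> t; rewrite /u /h cosL.
- by move=> t; rewrite /u /h mulrN cosN.
Qed.

Definition smooth n v := conv L (kernel n) v.

Lemma smooth_trig n v : itgable 0 L v -> trig L (smooth n v).
Proof. by move=> iv; apply: conv_trig => //; exact: kernel_sep. Qed.

(** Korovkin's argument: [v] varies by at most a small constant plus a multiple
    of [1 - cos], which the kernel integrates to [1 / (n + 1)]. *)
Lemma smooth_approx v e : continuous v -> Defs.periodic L v -> 0 < e ->
  exists N, forall n x, (N <= n)%N -> `|smooth n v x - v x| <= e.
Proof.
move=> cv pv e0; have e2 : 0 < e / 2 by rewrite divr_gt0.
have [C C0 hC] := periodic_modulus cv pv e2.
have [N hN] : exists N : nat, C / (e / 2) <= N%:R.
  exists (Num.bound (C / (e / 2))); apply/ltW.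
  by apply: le_lt_trans (archi_boundP _); rewrite ?divr_ge0 // ltW.
exists N => n x Nn.
have ck : continuous (kernel n x) by exact/trig_cont/sep_trig_r/kernel_sep.
have E : smooth n v x - v x = itg 0 L (fun y => (v y - v x) * kernel n x y).
  have e1 : v x = itg 0 L (fun y => v x * kernel n x y).
    by rewrite itgZ ?kernel_mass ?mulr1 //; exact: cont_itgable.
  rewrite [in LHS]e1 /smooth /conv -itgB; try by apply: cont_itgable; cont.
  by apply: eq_itg => y _; ring.
have cc : continuous (fun y => (1 - cos (om * (x - y))) * kernel n x y).
  by apply: cont_mul => //; cont.
have B : itg 0 L (fun y => (e / 2) * kernel n x y + C * ((1 - cos (om * (x - y))) * kernel n x y))
    = e / 2 + C / n.+1%:R.
  rewrite itgD; try by apply: itgableZ; exact: cont_itgable.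
  rewrite !itgZ; try exact: cont_itgable.
  by rewrite kernel_mass kernel_moment mulr1.
have small : C / n.+1%:R <= e / 2.
  rewrite ler_pdivrMr // mulrC -ler_pdivrMr //; apply: le_trans hN _.
  by rewrite ler_nat ltnW.
have bound y : `|(v y - v x) * kernel n x y|
    <= (e / 2) * kernel n x y + C * ((1 - cos (om * (x - y))) * kernel n x y).
  rewrite normrM (ger0_norm (kernel_ge0 _ _ _)).
  have := hC x y; rewrite distrC; have := kernel_ge0 n x y.
  move: (kernel n x y) (cos _) `|v y - v x| => k z w k0 hw.
  by have := ler_wpM2r k0 hw; lra.
have cB : continuous (fun y => (e / 2) * kernel n x y
    + C * ((1 - cos (om * (x - y))) * kernel n x y)).
  by apply: cont_add; apply: cont_mul => //; exact: cont_cst.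
have cA : continuous (fun y => (v y - v x) * kernel n x y) by cont.
rewrite E; apply: (@le_trans _ _ (e / 2 + C / n.+1%:R)); last by rewrite [leRHS]splitr lerD2l.
rewrite -B ler_norml; apply/andP; split.
  rewrite -itgN; last exact: cont_itgable.
  apply: le_itg; [apply: itgableN; exact: cont_itgable|exact: cont_itgable|].
  by move=> y _; have := bound y; rewrite ler_norml => /andP[].
apply: le_itg; [exact: cont_itgable|exact: cont_itgable|].
by move=> y _; have := bound y; rewrite ler_norml => /andP[].
Qed.

(** Jensen's inequality for the probability density [kernel n x], integrated
    over [x]. *)
Lemma smooth_contract n g : sq_itgable 0 L g ->
  itg 0 L (fun x => smooth n g x ^+ 2) <= itg 0 L (fun x => g x ^+ 2).
Proof.
move=> sg; have [_ g2] := sg; have gi := sq_itgable_itgable sg.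
have ctr v : itgable 0 L v -> continuous (smooth n v).
  by move=> /(smooth_trig n) /trig_cont.
have jensen x : smooth n g x ^+ 2 <= smooth n (fun y => g y ^+ 2) x.
  set s := smooth n g x.
  have ck : continuous (kernel n x) by exact/trig_cont/sep_trig_r/kernel_sep.
  have : 0 <= itg 0 L (fun y => (g y - s) ^+ 2 * kernel n x y).
    by apply: itg_ge0 => y _; rewrite mulr_ge0 ?sqr_ge0 ?kernel_ge0.
  have -> : itg 0 L (fun y => (g y - s) ^+ 2 * kernel n x y)
      = smooth n (fun y => g y ^+ 2) x - 2 * s * smooth n g x + s ^+ 2.
    have i1 : itgable 0 L (fun y => g y ^+ 2 * kernel n x y) by exact: itgableM_cont.
    have i2 : itgable 0 L (fun y => g y * kernel n x y) by exact: itgableM_cont.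
    have i3 : itgable 0 L (kernel n x) by exact: cont_itgable.
    have -> : s ^+ 2 = itg 0 L (fun y => s ^+ 2 * kernel n x y).
      by rewrite itgZ // kernel_mass mulr1.
    have -> : 2 * s * smooth n g x = itg 0 L (fun y => 2 * s * (g y * kernel n x y)).
      by rewrite itgZ.
    rewrite /smooth /conv -itgB ?itgableZ // -itgD ?itgableZ //.
      by apply: eq_itg => y _; ring.
    by apply: itgableB => //; exact: itgableZ.
  by rewrite -/s; lra.
apply: (@le_trans _ _ (itg 0 L (fun x => smooth n (fun y => g y ^+ 2) x))).
  apply: le_itg => [||x _]; last exact: jensen.
    by apply: cont_itgable; apply: cont_exp; exact: ctr.
  by apply: cont_itgable; exact: ctr.
have one : itgable 0 L (fun=> 1 : R) by apply: cont_itgable; exact: cont_cst.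
have -> : itg 0 L (fun x => smooth n (fun y => g y ^+ 2) x)
    = itg 0 L (fun x => 1 * conv L (kernel n) (fun y => g y ^+ 2) x).
  by apply: eq_itg => x _; rewrite mul1r.
rewrite (conv_fubini (kernel_sep n) one g2).
rewrite le_eqVlt; apply/orP; left; apply/eqP; apply: eq_itg => y _.
rewrite /conv (_ : itg 0 L _ = 1) ?mulr1 // -[RHS](kernel_mass n y).
by apply: eq_itg => x _; rewrite mul1r kernel_sym.
Qed.

(** The translation invariance of the kernel turns a weak derivative into a
    derivative of the smoothed function. *)
Lemma smooth_weak_der n v g x : itgable 0 L v -> weak_derivative L v g ->
  has_deriv (smooth n v) x (smooth n g x).
Proof.
move=> iv wg; have [K1 sK1 [dK dconv]] := conv_der (kernel_sep n).
apply: der_eq (dconv v iv x) _.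
have kE y z : kernel n y z = kernel n (y - z) 0 by rewrite /kernel subr0.
have K1E y z : K1 y z = K1 (y - z) 0.
  apply: der_unique (dK y z) _.
  have -> : (fun x => kernel n x z) = (fun x => kernel n (x - z) 0).
    by apply/funext => t; rewrite kE.
  apply: (@der_eq _ (fun t => (fun x => kernel n x 0) (t - z))).
    by apply: (@der_comp _ (fun x => kernel n x 0) (fun t => t - z) y _ (K1 (y - z) 0)); [exact: dK|der].
  by ring.
have dy y : has_deriv (kernel n x) y (- K1 x y).
  have -> : kernel n x = (fun y => kernel n (x - y) 0) by apply/funext => t; rewrite kE.
  apply: (@der_eq _ (fun t => (fun x => kernel n x 0) (x - t))).
    by apply: (@der_comp _ (fun x => kernel n x 0) (fun t => x - t) y _ (K1 (x - y) 0)); [exact: dK|der].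
  by rewrite [K1 x y]K1E; ring.
have tk : test_fun L (kernel n x) by apply/trig_test/sep_trig_r/kernel_sep.
have := wg _ tk; rewrite !int_perE /smooth /conv => E.
apply: oppr_inj; rewrite -E -itgN; last exact: sep_itgable.
by apply: eq_itg => y _; rewrite (der_derive1 (dy y)) mulrN.
Qed.

End Kernel.

(** * Weak derivatives *)

Section WeakDerivative.
Context {R : realType}.
Variable L : R.
Hypothesis L0 : 0 < L.
Implicit Types (x y e : R) (f g h d u v : R -> R).
Local Notation mu := (@lebesgue_measure R).

Lemma itg_norm_le a b f : itgable a b f -> `|itg a b f| <= itg a b (fun x => `|f x|).
Proof. by move=> fi; exact: le_normr_Rintegral. Qed.

Lemma itgable_norm a b f : itgable a b f -> itgable a b (fun x => `|f x|).
Proof. by move=> fi; exact: (integrable_norm fi). Qed.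

Lemma itg_small d h e : itgable 0 L d -> continuous h ->
  (forall x, `|h x| <= e) -> `|itg 0 L (fun x => d x * h x)| <= e * itg 0 L (fun x => `|d x|).
Proof.
move=> di ch he; have dh := itgableM_cont di ch.
apply: le_trans (itg_norm_le dh) _; rewrite -itgZ; last exact: itgable_norm.
apply: le_itg; [exact: itgable_norm|by apply: itgableZ; exact: itgable_norm|].
by move=> x _; rewrite normrM mulrC ler_wpM2r.
Qed.

Lemma test_fun_C1 psi : test_fun L psi ->
  [/\ forall x, has_deriv psi x (derive1 psi x), continuous (derive1 psi),
      continuous psi, Defs.periodic L psi & Defs.periodic L (derive1 psi)].
Proof.
move=> [per d].
have d0 x : has_deriv psi x (derive1 psi x) by apply: der_of_derivable; exact: (d 0%N x).
have d1 x : has_deriv (derive1 psi) x (derive1 (derive1 psi) x).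
  by apply: der_of_derivable; exact: (d 1%N x).
split=> //; [exact: cont_der d1|exact: cont_der d0|].
move=> x; apply: der_unique (d0 x).
have e : (fun t => psi (t + L)) = psi by apply/funext => t; rewrite per.
rewrite -[X in has_deriv X]e; have ? := d0 (x + L).
by apply: der_eq; [der|rewrite /=; ring].
Qed.

Lemma C1_weak v v1 : (forall x, has_deriv v x (v1 x)) -> continuous v1 ->
  Defs.periodic L v -> weak_derivative L v v1.
Proof.
move=> dv cv1 pv psi /test_fun_C1 [dp cp1 cp pp pp1].
have cv := cont_der dv; rewrite !int_perE.
have : itg 0 L (fun x => v x * derive1 psi x + v1 x * psi x) = 0.
  rewrite (@itg_der _ 0 L (fun x => v x * psi x)) ?(ltW L0) //.
  - by rewrite -[L in v L]add0r -[L in psi L]add0r pv pp subrr.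
  - by cont.
  - move=> x _; have ? := dv x; have ? := dp x.
    by apply: der_eq; [der|rewrite /=; ring].
rewrite itgD; [|by apply: cont_itgable; cont|by apply: cont_itgable; cont].
by move/eqP; rewrite addr_eq0 => /eqP.
Qed.

(** By smoothing, smooth test functions can be replaced by continuously
    differentiable ones. *)
Lemma weak_C1 v g psi psi1 : continuous v -> itgable 0 L g ->
  weak_derivative L v g -> (forall x, has_deriv psi x (psi1 x)) -> continuous psi1 ->
  Defs.periodic L psi -> Defs.periodic L psi1 ->
  itg 0 L (fun x => v x * psi1 x) = - itg 0 L (fun x => g x * psi x).
Proof.
move=> cv gi wg dp cp1 pp pp1; have cp := cont_der dp.
have vi : itgable 0 L v by exact: cont_itgable.
apply/eqP; rewrite -subr_eq0 opprK -normr_le0; apply/ler_addgt0Pl => e e0; rewrite addr0.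
pose M := itg 0 L (fun x => `|v x|) + itg 0 L (fun x => `|g x|) + 1.
have Iv0 : 0 <= itg 0 L (fun x => `|v x|) by apply: itg_ge0.
have Ig0 : 0 <= itg 0 L (fun x => `|g x|) by apply: itg_ge0.
have M0 : 0 < M by rewrite /M; lra.
have eM : 0 < e / M by rewrite divr_gt0.
have [N1 h1] := smooth_approx L0 cp pp eM.
have [N2 h2] := smooth_approx L0 cp1 pp1 eM.
pose n := maxn N1 N2.
have wp := C1_weak dp cp1 pp.
have pi_ : itgable 0 L psi by exact: cont_itgable.
have p1i : itgable 0 L psi1 by exact: cont_itgable.
have ts : trig L (smooth L n psi) by exact: smooth_trig.
have ts1 : trig L (smooth L n psi1) by exact: smooth_trig.
have cs := trig_cont ts; have cs1 := trig_cont ts1.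
have := wg _ (trig_test L0 ts); rewrite !int_perE.
have -> : derive1 (smooth L n psi) = smooth L n psi1.
  by apply/funext => x; apply: der_derive1; exact: smooth_weak_der.
move=> E.
have -> : itg 0 L (fun x => v x * psi1 x) + itg 0 L (fun x => g x * psi x)
  = itg 0 L (fun x => v x * (psi1 x - smooth L n psi1 x))
    + itg 0 L (fun x => g x * (psi x - smooth L n psi x)).
  have -> : itg 0 L (fun x => v x * (psi1 x - smooth L n psi1 x))
      = itg 0 L (fun x => v x * psi1 x) - itg 0 L (fun x => v x * smooth L n psi1 x).
    rewrite -itgB; [|exact: itgableM_cont|exact: itgableM_cont].
    by apply: eq_itg => x _; ring.
  have -> : itg 0 L (fun x => g x * (psi x - smooth L n psi x))
      = itg 0 L (fun x => g x * psi x) - itg 0 L (fun x => g x * smooth L n psi x).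
    rewrite -itgB; [|exact: itgableM_cont|exact: itgableM_cont].
    by apply: eq_itg => x _; ring.
  by rewrite E; ring.
have s1 : `|itg 0 L (fun x => v x * (psi1 x - smooth L n psi1 x))|
    <= e / M * itg 0 L (fun x => `|v x|).
  apply: itg_small => //; first by cont.
  by move=> x; rewrite distrC; apply: h2; exact: leq_maxr.
have s2 : `|itg 0 L (fun x => g x * (psi x - smooth L n psi x))|
    <= e / M * itg 0 L (fun x => `|g x|).
  apply: itg_small => //; first by cont.
  by move=> x; rewrite distrC; apply: h1; exact: leq_maxl.
apply: le_trans (ler_normD _ _) _; apply: le_trans (lerD s1 s2) _.
by rewrite -mulrDr mulrAC ler_pdivrMr // ler_pM2l // /M lerDl.
Qed.

End WeakDerivative.

Section WeakDerivative.
Context {R : realType}.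
Variable L : R.
Hypothesis L0 : 0 < L.
Implicit Types (x y e : R) (f g h d u v : R -> R).
Local Notation mu := (@lebesgue_measure R).

Section Uniqueness.
Variable d : R -> R.
Hypothesis sd : sq_itgable 0 L d.
Hypothesis d_test : forall psi, test_fun L psi -> itg 0 L (fun x => d x * psi x) = 0.

Let di : itgable 0 L d. Proof. exact: sq_itgable_itgable. Qed.

Let orth_cont h : continuous h -> Defs.periodic L h ->
  itg 0 L (fun x => d x * h x) = 0.
Proof.
move=> ch ph; apply/eqP; rewrite -normr_le0; apply/ler_addgt0Pl => e e0; rewrite addr0.
pose M := itg 0 L (fun x => `|d x|) + 1.
have I0 : 0 <= itg 0 L (fun x => `|d x|) by apply: itg_ge0.
have M0 : 0 < M by rewrite /M; lra.
have eM : 0 < e / M by rewrite divr_gt0.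
have [N hN] := smooth_approx L0 ch ph eM.
have ts : trig L (smooth L N h) by apply: smooth_trig => //; exact: cont_itgable.
have cs := trig_cont ts.
have -> : itg 0 L (fun x => d x * h x) = itg 0 L (fun x => d x * (h x - smooth L N h x)).
  have -> : itg 0 L (fun x => d x * (h x - smooth L N h x))
      = itg 0 L (fun x => d x * h x) - itg 0 L (fun x => d x * smooth L N h x).
    rewrite -itgB; [|exact: itgableM_cont|exact: itgableM_cont].
    by apply: eq_itg => x _; ring.
  by rewrite (d_test (trig_test L0 ts)) subr0.
have s : `|itg 0 L (fun x => d x * (h x - smooth L N h x))|
    <= e / M * itg 0 L (fun x => `|d x|).
  apply: itg_small => //; first by cont.
  by move=> x; rewrite distrC; apply: hN.
apply: le_trans s _; rewrite mulrAC ler_pdivrMr // ler_pM2l // /M.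
by lra.
Qed.

(** Indicators of intervals are limits of continuous periodic functions. *)
Let primitive_zero x : 0 < x -> x < L -> itg 0 x d = 0.
Proof.
move=> x0 xL.
have pL : 0 < pi / L by rewrite divr_gt0 // pi_gt0.
have piL : pi / L * L = pi by rewrite divfK ?gt_eqF.
(* a product of two antiperiodic factors, positive on the interval from [0] to
   [x] and nonpositive on the rest of the period *)
pose s y := sin (pi / L * y) * sin (pi / L * (x - y)).
have cs : continuous s by rewrite /s; cont.
have ps : Defs.periodic L s.
  move=> y; rewrite /s mulrDr piL sinDpi.
  have -> : pi / L * (x - y) = pi / L * (x - (y + L)) + pi.
    have -> : pi / L * (x - y) = pi / L * (x - (y + L)) + pi / L * L by ring.
    by rewrite piL.
  by rewrite sinDpi mulrN mulNr.
have sin_pos z : 0 < z -> z < L -> 0 < sin (pi / L * z).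
  move=> z0 zL; apply: sin_gt0_pi; rewrite mulr_gt0 //=.
  by rewrite -[X in _ < X]piL ltr_pM2l.
have s_pos y : 0 < y -> y < x -> 0 < s y.
  by move=> y0 yx; rewrite /s mulr_gt0 // sin_pos //; lra.
have s_neg y : x <= y -> y <= L -> s y <= 0.
  move=> xy yL; have -> : s y = - (sin (pi / L * y) * sin (pi / L * (y - x))).
    rewrite /s -[x - y]opprB [pi / L * - _]mulrN sinN.
    by rewrite [LHS]mulrN.
  rewrite oppr_le0 mulr_ge0 //.
    by apply: sin_ge0_pi; rewrite mulr_ge0 ?(ltW pL) ?(ltW (lt_le_trans x0 xy)) //=
       -[X in _ <= X]piL ler_pM2l.
  apply: sin_ge0_pi; rewrite mulr_ge0 ?(ltW pL) ?subr_ge0 //=.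
  by rewrite -[X in _ <= X]piL ler_pM2l //; lra.
have s_zero : s 0 = 0 by rewrite /s mulr0 sin0 mul0r.
pose h n y := Num.min 1 (Num.max 0 (n%:R * s y)).
have ch n : continuous (h n).
  move=> y; rewrite /h.
  have cn : continuous (fun y => n%:R * s y) by cont.
  apply: (@continuous_min _ _ (fun=> 1) (fun y => Num.max 0 (n%:R * s y)) y); first exact: cvg_cst.
  by apply: (@continuous_max _ _ (fun=> 0) (fun y => n%:R * s y) y); [exact: cvg_cst|exact: cn].
have ph n : Defs.periodic L (h n) by move=> y; rewrite /h ps.
have h01 n y : 0 <= h n y <= 1.
  by rewrite /h le_min ler01 le_max lexx /= ge_min lexx.
have mI : measurable `]0, x[ by exact: measurable_itv.
pose chi : R -> R := \1_`]0, x[.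
have h_lim y : 0 <= y <= L -> h n y @[n --> \oo] --> chi y.
  move=> /andP[y0 yL]; apply: cvg_near_cst.
  have chi0 : ~~ ((0 < y) && (y < x)) -> chi y = 0.
    by move=> hy; rewrite /chi indicE memNset //= in_itv /=; apply/negP.
  case: (ltP 0 y) => y0'; last first.
    have -> : y = 0 by apply/le_anti; rewrite y0' y0.
    near=> n; rewrite /h s_zero mulr0 maxxx min_r ?ler01 //.
    by rewrite /chi indicE memNset //= in_itv /= ltxx.
  case: (ltP y x) => yx; last first.
    near=> n; rewrite chi0 ?y0' -?leNgt //.
    by rewrite /h max_l ?min_r // mulr_ge0_le0 // s_neg.
  have -> : chi y = 1 by rewrite /chi indicE mem_set //= in_itv /= y0'.
  have sy := s_pos y y0' yx.
  near=> n; rewrite /h min_l // le_max -ler_pdivrMr // mul1r; apply/orP; right.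
  by near: n; exact: nbhs_infty_ger.
have mdh n := measurable_int mu (itgableM_cont di (ch n)).
have md := itgable_measurable di.
have mchi : measurable_fun `[0, L] chi by exact: measurable_realfun.measurable_indic.
have mdc := (measurable_realfun.measurable_EFinP _ _).2
  (measurable_realfun.measurable_funM md mchi).
have [] := @dominated_convergence _ _ R mu `[0, L] (measurable_itv _)
  (fun n y => (d y * h n y)%:E) (fun y => (d y * chi y)%:E) (fun y => `|d y|%:E) mdh mdc.
- apply: aeW => y /=; rewrite in_itv /= => hy.
  by apply: cvg_EFin; [exact: nearW|apply: cvgMr; exact: h_lim].
- exact: itgable_norm.
- apply: aeW => y n _ /=; rewrite lee_fin normrM ler_piMr //.
  by have /andP[a b] := h01 n y; rewrite ger0_norm.
move=> dci _.
have -> : (fun n => (\int[mu]_(y in `[0%R, L]) (d y * h n y)%:E)%E) = (fun=> 0%E).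
  apply/funext => n; rewrite -[LHS]fineK; last first.
    by apply: integrable_fin_num => //; exact: (itgableM_cont di (ch n)).
  by have := orth_cont (ch n) (ph n); rewrite /itg /Rintegral => ->.
move=> /(cvg_unique (@ereal_hausdorff R) (cvg_cst _)) E.
have : itg 0 L (fun y => d y * chi y) = 0 by rewrite /itg /Rintegral -E.
have -> : (fun y => d y * chi y) = d \_ `]0, x[.
  apply/funext => y; rewrite /chi indicE patchE; case: ifP => _; rewrite ?mulr1 ?mulr0 //.
rewrite /itg -Rintegral_mkcondr.
have -> : `[0, L] `&` `]0, x[ = `]0, x[%classic :> set R.
  apply/seteqP; split=> y /=; rewrite !in_itv /=; first by case.
  by move=> /andP[a b]; split; apply/andP; split; lra.
have sub : `]0, x[%classic `<=` `[0, L]%classic :> Prop.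
  by move=> y /=; rewrite !in_itv /= => /andP[a b]; apply/andP; split; lra.
have sub' : `]0, x]%classic `<=` `[0, L]%classic :> Prop.
  by move=> y /=; rewrite !in_itv /= => /andP[a b]; apply/andP; split; lra.
rewrite Rintegral_itv_bndo_bndc ?Rintegral_itv_obnd_cbnd //.
- by apply: integrableS di.
- by apply: integrableS di.
Unshelve. all: by end_near.
Qed.

(** A function with vanishing primitive is zero almost everywhere. *)
Lemma orthogonal_zero : itg 0 L (fun x => d x ^+ 2) = 0.
Proof.
pose f := d \_ `[0, L].
have fI : mu.-integrable setT (EFin \o f).
  by rewrite /f -restrict_EFin; apply/integrable_restrict => //; rewrite setTI; exact: di.
have fl : locally_integrable [set: R] f by apply: integrable_locally => //; exact: di.
have fy y : mu.-integrable [set` Interval (BLeft 0) (BRight y)] (EFin \o f).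
  by apply: integrableS fI.
have F0 y : 0 < y -> y < L -> \int[mu]_(t in [set` Interval (BLeft 0) (BRight y)]) f t = 0.
  move=> y0 yL; rewrite -[RHS](primitive_zero y0 yL); apply: eq_Rintegral => t.
  rewrite inE /= in_itv /= => /andP[a b]; rewrite /f patchE ifT // inE /= in_itv /=.
  by apply/andP; split; lra.
have ae0 : {ae mu, forall x, `]0, L[%classic x -> (d x ^+ 2)%:E = 0%:E}.
  have := FTC1 fy fl; apply: filterS; first exact: (ae_filter_ringOfSetsType mu).
  move=> x + /=; rewrite in_itv /= => H /andP[x0 xL].
  have [|dF eF] := H; first by rewrite lte_fin.
  have fx : f x = d x by rewrite /f patchE ifT // inE /= in_itv /= (ltW x0) (ltW xL).
  rewrite fx in eF.
  have : has_deriv (fun=> 0 : R) x (d x).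
    apply: near_eq_is_derive (_ : has_deriv _ x (d x)); last first.
      by rewrite -eF; exact: der_of_derivable dF.
    near=> y; apply: F0.
      by near: y; exact: lt_nbhsr.
    by near: y; exact: lt_nbhsl.
  move=> /der_unique /(_ (der_cst 0 x)) ->; by rewrite expr0n.
have [md d2] := sd.
have sub : `]0, L[%classic `<=` `[0, L]%classic :> Prop.
  by move=> y /=; rewrite !in_itv /= => /andP[a b]; apply/andP; split; lra.
have sub' : `]0, L]%classic `<=` `[0, L]%classic :> Prop.
  by move=> y /=; rewrite !in_itv /= => /andP[a b]; apply/andP; split; lra.
rewrite /itg -Rintegral_itv_obnd_cbnd; last by apply: integrableS d2.
rewrite -Rintegral_itv_bndo_bndc; last by apply: integrableS d2.
have d2' : mu.-integrable `]0, L[ (EFin \o (fun x => d x ^+ 2)) by apply: integrableS d2.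
rewrite /Rintegral (@ae_eq_integral _ _ _ mu `]0, L[ (fun=> 0%:E)) //.
- by rewrite integral0.
- exact: measurable_int d2'.
Unshelve. all: by end_near.
Qed.

End Uniqueness.

End WeakDerivative.

(** * Periodic Sobolev functions *)

Section Sobolev.
Context {R : realType}.
Variable L : R.
Hypothesis L0 : 0 < L.
Implicit Types (x y e k : R) (a b f g h u v : R -> R).
Local Notation mu := (@lebesgue_measure R).

(** A function of the Sobolev class together with one of its weak derivatives;
    carrying the derivative explicitly avoids choosing it. *)
Record sobolev u g : Prop := Sobolev {
  sob_periodic : Defs.periodic L u;
  sob_cont : continuous u;
  sob_L2 : L2per L g;
  sob_weak : weak_derivative L u g }.

Lemma H1per_sobolev u : H1per L u -> sobolev u (wderiv L u).
Proof.
move=> [pu cu [g Lg wg]].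
have [LG wG] : [set g | L2per L g /\ weak_derivative L u g] (wderiv L u).
  by apply: (@getPex _ [set g | L2per L g /\ weak_derivative L u g]); exists g.
by split.
Qed.

Lemma sobolev_H1per u g : sobolev u g -> H1per L u.
Proof. by case=> pu cu Lg wg; split=> //; exists g. Qed.

Lemma sob_sq u g : sobolev u g -> sq_itgable 0 L g.
Proof. by move=> /sob_L2 /L2per_sq. Qed.

Lemma L2perD f g : L2per L f -> L2per L g -> L2per L (fun x => f x + g x).
Proof.
move=> Lf Lg; have [pf mf _] := Lf; have [pg mg _] := Lg; split.
- by move=> x; rewrite pf pg.
- exact: measurable_realfun.measurable_funD.
- by have [] := sq_itgableD (L2per_sq Lf) (L2per_sq Lg).
Qed.

Lemma L2perZ k f : L2per L f -> L2per L (fun x => k * f x).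
Proof.
move=> Lf; have [pf mf _] := Lf; split.
- by move=> x; rewrite pf.
- by apply: measurable_realfun.measurable_funM.
- by have [] := sq_itgableZ k (L2per_sq Lf).
Qed.

Lemma sobolevD u g v h : sobolev u g -> sobolev v h ->
  sobolev (fun x => u x + v x) (fun x => g x + h x).
Proof.
move=> su sv; have [pu cu Lu wu] := su; have [pv cv Lv wv] := sv; split.
- by move=> x; rewrite pu pv.
- exact: cont_add.
- exact: L2perD.
- move=> psi tp; have [_ cp1 cp _ _] := test_fun_C1 tp; rewrite !int_perE.
  have E1 := wu _ tp; have E2 := wv _ tp; rewrite !int_perE in E1 E2.
  have gi := sq_itgable_itgable (sob_sq su); have hi := sq_itgable_itgable (sob_sq sv).
  have -> : itg 0 L (fun x => (u x + v x) * derive1 psi x)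
      = itg 0 L (fun x => u x * derive1 psi x) + itg 0 L (fun x => v x * derive1 psi x).
    rewrite -itgD; [|by apply: cont_itgable; cont|by apply: cont_itgable; cont].
    by apply: eq_itg => x _; rewrite mulrDl.
  have -> : itg 0 L (fun x => (g x + h x) * psi x)
      = itg 0 L (fun x => g x * psi x) + itg 0 L (fun x => h x * psi x).
    rewrite -itgD; [|exact: itgableM_cont|exact: itgableM_cont].
    by apply: eq_itg => x _; rewrite mulrDl.
  by rewrite E1 E2 opprD.
Qed.

Lemma sobolevZ k u g : sobolev u g -> sobolev (fun x => k * u x) (fun x => k * g x).
Proof.
move=> su; have [pu cu Lu wu] := su; split.
- by move=> x; rewrite pu.
- by cont.
- exact: L2perZ.
- move=> psi tp; have [_ cp1 cp _ _] := test_fun_C1 tp; rewrite !int_perE.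
  have E := wu _ tp; rewrite !int_perE in E.
  have gi := sq_itgable_itgable (sob_sq su).
  have -> : itg 0 L (fun x => k * u x * derive1 psi x)
      = k * itg 0 L (fun x => u x * derive1 psi x).
    rewrite -itgZ; last by apply: cont_itgable; cont.
    by apply: eq_itg => x _; rewrite mulrA.
  have -> : itg 0 L (fun x => k * g x * psi x) = k * itg 0 L (fun x => g x * psi x).
    by rewrite -itgZ; [apply: eq_itg => x _; rewrite mulrA|exact: itgableM_cont].
  by rewrite E mulrN.
Qed.

Lemma sobolevB u g v h : sobolev u g -> sobolev v h ->
  sobolev (fun x => u x - v x) (fun x => g x - h x).
Proof.
move=> su sv; have := sobolevD su (sobolevZ (-1) sv).
have -> : (fun x => u x + -1 * v x) = (fun x => u x - v x).
  by apply/funext => x; rewrite mulN1r.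
have -> // : (fun x => g x + -1 * h x) = (fun x => g x - h x).
by apply/funext => x; rewrite mulN1r.
Qed.

Lemma C1_sobolev v v1 : (forall x, has_deriv v x (v1 x)) -> continuous v1 ->
  Defs.periodic L v -> Defs.periodic L v1 -> sobolev v v1.
Proof.
move=> dv cv1 pv pv1; split=> //; first exact: cont_der dv.
  split=> //; first exact: measurable_realfun.continuous_measurable_fun.
  by have [] := cont_sq_itgable 0 L cv1.
exact: C1_weak.
Qed.

(** ** Uniqueness of the weak derivative *)

Lemma sobolev_unique u g h f : sobolev u g -> sobolev u h -> sq_itgable 0 L f ->
  itg 0 L (fun x => g x * f x) = itg 0 L (fun x => h x * f x).
Proof.
move=> su sv sf; have sg := sob_sq su; have sh := sob_sq sv.
have sd := sq_itgableB sg sh.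
have Z : itg 0 L (fun x => (g x - h x) ^+ 2) = 0.
  apply: (orthogonal_zero L0 sd) => psi tp; have [_ _ cp _ _] := test_fun_C1 tp.
  have E1 := sob_weak su tp; have E2 := sob_weak sv tp; rewrite !int_perE in E1 E2.
  have gi := sq_itgable_itgable sg; have hi := sq_itgable_itgable sh.
  have -> : itg 0 L (fun x => (g x - h x) * psi x)
      = itg 0 L (fun x => g x * psi x) - itg 0 L (fun x => h x * psi x).
    rewrite -itgB; [|exact: itgableM_cont|exact: itgableM_cont].
    by apply: eq_itg => x _; rewrite mulrBl.
  by apply/eqP; rewrite subr_eq0 -eqr_opp -E1 -E2.
have := sq_itgable_cauchy sd sf; rewrite Z mul0r => h0.
have : itg 0 L (fun x => (g x - h x) * f x) = 0.
  by apply/eqP; rewrite -sqrf_eq0; apply/eqP/le_anti; rewrite h0 sqr_ge0.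
have -> : itg 0 L (fun x => (g x - h x) * f x)
    = itg 0 L (fun x => g x * f x) - itg 0 L (fun x => h x * f x).
  rewrite -itgB; [|exact: sq_itgableM|exact: sq_itgableM].
  by apply: eq_itg => x _; rewrite mulrBl.
by move/eqP; rewrite subr_eq0 => /eqP.
Qed.

Lemma sobolev_unique_sq u g h : sobolev u g -> sobolev u h ->
  itg 0 L (fun x => g x ^+ 2) = itg 0 L (fun x => h x ^+ 2).
Proof.
move=> su sv; have := sobolev_unique su sv (sob_sq su).
have := sobolev_unique su sv (sob_sq sv).
have -> : (fun x => g x * h x) = (fun x => h x * g x) by apply/funext => x; rewrite mulrC.
by move=> <- /esym ->.
Qed.

Lemma H1norm_sq u g : sobolev u g ->
  H1norm L u ^+ 2 = itg 0 L (fun x => u x ^+ 2) + itg 0 L (fun x => g x ^+ 2).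
Proof.
move=> su; have sw := H1per_sobolev (sobolev_H1per su).
rewrite /H1norm !int_perE (sobolev_unique_sq sw su) sqr_sqrtr //.
by apply: addr_ge0; apply: itg_ge0 => x _; exact: sqr_ge0.
Qed.

(** ** Density *)

Let uniform (f_ : nat -> R -> R) f := forall e, 0 < e ->
  exists N, forall n x, (N <= n)%N -> `|f_ n x - f x| <= e.

Let uniform_sq (f_ : nat -> R -> R) f M : uniform f_ f -> (forall x, `|f x| <= M) ->
  uniform (fun n x => f_ n x ^+ 2) (fun x => f x ^+ 2).
Proof.
move=> fu fM e e0.
have M0 : 0 <= M by exact: le_trans (normr_ge0 _) (fM 0).
pose d := Num.min 1 (e / (1 + 2 * M)).
have k0 : 0 < 1 + 2 * M by lra.
have d0 : 0 < d by rewrite lt_min ltr01 divr_gt0.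
have d1 : d <= 1 by rewrite ge_min lexx.
have dk : d * (1 + 2 * M) <= e by rewrite -ler_pdivlMr // ge_min lexx orbT.
have [N hN] := fu d d0; exists N => n x /hN -/(_ x) h.
rewrite subr_sqr normrM; apply: le_trans dk; apply: ler_pM => //.
have -> : f_ n x + f x = (f_ n x - f x) + 2 * f x by ring.
apply: le_trans (ler_normD _ _) _; apply: lerD; first exact: le_trans h d1.
by rewrite normrM ger0_norm // ler_wpM2l.
Qed.

Let uniform_itg a (f_ : nat -> R -> R) f : itgable 0 L a -> uniform f_ f -> continuous f ->
  (forall n, continuous (f_ n)) ->
  itg 0 L (fun x => a x * f_ n x) @[n --> \oo] --> itg 0 L (fun x => a x * f x).
Proof.
move=> ai fu cf cfn; apply/cvgrPdist_le => /= e e0.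
pose M := itg 0 L (fun x => `|a x|) + 1.
have I0 : 0 <= itg 0 L (fun x => `|a x|) by apply: itg_ge0.
have M0 : 0 < M by rewrite /M; lra.
have eM : 0 < e / M by rewrite divr_gt0.
have [N hN] := fu _ eM; exists N => // n /= Nn; rewrite distrC.
have -> : itg 0 L (fun x => a x * f_ n x) - itg 0 L (fun x => a x * f x)
    = itg 0 L (fun x => a x * (f_ n x - f x)).
  rewrite -itgB; [|exact: itgableM_cont|exact: itgableM_cont].
  by apply: eq_itg => x _; rewrite mulrBr.
apply: le_trans (_ : e / M * itg 0 L (fun x => `|a x|) <= _).
  by apply: itg_small => // [|x]; [move: (cfn n) => ?; cont|exact: hN].
by rewrite mulrAC ler_pdivrMr // ler_pM2l // /M; lra.
Qed.

Let uniform_pt (f_ : nat -> R -> R) f x : uniform f_ f -> f_ n x @[n --> \oo] --> f x.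
Proof.
move=> fu; apply/cvgrPdist_le => /= e e0.
by have [N hN] := fu _ e0; exists N => // n /= Nn; rewrite distrC hN.
Qed.

(** Quadratic inequalities extend from continuously differentiable functions to
    the Sobolev class, because smoothing converges uniformly and does not
    increase the Dirichlet integral. *)
Lemma sobolev_form_ge0 a b (C1 C2 C3 : R) x0 : continuous a -> continuous b ->
  (forall v v1, (forall x, has_deriv v x (v1 x)) -> continuous v1 ->
    Defs.periodic L v -> Defs.periodic L v1 ->
    0 <= itg 0 L (fun x => v1 x ^+ 2) + (itg 0 L (fun x => a x * v x ^+ 2)
      + C1 * itg 0 L v ^+ 2 + C2 * itg 0 L (fun x => b x * v x) ^+ 2 + C3 * v x0 ^+ 2)) ->
  forall v g, sobolev v g ->
    0 <= itg 0 L (fun x => g x ^+ 2) + (itg 0 L (fun x => a x * v x ^+ 2)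
      + C1 * itg 0 L v ^+ 2 + C2 * itg 0 L (fun x => b x * v x) ^+ 2 + C3 * v x0 ^+ 2).
Proof.
move=> ca cb H v g sv; have [pv cv Lg wg] := sv; have sg := sob_sq sv.
have gi := sq_itgable_itgable sg; have vi : itgable 0 L v by exact: cont_itgable.
pose w n := smooth L n v.
have tw n : trig L (w n) by exact: smooth_trig.
have cw n : continuous (w n) := trig_cont (tw n).
have uw : uniform w v.
  by move=> e e0; have [N hN] := smooth_approx L0 cv pv e0; exists N => n x; exact: hN.
have [M M0 vM] := periodic_bounded L0 pv cv.
have usq := uniform_sq uw vM.
have c2 f : continuous f -> continuous (fun x => f x ^+ 2) by move=> cf; cont.
pose Q (f : R -> R) : R := itg 0 L (fun x => a x * f x ^+ 2)
  + C1 * itg 0 L f ^+ 2 + C2 * itg 0 L (fun x => b x * f x) ^+ 2 + C3 * f x0 ^+ 2.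
have one f : itg 0 L f = itg 0 L (fun x => 1 * f x) by apply: eq_itg => x _; rewrite mul1r.
have cQ : Q (w n) @[n --> \oo] --> Q v.
  have l1 := uniform_itg (cont_itgable 0 L ca) usq (c2 _ cv) (fun n => c2 _ (cw n)).
  have l2 := uniform_itg (cont_itgable 0 L cb) uw cv cw.
  have l3 : itg 0 L (w n) @[n --> \oo] --> itg 0 L v.
    rewrite [in X in _ --> X]one.
    have -> : (fun n => itg 0 L (w n)) = (fun n => itg 0 L (fun x => 1 * w n x)).
      by apply/funext => n; exact: one.
    by apply: uniform_itg => //; apply: cont_itgable; exact: cont_cst.
  have l4 := @uniform_pt w v x0 uw.
  have sq (z : nat -> R) (l : R) C : z n @[n --> \oo] --> l ->
      C * z n ^+ 2 @[n --> \oo] --> C * l ^+ 2.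
    by move=> zl; apply: cvgMr; rewrite expr2; under eq_fun do rewrite expr2; exact: cvgM.
  by apply: cvgD; [apply: cvgD; [apply: cvgD|]|]; [exact: l1|exact: sq|exact: sq|exact: sq].
rewrite -[X in _ <= _ + X]/(Q v).
have cG : itg 0 L (fun x => g x ^+ 2) + Q (w n) @[n --> \oo]
    --> itg 0 L (fun x => g x ^+ 2) + Q v by apply: cvgD => //; exact: cvg_cst.
apply: (cvgr_to_ge cG); apply: nearW => n.
have pw : Defs.periodic L (w n) by exact: trig_periodic.
have tg : trig L (smooth L n g) by exact: smooth_trig.
have := H (w n) (smooth L n g) (fun x => smooth_weak_der L0 n x vi wg) (trig_cont tg)
  pw (trig_periodic L0 tg).
by have := smooth_contract L0 n sg; rewrite -/(Q (w n)); lra.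
Qed.

(** The mean value of [v x ^+ 2 - v y ^+ 2 = itg y x (2 * v * v')] over [y]. *)
Lemma sobolev_sup v g x : sobolev v g ->
  v x ^+ 2 <= (L^-1 + 1) * itg 0 L (fun x => v x ^+ 2) + itg 0 L (fun x => g x ^+ 2).
Proof.
move=> sv; have cv := sob_cont sv.
pose a (_ : R) := L^-1 + 1.
have ca : continuous a by exact: cont_cst.
have := @sobolev_form_ge0 a a 0 0 (-1) x ca ca _ v g sv.
rewrite itgZ; last by apply: cont_itgable; cont.
have h : forall A B C D E : R, (0 <= A + (B + 0 * C + 0 * D + -1 * E)) -> E <= B + A.
  by move=> *; lra.
move=> H; apply: h; apply: H => {}v v1 dv cv1 pv pv1 {g sv cv}; have cv := cont_der dv.
rewrite itgZ; last by apply: cont_itgable; cont.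
set V := itg 0 L (fun x => v x ^+ 2); set V1 := itg 0 L (fun x => v1 x ^+ 2).
suff : v x ^+ 2 <= (L^-1 + 1) * V + V1 by lra.
have [k /andP[xk0 xkL]] := periodic_reduce x L0.
have -> : v x = v (x + k%:~R * L) by rewrite periodic_int.
move: (x + _) xk0 xkL => z z0 zL.
have cvv : continuous (fun x => v x ^+ 2 + v1 x ^+ 2) by cont.
have step y t : 0 <= y -> y <= t -> t <= L -> `|v t ^+ 2 - v y ^+ 2| <= V + V1.
  move=> y0 yt tL.
  have <- : itg y t (fun x => 2 * (v x * v1 x)) = v t ^+ 2 - v y ^+ 2.
    rewrite (@itg_der _ y t (fun x => v x ^+ 2)) //; first by cont.
    by move=> s _; have ? := dv s; apply: der_eq; [der|rewrite /=; ring].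
  apply: le_trans (itg_norm_le _) _; first by apply: cont_itgable; cont.
  have -> : V + V1 = itg 0 L (fun x => v x ^+ 2 + v1 x ^+ 2).
    by rewrite itgD //; apply: cont_itgable; cont.
  have i := cont_itgable 0 L cvv.
  have h0 s : 0 <= v s ^+ 2 + v1 s ^+ 2 by rewrite addr_ge0 ?sqr_ge0.
  rewrite (itg_split y0 (le_trans yt tL) i) (itg_split yt tL (cont_itgable y L cvv)).
  have p1 : 0 <= itg 0 y (fun x => v x ^+ 2 + v1 x ^+ 2) by apply: itg_ge0.
  have p2 : 0 <= itg t L (fun x => v x ^+ 2 + v1 x ^+ 2) by apply: itg_ge0.
  apply: le_trans (_ : itg y t (fun x => v x ^+ 2 + v1 x ^+ 2) <= _); last by lra.
  apply: le_itg; [apply: cont_itgable|exact: cont_itgable|].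
    by apply: cont_norm; cont.
  move=> s _; rewrite ler_norml; apply/andP; split.
    by have := sqr_ge0 (v s + v1 s); lra.
  by have := sqr_ge0 (v s - v1 s); lra.
have bound y : 0 <= y <= L -> v z ^+ 2 <= v y ^+ 2 + (V + V1).
  move=> /andP[y0 yL]; case: (leP y z) => yz.
    by have := step y z y0 yz (ltW zL); rewrite ler_norml => /andP[_]; lra.
  by have := step z y z0 (ltW yz) yL; rewrite ler_norml => /andP[]; lra.
have : itg 0 L (fun=> v z ^+ 2) <= itg 0 L (fun y => v y ^+ 2 + (V + V1)).
  by apply: le_itg => //; apply: cont_itgable; cont.
rewrite itgD; [|by apply: cont_itgable; cont|by apply: cont_itgable; cont].
rewrite !itg_cst ?(ltW L0) // subr0 -ler_pdivlMr // -/V => h0.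
apply: le_trans h0 _; rewrite mulrDl mulfK ?gt_eqF // [V / L]mulrC; lra.
Qed.

Lemma itg_sqrD g h : sq_itgable 0 L g -> sq_itgable 0 L h ->
  itg 0 L (fun x => (g x + h x) ^+ 2) = itg 0 L (fun x => g x ^+ 2)
    + 2 * itg 0 L (fun x => g x * h x) + itg 0 L (fun x => h x ^+ 2).
Proof.
move=> sg sh; have [_ ig] := sg; have [_ ih] := sh; have igh := sq_itgableM sg sh.
rewrite -itgZ // -itgD //; last exact: itgableZ.
rewrite -itgD //; last by apply: itgableD => //; exact: itgableZ.
by apply: eq_itg => x _; ring.
Qed.

Lemma itg_sqrB g h : sq_itgable 0 L g -> sq_itgable 0 L h ->
  itg 0 L (fun x => (g x - h x) ^+ 2) = itg 0 L (fun x => g x ^+ 2)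
    - 2 * itg 0 L (fun x => g x * h x) + itg 0 L (fun x => h x ^+ 2).
Proof.
move=> sg sh; have [_ ig] := sg; have [_ ih] := sh; have igh := sq_itgableM sg sh.
rewrite -itgZ // -itgB //; last exact: itgableZ.
rewrite -itgD //; last by apply: itgableB => //; exact: itgableZ.
by apply: eq_itg => x _; ring.
Qed.

(** ** The product space *)

Implicit Types w : (R -> R) * (R -> R).

Lemma Xper_sobolev w : Xper L w ->
  sobolev w.1 (wderiv L w.1) /\ sobolev w.2 (wderiv L w.2).
Proof. by move=> [/H1per_sobolev s1 /H1per_sobolev s2]. Qed.

Lemma Xnorm_ge0 w : 0 <= Xnorm L w. Proof. exact: sqrtr_ge0. Qed.

Lemma Xnorm_sq w g h : sobolev w.1 g -> sobolev w.2 h -> Xnorm L w ^+ 2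
  = itg 0 L (fun x => w.1 x ^+ 2) + itg 0 L (fun x => g x ^+ 2)
    + (itg 0 L (fun x => w.2 x ^+ 2) + itg 0 L (fun x => h x ^+ 2)).
Proof.
move=> s1 s2; rewrite /Xnorm sqr_sqrtr; last by rewrite addr_ge0 ?sqr_ge0.
exact: (f_equal2 +%R (H1norm_sq s1) (H1norm_sq s2)).
Qed.

Lemma XperB w1 w2 : Xper L w1 -> Xper L w2 -> Xper L (w1 - w2).
Proof.
move=> /Xper_sobolev[a1 a2] /Xper_sobolev[b1 b2].
by split; [exact: sobolev_H1per (sobolevB a1 b1)|exact: sobolev_H1per (sobolevB a2 b2)].
Qed.

Lemma Xnorm_opp w : Xper L w -> Xnorm L (- w) = Xnorm L w.
Proof.
move=> /Xper_sobolev[s1 s2].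
have opp u : (fun x => -1 * u x) = (fun x => - u x) by apply/funext => x; rewrite mulN1r.
have n1 := sobolevZ (-1) s1; have n2 := sobolevZ (-1) s2; rewrite !opp in n1 n2.
have sq u : itg 0 L (fun x => (- u x) ^+ 2) = itg 0 L (fun x => u x ^+ 2).
  by apply: eq_itg => x _; rewrite sqrrN.
have E : Xnorm L (- w) ^+ 2 = Xnorm L w ^+ 2.
  apply: etrans (@Xnorm_sq (- w) _ _ n1 n2) _; apply: etrans _ (esym (Xnorm_sq s1 s2)).
  exact: (f_equal2 +%R (f_equal2 +%R (sq w.1) (sq _)) (f_equal2 +%R (sq w.2) (sq _))).
apply/eqP; rewrite -(@eqrXn2 _ 2 _ _ isT (Xnorm_ge0 _) (Xnorm_ge0 _)); exact/eqP.
Qed.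

(** Minkowski's inequality, from Young's inequality with the weight [B / A]. *)
Lemma Xnorm_triangle w1 w2 A B : Xper L w1 -> Xper L w2 ->
  Xnorm L w1 < A -> Xnorm L w2 < B -> Xnorm L (w1 + w2) < A + B.
Proof.
move=> /Xper_sobolev[a1 a2] /Xper_sobolev[b1 b2] hA hB.
have A0 : 0 < A := le_lt_trans (Xnorm_ge0 _) hA.
have B0 : 0 < B := le_lt_trans (Xnorm_ge0 _) hB.
pose t := B / A; have t0 : 0 < t by rewrite divr_gt0.
have young u v : sq_itgable 0 L u -> sq_itgable 0 L v ->
    itg 0 L (fun x => (u x + v x) ^+ 2)
    <= (1 + t) * itg 0 L (fun x => u x ^+ 2) + (1 + t^-1) * itg 0 L (fun x => v x ^+ 2).
  move=> su sv; rewrite (itg_sqrD su sv).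
  have := itg_sqrB (sq_itgableZ t su) sv.
  have -> : itg 0 L (fun x => (t * u x) ^+ 2) = t ^+ 2 * itg 0 L (fun x => u x ^+ 2).
    by rewrite -itgZ; [apply: eq_itg => x _; rewrite exprMn|case: su].
  have -> : itg 0 L (fun x => t * u x * v x) = t * itg 0 L (fun x => u x * v x).
    by rewrite -itgZ; [apply: eq_itg => x _; rewrite mulrA|exact: sq_itgableM].
  have : 0 <= itg 0 L (fun x => (t * u x - v x) ^+ 2).
    by apply: itg_ge0 => x _; exact: sqr_ge0.
  move: (itg 0 L (fun x => (t * u x - v x) ^+ 2)) (itg 0 L (fun x => u x ^+ 2)) => k1 k2.
  move: (itg 0 L (fun x => v x ^+ 2)) (itg 0 L (fun x => u x * v x)) => k3 k4 k1_ge0 E.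
  have : 2 * k4 <= t * k2 + t^-1 * k3.
    rewrite -(ler_pM2l t0) mulrDr [t * (t^-1 * k3)]mulrA mulfV ?gt_eqF // mul1r.
    by rewrite E in k1_ge0; clear - k1_ge0; lra.
  by clear; lra.
have h : Xnorm L (w1 + w2) ^+ 2 <= (1 + t) * Xnorm L w1 ^+ 2 + (1 + t^-1) * Xnorm L w2 ^+ 2.
  have cq f : continuous f -> sq_itgable 0 L f by exact: cont_sq_itgable.
  have alg (X1 X2 X3 p1 p2 p3 p4 x1 x2 x3 x4 y1 y2 y3 y4 T1 T2 : R) :
    X1 = p1 + p2 + (p3 + p4) -> X2 = x1 + x2 + (x3 + x4) -> X3 = y1 + y2 + (y3 + y4) ->
    p1 <= T1 * x1 + T2 * y1 -> p2 <= T1 * x2 + T2 * y2 ->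
    p3 <= T1 * x3 + T2 * y3 -> p4 <= T1 * x4 + T2 * y4 -> X1 <= T1 * X2 + T2 * X3.
    by clear; move=> -> -> ->; lra.
  exact: (alg _ _ _ _ _ _ _ _ _ _ _ _ _ _ _ _ _
    (@Xnorm_sq (w1 + w2) _ _ (sobolevD a1 b1) (sobolevD a2 b2))
    (Xnorm_sq a1 a2) (Xnorm_sq b1 b2)
    (young _ _ (cq _ (sob_cont a1)) (cq _ (sob_cont b1))) (young _ _ (sob_sq a1) (sob_sq b1))
    (young _ _ (cq _ (sob_cont a2)) (cq _ (sob_cont b2))) (young _ _ (sob_sq a2) (sob_sq b2))).
rewrite -(ltr_pXn2r (n := 2)) ?nnegrE ?Xnorm_ge0 ?addr_ge0 ?(ltW A0) ?(ltW B0) //.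
apply: le_lt_trans h _.
have -> : (A + B) ^+ 2 = (1 + t) * A ^+ 2 + (1 + t^-1) * B ^+ 2.
  by rewrite /t; field; rewrite !gt_eqF.
apply: ltrD; rewrite ltr_pM2l ?addr_gt0 ?invr_gt0 ?ltr01 //.
  by rewrite ltr_pXn2r ?nnegrE ?Xnorm_ge0 // ltW.
by rewrite ltr_pXn2r ?nnegrE ?Xnorm_ge0 // ltW.
Qed.

End Sobolev.

(** * The forms on the Sobolev class *)

Section SobolevForms.
Context {R : realType}.
Variables (c A l : R) (phi phi1 : R -> R).
Hypothesis hw : half_wave c A l phi phi1.
Hypothesis even : forall x, phi (- x) = phi x.
Hypothesis per : Defs.periodic (l + l) phi.
Implicit Types (x y M : R) (u v g q h f : R -> R).
Let l0 : 0 < l. Proof. exact: hw_l hw. Qed.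
Let p := hw_profile hw.
Let L := l + l.
Let L0 : 0 < L. Proof. by rewrite addr_gt0. Qed.

Definition wave y x : R := phi (x + y).
Definition wave1 y x : R := phi1 (x + y).

Lemma cont_shift f y : continuous f -> continuous (fun x : R => f (x + y) : R).
Proof. by move=> cf; apply: (@cont_comp _ f (fun x => x + y)) => //; cont. Qed.

Lemma wave_gt1 y x : 1 < wave y x. Proof. exact: pr_gt1 p _. Qed.

Lemma wave_gt0 y x : 0 < wave y x. Proof. exact: lt_trans ltr01 (wave_gt1 y x). Qed.

Lemma wave_der y x : has_deriv (wave y) x (wave1 y x).
Proof. by have ? := pr_der p (x + y); rewrite /wave /wave1; apply: der_eq; [der|rewrite /=; ring]. Qed.

Lemma wave1_der y x : has_deriv (wave1 y) x (- force c A (wave y x)).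
Proof. by have ? := pr_der1 p (x + y); rewrite /wave /wave1; apply: der_eq; [der|rewrite /=; ring]. Qed.

Lemma wave_cont y : continuous (wave y).
Proof. by apply: cont_shift; exact: profile_cont p. Qed.

Lemma wave1_cont y : continuous (wave1 y).
Proof. by apply: cont_shift; exact: profile_cont1 p. Qed.

Lemma wave_cont_force y : continuous (fun x => force c A (wave y x)).
Proof. by apply: (@cont_shift (fun x => force c A (phi x))); exact: profile_cont_force p. Qed.

Lemma wave_cont_ln y : continuous (fun x => ln (wave y x ^+ 2)).
Proof. by apply: (@cont_shift (fun x => ln (phi x ^+ 2))); exact: cont_ln_profile hw. Qed.

Lemma wave_cont_force1 y : continuous (fun x => force1 c (wave y x)).
Proof. by apply: (@cont_shift (fun x => force1 c (phi x))); exact: profile_cont_force1 p. Qed.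

Lemma wave_periodic y : Defs.periodic L (wave y).
Proof. by move=> x; rewrite /wave addrAC per. Qed.

Lemma wave_ln_bounded : exists2 M, 0 < M & forall y x, `|ln (wave y x ^+ 2)| <= M.
Proof.
have pl : Defs.periodic L (fun x => ln (phi x ^+ 2)) by move=> x; rewrite per.
have [M M0 hM] := periodic_bounded L0 pl (cont_ln_profile hw).
by exists M => // y x; exact: hM.
Qed.

(** The second variation along the diagonal [u_1 = u_2] of the conserved
    functional, and the one along the antidiagonal. *)
Definition sym_form y v g := itg 0 L (fun x => g x ^+ 2)
  - itg 0 L (fun x => force1 c (wave y x) * v x ^+ 2).
Definition alt_form y v g := itg 0 L (fun x => g x ^+ 2)
  + itg 0 L (fun x => (c + ln (wave y x ^+ 2)) * v x ^+ 2).
Definition sobolev_sq v g := itg 0 L (fun x => v x ^+ 2) + itg 0 L (fun x => g x ^+ 2).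

Let shift_itg h y : continuous h -> Defs.periodic L h ->
  itg 0 L (fun x => h (x - y)) = itg 0 L h.
Proof. by move=> ch ph; rewrite itg_period. Qed.

(** Bounded potentials: controlling the mass by the form also controls the
    Dirichlet integral. *)
Let boost (M kap S G W F Q : R) : 0 <= M -> 0 < kap -> 0 <= S -> - (M * S) <= W ->
  F = G + W -> kap * S <= F + Q -> 0 <= Q -> S + G <= (1 + (1 + M) / kap) * (F + Q).
Proof.
move=> M0 k0 S0 hW FE hS Q0.
have hS' : S <= (F + Q) / kap by rewrite ler_pdivlMr // mulrC.
have : (1 + M) * S <= (1 + M) * ((F + Q) / kap) by rewrite ler_wpM2l //; lra.
have -> : (1 + (1 + M) / kap) * (F + Q) = (F + Q) + (1 + M) * ((F + Q) / kap) by ring.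
by lra.
Qed.

Let weighted_bound q v M : continuous q -> continuous v -> (forall x, `|q x| <= M) ->
  `|itg 0 L (fun x => q x * v x ^+ 2)| <= M * itg 0 L (fun x => v x ^+ 2).
Proof.
move=> cq cv hq; apply: le_trans (itg_norm_le _) _; first by apply: cont_itgable; cont.
rewrite -itgZ; last by apply: cont_itgable; cont.
apply: le_itg; [|by apply: cont_itgable; cont|].
  by apply: cont_itgable; apply: cont_norm; cont.
by move=> x _; rewrite normrM [`|v x ^+ 2|]ger0_norm ?sqr_ge0 // ler_wpM2r ?sqr_ge0.
Qed.

Lemma force1_wave_bounded : exists2 M, 0 < M & forall y x, `|force1 c (wave y x)| <= M.
Proof.
have [M M0 hM] := wave_ln_bounded; exists (M + `|2 - c|); first by rewrite ltr_pwDl.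
move=> y x; rewrite /force1 -addrA; apply: le_trans (ler_normD _ _) _.
by rewrite lerD2r.
Qed.

Lemma alt_wave_bounded : exists2 M, 0 < M & forall y x, `|c + ln (wave y x ^+ 2)| <= M.
Proof.
have [M M0 hM] := wave_ln_bounded; exists (`|c| + M); first by rewrite ltr_wpDl.
by move=> y x; apply: le_trans (ler_normD _ _) _; rewrite lerD2l.
Qed.

(** The constraints of [form_coercive] move with the translated wave. *)
Lemma sym_form_coercive : exists K C, [/\ 0 < K, 0 <= C & forall y v g, sobolev L v g ->
  sobolev_sq v g <= K * (sym_form y v g + C * (itg 0 L v ^+ 2
    + itg 0 L (fun x => wave y x * v x) ^+ 2 + v (l / 2 - y) ^+ 2))].
Proof.
have [kap [C [k0 C0 H]]] := form_coercive hw even per.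
have [M M0 hM] := force1_wave_bounded.
exists (1 + (1 + M) / kap), C; split=> //.
  by rewrite ltr_pwDl // ltW // divr_gt0 //; lra.
move=> y v g sv; have cv := sob_cont sv; have cf1 := @wave_cont_force1 y.
have ct := @wave_cont y.
apply: (@boost M kap _ _ (- itg 0 L (fun x => force1 c (wave y x) * v x ^+ 2))) => //.
- exact: ltW.
- by apply: itg_ge0 => x _; exact: sqr_ge0.
- by rewrite lerN2; have := weighted_bound cf1 cv (hM y); rewrite ler_norml => /andP[].
- pose a x := - (force1 c (wave y x) + kap).
  have ca : continuous a by rewrite /a; cont.
  have split_a u : continuous u -> itg 0 L (fun x => a x * u x ^+ 2)
      = - itg 0 L (fun x => force1 c (wave y x) * u x ^+ 2)
        - kap * itg 0 L (fun x => u x ^+ 2).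
    move=> cu; rewrite -itgZ; last by apply: cont_itgable; cont.
    rewrite -itgN; last by apply: cont_itgable; cont.
    rewrite -itgB; [|by apply: cont_itgable; cont|by apply: cont_itgable; cont].
    by apply: eq_itg => x _; rewrite /a; ring.
  have := @sobolev_form_ge0 _ L L0 a (wave y) C C C (l / 2 - y) ca ct _ v g sv.
  rewrite (split_a v cv) /sym_form.
  move=> h; suff : 0 <= itg 0 L (fun x => g x ^+ 2) +
      (- itg 0 L (fun x => force1 c (wave y x) * v x ^+ 2) -
      kap * itg 0 L (fun x => v x ^+ 2) + C * itg 0 L v ^+ 2 +
      C * itg 0 L (fun x => wave y x * v x) ^+ 2 + C * v (l / 2 - y) ^+ 2) by lra.
  apply: h => {g sv cv}v v1 dv cv1 pv pv1; have cv := cont_der dv.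
  rewrite (split_a v cv).
  have dw x : has_deriv (fun x => v (x - y)) x (v1 (x - y)).
    by have ? := dv (x - y); apply: der_eq; [der|rewrite /=; ring].
  have cw := @cont_shift v1 (- y) cv1.
  have pw : Defs.periodic L (fun x => v (x - y)) by move=> x; rewrite addrAC pv.
  have pw1 : Defs.periodic L (fun x => v1 (x - y)) by move=> x; rewrite addrAC pv1.
  have := H _ _ dw cw pw pw1; rewrite -/L.
  have tE x : wave y (x - y) = phi x by rewrite /wave subrK.
  have pt := @wave_periodic y.
  rewrite (@shift_itg (fun x => v x ^+ 2) y); [|by cont|by move=> x; rewrite pv].
  rewrite (@shift_itg v y) //.
  have -> : (fun x => v (x - y) * phi x) = (fun x => v (x - y) * wave y (x - y)).
    by apply/funext => x; rewrite tE.
  rewrite (@shift_itg (fun x => v x * wave y x) y); [|by cont|by move=> x; rewrite pv pt].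
  have -> : form c l phi (fun x => v (x - y)) (fun x => v1 (x - y))
      = itg 0 L (fun x => v1 x ^+ 2) - itg 0 L (fun x => force1 c (wave y x) * v x ^+ 2).
    rewrite -itgB; [|by apply: cont_itgable; cont|by apply: cont_itgable; cont].
    rewrite -(@shift_itg (fun x => v1 x ^+ 2 - force1 c (wave y x) * v x ^+ 2) y).
    - by apply: eq_itg => x _; rewrite tE.
    - by cont.
    - by move=> x; rewrite pv pv1 pt.
  have -> : (fun x => v x * wave y x) = (fun x => wave y x * v x).
    by apply/funext => x; rewrite mulrC.
  by lra.
- by rewrite mulr_ge0 // !addr_ge0 ?sqr_ge0.
Qed.

Lemma alt_form_coercive : exists K C, [/\ 0 < K, 0 <= C & forall y v g, sobolev L v g ->
  sobolev_sq v g <= K * (alt_form y v g + C * itg 0 L v ^+ 2)].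
Proof.
have [C [C0 H]] := form2_coercive hw.
have [M M0 hM] := alt_wave_bounded.
exists (1 + (1 + M) / 1), C; split=> //; first by rewrite divr1; lra.
move=> y v g sv; have cv := sob_cont sv; have cf1 := @wave_cont_ln y.
have cq : continuous (fun x => c + ln (wave y x ^+ 2)).
  by apply: cont_add; [exact: cont_cst|exact: cf1].
have iq u : continuous u -> itgable 0 L (fun x => (c + ln (wave y x ^+ 2)) * u x ^+ 2).
  by move=> cu; apply: cont_itgable; apply: (cont_mul cq); cont.
apply: (@boost M 1 _ _ (itg 0 L (fun x => (c + ln (wave y x ^+ 2)) * v x ^+ 2))) => //.
- exact: ltW.
- by apply: itg_ge0 => x _; exact: sqr_ge0.
- by have := weighted_bound cq cv (hM y); rewrite ler_norml => /andP[].
- pose a x := c + ln (wave y x ^+ 2) - 1.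
  have ca : continuous a by apply: (cont_add cq); exact: cont_cst.
  have split_a u : continuous u -> itg 0 L (fun x => a x * u x ^+ 2)
      = itg 0 L (fun x => (c + ln (wave y x ^+ 2)) * u x ^+ 2)
        - itg 0 L (fun x => u x ^+ 2).
    move=> cu; rewrite -itgB; [|exact: iq|by apply: cont_itgable; cont].
    by apply: eq_itg => x _; rewrite /a; ring.
  have := @sobolev_form_ge0 _ L L0 a a C 0 0 0 ca ca _ v g sv.
  rewrite (split_a v cv) /alt_form => h.
  suff : 0 <= itg 0 L (fun x => g x ^+ 2) +
      (itg 0 L (fun x => (c + ln (wave y x ^+ 2)) * v x ^+ 2) - itg 0 L (fun x => v x ^+ 2)
       + C * itg 0 L v ^+ 2 + 0 * itg 0 L (fun x => a x * v x) ^+ 2 + 0 * v 0 ^+ 2) by lra.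
  apply: h => {g sv cv}v v1 dv cv1 pv pv1; have cv := cont_der dv.
  rewrite (split_a v cv).
  have dw x : has_deriv (fun x => v (x - y)) x (v1 (x - y)).
    by have ? := dv (x - y); apply: der_eq; [der|rewrite /=; ring].
  have cw := @cont_shift v1 (- y) cv1.
  have pw : Defs.periodic L (fun x => v (x - y)) by move=> x; rewrite addrAC pv.
  have pw1 : Defs.periodic L (fun x => v1 (x - y)) by move=> x; rewrite addrAC pv1.
  have := H _ _ dw cw pw pw1; rewrite -/L.
  have tE x : wave y (x - y) = phi x by rewrite /wave subrK.
  have pt := @wave_periodic y.
  rewrite (@shift_itg (fun x => v x ^+ 2) y); [|by cont|by move=> x; rewrite pv].
  rewrite (@shift_itg v y) //.
  have -> : form2 c l phi (fun x => v (x - y)) (fun x => v1 (x - y))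
      = itg 0 L (fun x => v1 x ^+ 2)
        + itg 0 L (fun x => (c + ln (wave y x ^+ 2)) * v x ^+ 2).
    rewrite -itgD; [|by apply: cont_itgable; cont|exact: iq].
    rewrite -(@shift_itg (fun x => v1 x ^+ 2 + (c + ln (wave y x ^+ 2)) * v x ^+ 2) y).
    - by apply: eq_itg => x _; rewrite tE.
    - by apply: cont_add; [cont|apply: (cont_mul cq); cont].
    - by move=> x; rewrite pv pv1 pt.
  by lra.
- by rewrite mulr_ge0 // sqr_ge0.
Qed.

Lemma sym_form_bounded : exists2 K, 0 < K & forall y v g, sobolev L v g ->
  `|sym_form y v g| <= K * sobolev_sq v g.
Proof.
have [M M0 hM] := force1_wave_bounded; exists (1 + M); first by lra.
move=> y v g sv; have cv := sob_cont sv.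
have := weighted_bound (@wave_cont_force1 y) cv (hM y).
have : 0 <= itg 0 L (fun x => g x ^+ 2) by apply: itg_ge0 => x _; exact: sqr_ge0.
have : 0 <= itg 0 L (fun x => v x ^+ 2) by apply: itg_ge0 => x _; exact: sqr_ge0.
rewrite /sym_form /sobolev_sq; set G := itg 0 L (fun x => g x ^+ 2).
set V := itg 0 L (fun x => v x ^+ 2) => V0 G0.
have MG : 0 <= M * G by rewrite mulr_ge0 // ltW.
by rewrite !ler_norml => /andP[h1 h2]; apply/andP; split; lra.
Qed.

Lemma alt_form_bounded : exists2 K, 0 < K & forall y v g, sobolev L v g ->
  `|alt_form y v g| <= K * sobolev_sq v g.
Proof.
have [M M0 hM] := alt_wave_bounded; exists (1 + M); first by lra.
move=> y v g sv; have cv := sob_cont sv; have cf1 := @wave_cont_ln y.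
have cq : continuous (fun x => c + ln (wave y x ^+ 2)).
  by apply: cont_add; [exact: cont_cst|exact: cf1].
have := weighted_bound cq cv (hM y).
have : 0 <= itg 0 L (fun x => g x ^+ 2) by apply: itg_ge0 => x _; exact: sqr_ge0.
have : 0 <= itg 0 L (fun x => v x ^+ 2) by apply: itg_ge0 => x _; exact: sqr_ge0.
rewrite /alt_form /sobolev_sq; set G := itg 0 L (fun x => g x ^+ 2).
set V := itg 0 L (fun x => v x ^+ 2) => V0 G0.
have MG : 0 <= M * G by rewrite mulr_ge0 // ltW.
by rewrite !ler_norml => /andP[h1 h2]; apply/andP; split; lra.
Qed.

End SobolevForms.

(** * Expansion of the nonlinear energy density *)

Section Potential.
Context {R : realType}.
Implicit Types (a b f s t x z P D : R).

(** The derivative [ln (1 + t) - t] of the left-hand side lies between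
    [- 2 * t ^+ 2] and [0]. *)
Lemma log_taylor t : `|t| <= 2^-1 ->
  `|(1 + t) * ln (1 + t) - t - t ^+ 2 / 2| <= `|t| ^+ 3.
Proof.
move=> ht.
pose r t := (1 + t) * ln (1 + t) - t - t ^+ 2 / 2.
have pos x : - 2^-1 <= x -> 0 < 1 + x by lra.
have dr x : - 2^-1 <= x -> has_deriv r x (ln (1 + x) - x).
  move=> hx; have p := pos x hx; rewrite /r.
  have ? : has_deriv (@ln R) (1 + x) (1 + x)^-1 by exact: is_derive1_ln.
  by apply: der_eq; [der|rewrite /=; field; rewrite gt_eqF].
have up x : - 2^-1 <= x -> ln (1 + x) - x <= 0.
  by move=> hx; rewrite subr_le0 le_ln1Dx //; lra.
have lo x : - 2^-1 <= x -> 0 <= ln (1 + x) - x + 2 * x ^+ 2.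
  move=> hx; have p := pos x hx.
  have : ln (1 + - (x / (1 + x))) <= - (x / (1 + x)).
    apply: le_ln1Dx; rewrite ltrNr opprK ltr_pdivrMr //; lra.
  have -> : 1 + - (x / (1 + x)) = (1 + x)^-1 by field; rewrite gt_eqF.
  rewrite lnV ?posrE // => h.
  have h1 : x / (1 + x) = x - x ^+ 2 / (1 + x) by field; rewrite gt_eqF.
  have : x ^+ 2 / (1 + x) <= 2 * x ^+ 2.
    by rewrite ler_pdivrMr // mulrC mulrA ler_peMl ?sqr_ge0 //; lra.
  by rewrite h1 in h; lra.
have r0 : r 0 = 0 by rewrite /r addr0 ln1; ring.
have dmr x : - 2^-1 <= x -> has_deriv (fun x => - r x) x (- (ln (1 + x) - x)).
  by move=> hx; have ? := dr x hx; der.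
have dpr x : - 2^-1 <= x ->
    has_deriv (fun x => r x + 2 / 3 * x ^+ 3) x (ln (1 + x) - x + 2 * x ^+ 2).
  by move=> hx; have ? := dr x hx; apply: der_eq; [der|rewrite /=; field].
rewrite -/(r t); move: ht; rewrite ler_norml => /andP[t1 t2].
case: (leP 0 t) => t0.
  have A : - r 0 <= - r t.
    apply: (der_ge0_le t0 (df := fun x => - (ln (1 + x) - x)) (f := fun x => - r x)) => x /andP[x0 xt].
      by apply: dmr; lra.
    by rewrite oppr_ge0 up //; lra.
  have B : r 0 + 2 / 3 * 0 ^+ 3 <= r t + 2 / 3 * t ^+ 3.
    apply: (der_ge0_le t0 (df := fun x => ln (1 + x) - x + 2 * x ^+ 2)
      (f := fun x => r x + 2 / 3 * x ^+ 3)) => x /andP[x0 xt].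
      by apply: dpr; lra.
    by apply: lo; lra.
  have t3 : 0 <= t ^+ 3 by rewrite exprn_ge0.
  rewrite r0 expr0n /= mulr0 in A B.
  by rewrite (ger0_norm t0) ler_norml; apply/andP; split; lra.
have A : - r t <= - r 0.
  apply: (der_ge0_le (ltW t0) (df := fun x => - (ln (1 + x) - x)) (f := fun x => - r x)) => x /andP[x0 xt].
    by apply: dmr; lra.
  by rewrite oppr_ge0 up //; lra.
have B : r t + 2 / 3 * t ^+ 3 <= r 0 + 2 / 3 * 0 ^+ 3.
  apply: (der_ge0_le (ltW t0) (df := fun x => ln (1 + x) - x + 2 * x ^+ 2)
    (f := fun x => r x + 2 / 3 * x ^+ 3)) => x /andP[x0 xt].
    by apply: dpr; lra.
  by apply: lo; lra.
have t3 : 0 <= (- t) ^+ 3 by rewrite exprn_ge0 //; lra.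
rewrite r0 expr0n /= mulr0 in A B.
have t3E : (- t) ^+ 3 = - t ^+ 3 by ring.
rewrite t3E in t3.
by rewrite (ltr0_norm t0) t3E ler_norml; apply/andP; split; lra.
Qed.

Lemma potentialE a b : 0 < a -> 0 < b ->
  potential a b = a * b * ln (a * b) - a * b.
Proof.
move=> a0 b0; rewrite /potential.
have -> : a ^+ 2 * b ^+ 2 = (a * b) ^+ 2 by ring.
by rewrite lnXn ?mulr_gt0 // mulr2n; field.
Qed.

(** The product [u_1 * u_2] determines the potential; it is expanded around
    [f ^+ 2]. *)
Lemma potential_expand f s P D : 1 < f -> `|P| <= s -> `|D| <= s -> s <= 8^-1 ->
  `|potential (f + P + D) (f + P - D) - potential f f
    - (2 * f * ln (f ^+ 2) * P + (ln (f ^+ 2) + 2) * P ^+ 2 - ln (f ^+ 2) * D ^+ 2)|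
  <= 18 * s * (P ^+ 2 + D ^+ 2).
Proof.
move=> f1 hP hD s8; have f0 : 0 < f by exact: lt_trans ltr01 f1.
have s0 : 0 <= s by exact: le_trans (normr_ge0 _) hP.
have [P1 P2] : - s <= P /\ P <= s by apply/andP; rewrite -ler_norml.
have [D1 D2] : - s <= D /\ D <= s by apply/andP; rewrite -ler_norml.
have a0 : 0 < f + P + D by lra.
have b0 : 0 < f + P - D by lra.
rewrite !potentialE // -expr2.
set lnf := ln (f ^+ 2).
pose q := P ^+ 2 + D ^+ 2.
pose w := (P ^+ 2 - D ^+ 2) / f.
pose z := 2 * P + w; pose x := z / f.
have q0 : 0 <= q by rewrite addr_ge0 ?sqr_ge0.
have sqs t : - s <= t -> t <= s -> t ^+ 2 <= s ^+ 2.
  by move=> t1 t2; have := mulr_ge0 (_ : 0 <= s - t) (_ : 0 <= s + t); lra.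
have qs : q <= 2 * s ^+ 2 by rewrite /q; have := sqs P P1 P2; have := sqs D D1 D2; lra.
have ss : s ^+ 2 <= s / 8.
  by rewrite expr2 ler_wpM2l //; lra.
have hw : `|w| <= q.
  rewrite /w normrM [`|f^-1|]gtr0_norm ?invr_gt0 //.
  apply: le_trans (_ : `|P ^+ 2 - D ^+ 2| <= _).
    by rewrite ler_piMr // invf_le1 // ltW.
  by rewrite ler_norml /q; have := sqr_ge0 P; have := sqr_ge0 D; move=> *; apply/andP; split; lra.
have [w1 w2] : - q <= w /\ w <= q by apply/andP; rewrite -ler_norml.
have hz : `|z| <= 3 * s.
  by rewrite ler_norml /z; apply/andP; split; lra.
have hx : `|x| <= 2^-1.
  rewrite /x normrM [`|f^-1|]gtr0_norm ?invr_gt0 //.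
  apply: le_trans (_ : `|z| <= _); last by lra.
  by rewrite ler_piMr // invf_le1 // ltW.
have x1 : 0 < 1 + x by move: hx; rewrite ler_norml => /andP[]; lra.
have E : (f + P + D) * (f + P - D) = f ^+ 2 * (1 + x).
  by rewrite /x /z /w; field; rewrite gt_eqF.
rewrite E lnM ?posrE ?exprn_gt0 // -/lnf.
pose r := (1 + x) * ln (1 + x) - x - x ^+ 2 / 2.
have -> : f ^+ 2 * (1 + x) * (lnf + ln (1 + x)) - f ^+ 2 * (1 + x)
    - (f ^+ 2 * lnf - f ^+ 2)
    - (2 * f * lnf * P + (lnf + 2) * P ^+ 2 - lnf * D ^+ 2)
  = f ^+ 2 * r + w * (4 * P + w) / 2.
  have -> : 2 * f * lnf * P + (lnf + 2) * P ^+ 2 - lnf * D ^+ 2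
    = lnf * (f ^+ 2 * x) + 2 * P ^+ 2.
    by rewrite /x /z /w; field; rewrite gt_eqF.
  have -> : w * (4 * P + w) / 2 = f ^+ 2 * (x ^+ 2 / 2) - 2 * P ^+ 2.
    by rewrite /x /z; field; rewrite gt_eqF.
  by rewrite /r; field.
have hr := log_taylor hx; rewrite -/r in hr.
have b1 : `|f ^+ 2 * r| <= 15 * s * q.
  rewrite normrM ger0_norm ?sqr_ge0 //.
  apply: le_trans (_ : f ^+ 2 * `|x| ^+ 3 <= _); first by rewrite ler_wpM2l ?sqr_ge0.
  have -> : f ^+ 2 * `|x| ^+ 3 = `|z| ^+ 3 / f.
    by rewrite /x normrM [`|f^-1|]gtr0_norm ?invr_gt0 //; field; rewrite gt_eqF.
  apply: le_trans (_ : `|z| ^+ 3 <= _).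
    by rewrite ler_piMr ?exprn_ge0 // invf_le1 // ltW.
  have -> : `|z| ^+ 3 = `|z| * z ^+ 2 by rewrite exprS real_normK ?num_real.
  have z2 : z ^+ 2 <= 5 * q.
    have w2s : w ^+ 2 <= q * q.
      by rewrite -(@real_normK _ w) ?num_real // expr2 ler_pM.
    have Pw : P * w <= s * q.
      by apply: le_trans (ler_norm _) _; rewrite normrM ler_pM.
    have sq1 : s * q <= q / 8 by rewrite [q / 8]mulrC ler_wpM2r.
    have qq : q * q <= q / 32 by rewrite ler_wpM2l //; lra.
    have -> : z ^+ 2 = 4 * P ^+ 2 + 4 * (P * w) + w ^+ 2 by rewrite /z; ring.
    have : P ^+ 2 <= q by rewrite /q lerDl sqr_ge0.
    by lra.
  have -> : 15 * s * q = (3 * s) * (5 * q) by ring.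
  by rewrite ler_pM ?sqr_ge0.
have b2 : `|w * (4 * P + w) / 2| <= 3 * s * q.
  rewrite normrM [`|2^-1|]gtr0_norm ?invr_gt0 // normrM.
  have h5 : `|4 * P + w| <= 5 * s by rewrite ler_norml; apply/andP; split; lra.
  have : `|w| * `|4 * P + w| <= q * (5 * s) by rewrite ler_pM.
  have : 0 <= s * q by rewrite mulr_ge0.
  by lra.
by apply: le_trans (ler_normD _ _) _; rewrite -/q; lra.
Qed.

Lemma potential_cont (u v : R -> R) : continuous u -> continuous v ->
  (forall x, 0 < u x) -> (forall x, 0 < v x) ->
  continuous (fun x => potential (u x) (v x)).
Proof.
move=> cu cv u0 v0.
have -> : (fun x => potential (u x) (v x))
    = (fun x => u x * v x * ln (u x * v x) - u x * v x).
  by apply/funext => x; rewrite potentialE.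
have cuv : continuous (fun x => u x * v x) by cont.
have cl : continuous (fun x => ln (u x * v x)).
  move=> x; apply: (@continuous_comp _ _ _ (fun x => u x * v x) (@ln R)).
    exact: cuv.
  by apply: continuous_ln; rewrite mulr_gt0.
by apply: cont_add; [apply: cont_mul|apply: cont_opp].
Qed.

End Potential.

(** * Expansion of the conserved functional *)

Section Lyapunov.
Context {R : realType}.
Variables (c A l : R) (phi phi1 : R -> R).
Hypothesis hw : half_wave c A l phi phi1.
Hypothesis even : forall x, phi (- x) = phi x.
Hypothesis per : Defs.periodic (l + l) phi.
Hypothesis per1 : Defs.periodic (l + l) phi1.
Implicit Types (x y s : R) (u v f g h P D : R -> R) (w : (R -> R) * (R -> R)).
Let l0 : 0 < l. Proof. exact: hw_l hw. Qed.
Let p := hw_profile hw.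
Let L := l + l.
Let L0 : 0 < L. Proof. by rewrite addr_gt0. Qed.
Let Phi := (phi, phi).
Local Notation f y := (wave phi y).
Local Notation f1 y := (wave1 phi1 y).

Lemma wave_sobolev y : sobolev L (f y) (f1 y).
Proof.
apply: C1_sobolev => //.
- exact: wave_der hw y.
- exact: wave1_cont hw y.
- exact: wave_periodic per y.
- by move=> x; rewrite /wave1 addrAC per1.
Qed.

(** The wave is a critical point of this combination of conserved quantities:
    [c] and [A] are the multipliers of momentum and mass. *)
Definition lyapunov w : R := energy L w + c * momentum L w + A * mass L w.

Definition density u v x : R :=
  c / 2 * (u x ^+ 2 + v x ^+ 2) + A * (u x + v x) - potential (u x) (v x).

Lemma density_cont u v : continuous u -> continuous v ->
  (forall x, 0 < u x) -> (forall x, 0 < v x) -> continuous (density u v).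
Proof.
move=> cu cv u0 v0; have cp := potential_cont cu cv u0 v0.
by apply: cont_add; [cont|apply: cont_opp].
Qed.

Lemma lyapunovE u v g h : sobolev L u g -> sobolev L v h ->
  (forall x, 0 < u x) -> (forall x, 0 < v x) ->
  lyapunov (u, v) = 2^-1 * (itg 0 L (fun x => g x ^+ 2) + itg 0 L (fun x => h x ^+ 2))
    + itg 0 L (density u v).
Proof.
move=> su sv u0 v0; have cu := sob_cont su; have cv := sob_cont sv.
have cp := potential_cont cu cv u0 v0.
have su' := H1per_sobolev (sobolev_H1per su).
have sv' := H1per_sobolev (sobolev_H1per sv).
have [_ iu] := sob_sq su'; have [_ iv] := sob_sq sv'.
rewrite -(sobolev_unique_sq L0 su' su) -(sobolev_unique_sq L0 sv' sv).
rewrite /lyapunov /energy /momentum /mass !int_perE /=.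
have i1 : itgable 0 L (fun x => u x ^+ 2 + v x ^+ 2) by apply: cont_itgable; cont.
have i2 : itgable 0 L (fun x => u x + v x) by apply: cont_itgable; cont.
have i3 : itgable 0 L (fun x => potential (u x) (v x)) by exact: cont_itgable.
have -> : itg 0 L (density u v) = c / 2 * itg 0 L (fun x => u x ^+ 2 + v x ^+ 2)
    + A * itg 0 L (fun x => u x + v x) - itg 0 L (fun x => potential (u x) (v x)).
  rewrite -!itgZ // -itgD; [|exact: itgableZ|exact: itgableZ].
  by rewrite -itgB //; apply: itgableD; exact: itgableZ.
have -> : itg 0 L (fun x => 2^-1 * (wderiv L u x ^+ 2 + wderiv L v x ^+ 2)
      - potential (u x) (v x))
    = 2^-1 * (itg 0 L (fun x => wderiv L u x ^+ 2) + itg 0 L (fun x => wderiv L v x ^+ 2))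
      - itg 0 L (fun x => potential (u x) (v x)).
  have i4 := itgableD iu iv.
  by rewrite -itgD // -itgZ // -itgB //; exact: itgableZ.
move: (itg 0 L (fun x => wderiv L u x ^+ 2) + _) (itg 0 L (fun x => potential (u x) (v x))).
move: (itg 0 L (fun x => u x ^+ 2 + v x ^+ 2)) (itg 0 L (fun x => u x + v x)).
by move=> *; ring.
Qed.

Definition perturbed y P D : (R -> R) * (R -> R) :=
  (fun x => f y x + P x + D x, fun x => f y x + P x - D x).

Section Perturbation.
Variables (y s : R) (P gP D gD : R -> R).
Hypothesis sP : sobolev L P gP.
Hypothesis sD : sobolev L D gD.
Hypothesis P_le : forall x, `|P x| <= s.
Hypothesis D_le : forall x, `|D x| <= s.
Hypothesis s8 : s <= 8^-1.

Let cP := sob_cont sP.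
Let cD := sob_cont sD.
Let cf : continuous (f y). Proof. exact: wave_cont hw y. Qed.

Lemma perturbed_pos x : 0 < (perturbed y P D).1 x /\ 0 < (perturbed y P D).2 x.
Proof.
rewrite /=; have := wave_gt1 hw y x; have := P_le x; have := D_le x.
by rewrite !ler_norml => /andP[D1 D2] /andP[Q1 Q2] h; have := s8; split; lra.
Qed.

(** The terms of first order cancel because [phi] is a critical point. *)
Lemma lyapunov_expand :
  `|lyapunov (perturbed y P D) - lyapunov Phi
    - (sym_form c l phi y P gP + alt_form c l phi y D gD)|
  <= 18 * s * (itg 0 L (fun x => P x ^+ 2) + itg 0 L (fun x => D x ^+ 2)).
Proof.
have s1 := sobolevD (sobolevD (wave_sobolev y) sP) sD.
have s2 := sobolevB (sobolevD (wave_sobolev y) sP) sD.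
have sF : sobolev L phi phi1.
  have := wave_sobolev 0.
  have -> : f 0 = phi by apply/funext => x; rewrite /wave addr0.
  by have -> : f1 0 = phi1 by apply/funext => x; rewrite /wave1 addr0.
have pos1 x := (perturbed_pos x).1; have pos2 x := (perturbed_pos x).2.
have phi0 x : 0 < phi x by exact: profile_gt0 p.
have cphi := sob_cont sF; have cphi1 := profile_cont1 p.
have cf1 : continuous (f1 y) by exact: wave1_cont hw y.
rewrite (lyapunovE s1 s2 pos1 pos2) (lyapunovE sF sF phi0 phi0).
have qf1 := cont_sq_itgable 0 L cf1; have qP := sob_sq sP; have qD := sob_sq sD.
have qS := sq_itgableD qf1 qP.
rewrite (itg_sqrD qS qD) (itg_sqrB qS qD) (itg_sqrD qf1 qP).
have -> : itg 0 L (fun x => phi1 x ^+ 2) = itg 0 L (fun x => f1 y x ^+ 2).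
  rewrite -(@itg_period _ L (fun x => phi1 x ^+ 2) y) //; first by cont.
  by move=> x; rewrite per1.
have -> : itg 0 L (density phi phi) = itg 0 L (density (f y) (f y)).
  rewrite -(@itg_period _ L (density phi phi) y) //; first exact: density_cont.
  by move=> x; rewrite /density per.
have gi := sq_itgable_itgable qP.
have cfo := @wave_cont_force _ _ _ _ _ _ hw y; have cln := @wave_cont_ln _ _ _ _ _ _ hw y.
have cfo1 := @wave_cont_force1 _ _ _ _ _ _ hw y.
have pf1 : Defs.periodic L (f1 y) by move=> x; rewrite /wave1 addrAC per1.
have pfo : Defs.periodic L (fun x => - force c A (f y x)).
  by move=> x; rewrite (wave_periodic per).
have W := weak_C1 L0 cP gi (sob_weak sP) (wave1_der hw y) (cont_opp cfo) pf1 pfo.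
have E1 : itg 0 L (fun x => f1 y x * gP x) = itg 0 L (fun x => force c A (f y x) * P x).
  apply: oppr_inj; have -> : itg 0 L (fun x => f1 y x * gP x) = itg 0 L (fun x => gP x * f1 y x).
    by apply: eq_itg => x _; rewrite mulrC.
  rewrite -W -itgN; last by apply: cont_itgable; cont.
  by apply: eq_itg => x _; ring.
rewrite E1 /sym_form /alt_form.
have f_pos x : 0 < f y x by exact: wave_gt0 hw y x.
have cd1 := density_cont (sob_cont s1) (sob_cont s2) pos1 pos2.
have cd2 := density_cont cf cf f_pos f_pos.
have cfP : continuous (fun x => force c A (f y x) * P x) by exact: cont_mul cfo cP.
have cP2 : continuous (fun x => P x ^+ 2) by cont.
have cD2 : continuous (fun x => D x ^+ 2) by cont.
have cfP2 : continuous (fun x => force1 c (f y x) * P x ^+ 2) by exact: cont_mul cfo1 cP2.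
have cq : continuous (fun x => c + ln (f y x ^+ 2)) by apply: (cont_add _ cln); exact: cont_cst.
have clD2 : continuous (fun x => (c + ln (f y x ^+ 2)) * D x ^+ 2) by exact: cont_mul cq cD2.
pose rem x := density (perturbed y P D).1 (perturbed y P D).2 x - density (f y) (f y) x
  + 2 * (force c A (f y x) * P x) + force1 c (f y x) * P x ^+ 2
  - (c + ln (f y x ^+ 2)) * D x ^+ 2.
have c2fP : continuous (fun x => 2 * (force c A (f y x) * P x)).
  by apply: cont_mul => //; exact: cont_cst.
have cdd := cont_add cd1 (cont_opp cd2).
have crem : continuous rem.
  by apply: cont_add (cont_opp clD2); apply: cont_add cfP2; exact: cont_add cdd c2fP.
have remE : itg 0 L rem = itg 0 L (density (perturbed y P D).1 (perturbed y P D).2)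
    - itg 0 L (density (f y) (f y)) + 2 * itg 0 L (fun x => force c A (f y x) * P x)
    + itg 0 L (fun x => force1 c (f y x) * P x ^+ 2)
    - itg 0 L (fun x => (c + ln (f y x ^+ 2)) * D x ^+ 2).
  have i1 := cont_itgable 0 L cd1; have i2 := cont_itgable 0 L cd2.
  have i3 := cont_itgable 0 L cfP; have i4 := cont_itgable 0 L cfP2.
  have i5 := cont_itgable 0 L clD2.
  have j1 := itgableB i1 i2; have j2 := itgableD j1 (itgableZ 2 i3).
  by rewrite /rem (itgB (itgableD j2 i4) i5) (itgD j2 i4) (itgD j1 (itgableZ 2 i3)) (itgB i1 i2) itgZ.
have rem_le x : `|rem x| <= 18 * s * (P x ^+ 2 + D x ^+ 2).
  have := potential_expand (wave_gt1 hw y x) (P_le x) (D_le x) s8.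
  rewrite -normrN; congr (`|_| <= _).
  rewrite /rem /density /force /force1 /=.
  move: (f y x) (P x) (D x) (ln _) (potential _ _) (potential _ _) => a b d e f g.
  by field.
have : `|itg 0 L rem| <= 18 * s * (itg 0 L (fun x => P x ^+ 2) + itg 0 L (fun x => D x ^+ 2)).
  rewrite -itgD; [|exact: cont_itgable|exact: cont_itgable].
  rewrite -itgZ; last by apply: cont_itgable; exact: cont_add.
  apply: le_trans (itg_norm_le (cont_itgable 0 L crem)) _; apply: le_itg => //.
    by apply: cont_itgable; exact: cont_norm.
  by apply: cont_itgable; apply: cont_mul; [exact: cont_cst|exact: cont_add].
congr (`|_| <= _); rewrite remE.
move: (itg 0 L (density _ _)) (itg 0 L (density _ _)) => d1 d2.
move: (itg 0 L (fun x => force c A (f y x) * P x)) => d3.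
move: (itg 0 L (fun x => force1 c (f y x) * P x ^+ 2)) => d4.
move: (itg 0 L (fun x => (c + ln (f y x ^+ 2)) * D x ^+ 2)) => d5.
move: (itg 0 L (fun x => f1 y x ^+ 2)) (itg 0 L (fun x => gP x ^+ 2)) => d6 d7.
move: (itg 0 L (fun x => gD x ^+ 2)) (itg 0 L (fun x => (f1 y x + gP x) * gD x)) => d8 d9.
by field.
Qed.

End Perturbation.
End Lyapunov.

(** * Control of perturbations by conserved quantities *)

Section Drift.
Context {R : realType}.
Variables (c A l : R) (phi phi1 : R -> R).
Hypothesis hw : half_wave c A l phi phi1.
Hypothesis even : forall x, phi (- x) = phi x.
Hypothesis per : Defs.periodic (l + l) phi.
Hypothesis per1 : Defs.periodic (l + l) phi1.
Implicit Types (x y s : R) (u v f g h P D : R -> R) (w : (R -> R) * (R -> R)).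
Let l0 : 0 < l. Proof. exact: hw_l hw. Qed.
Let p := hw_profile hw.
Let L := l + l.
Let L0 : 0 < L. Proof. by rewrite addr_gt0. Qed.
Let Phi := (phi, phi).
Local Notation f y := (wave phi y).
Local Notation lyap := (lyapunov c A l).

(** The size of the change, relative to the wave, of the quantities conserved
    by the flow; the means of both components are conserved separately. *)
Definition drift w : R := `|lyap w - lyap Phi|
  + (2^-1 * (itg 0 L w.1 + itg 0 L w.2) - itg 0 L phi) ^+ 2
  + (2^-1 * (itg 0 L w.1 - itg 0 L w.2)) ^+ 2
  + (momentum L w - momentum L Phi) ^+ 2.

Let sq_ge0 g : 0 <= itg 0 L (fun x => g x ^+ 2).
Proof. by apply: itg_ge0 => x _; exact: sqr_ge0. Qed.

Let mean_sq v : continuous v -> itg 0 L v ^+ 2 <= L * itg 0 L (fun x => v x ^+ 2).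
Proof.
move=> cv; have one : continuous (fun _ : R => 1 : R) by exact: cont_cst.
have := sq_itgable_cauchy (cont_sq_itgable 0 L one) (cont_sq_itgable 0 L cv).
have -> : itg 0 L (fun x => 1 * v x) = itg 0 L v by apply: eq_itg => x _; rewrite mul1r.
have -> : itg 0 L (fun _ : R => (1 : R) ^+ 2) = L.
  by rewrite itg_cst ?(ltW L0) // expr1n mul1r subr0.
by [].
Qed.

Section Perturbation.
Variables (y : R) (P gP D gD : R -> R).
Hypothesis sP : sobolev L P gP.
Hypothesis sD : sobolev L D gD.
Let cP := sob_cont sP.
Let cD := sob_cont sD.
Let cf : continuous (f y). Proof. exact: wave_cont hw y. Qed.
Local Notation w := (perturbed phi y P D).

Lemma Xnorm_perturbed : Xnorm L (w - translate y Phi) ^+ 2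
  = 2 * (sobolev_sq l P gP + sobolev_sq l D gD).
Proof.
have -> : w - translate y Phi = (fun x => P x + D x, fun x => P x - D x).
  congr (_, _); apply/funext => x /=.
    by rewrite /wave -[LHS]/(phi (x + y) + P x + D x - phi (x + y)); ring.
  by rewrite /wave -[LHS]/(phi (x + y) + P x - D x - phi (x + y)); ring.
have cc := @cont_sq_itgable R 0 L.
rewrite (@Xnorm_sq _ L L0 (fun x => P x + D x, fun x => P x - D x) _ _ (sobolevD sP sD) (sobolevB sP sD)) /sobolev_sq /=.
rewrite (itg_sqrD (cc _ cP) (cc _ cD)) (itg_sqrB (cc _ cP) (cc _ cD)).
rewrite (itg_sqrD (sob_sq sP) (sob_sq sD)) (itg_sqrB (sob_sq sP) (sob_sq sD)).
rewrite -/L.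
move: (itg 0 L (fun x => P x ^+ 2)) (itg 0 L (fun x => D x ^+ 2)) => a b.
move: (itg 0 L (fun x => gP x ^+ 2)) (itg 0 L (fun x => gD x ^+ 2)) => d e.
by move: (itg 0 L _) (itg 0 L _) => m n; ring.
Qed.

Let wave_mean : itg 0 L (f y) = itg 0 L phi.
Proof. by apply: itg_period => //; exact: profile_cont p. Qed.

Lemma perturbed_mean_sum :
  2^-1 * (itg 0 L w.1 + itg 0 L w.2) - itg 0 L phi = itg 0 L P.
Proof.
have i1 := cont_itgable 0 L cf; have i2 := cont_itgable 0 L cP.
have i3 := cont_itgable 0 L cD; have i4 := itgableD i1 i2.
rewrite /= (itgD i4 i3) (itgB i4 i3) (itgD i1 i2) wave_mean.
by move: (itg 0 L phi) (itg 0 L P) (itg 0 L D) => a b d; field.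
Qed.

Lemma perturbed_mean_diff : 2^-1 * (itg 0 L w.1 - itg 0 L w.2) = itg 0 L D.
Proof.
have i1 := cont_itgable 0 L cf; have i2 := cont_itgable 0 L cP.
have i3 := cont_itgable 0 L cD; have i4 := itgableD i1 i2.
rewrite /= (itgD i4 i3) (itgB i4 i3).
by move: (itg 0 L (fun x => f y x + P x)) (itg 0 L D) => a d; field.
Qed.

Lemma perturbed_momentum : momentum L w - momentum L Phi
  = 2 * itg 0 L (fun x => f y x * P x)
    + (itg 0 L (fun x => P x ^+ 2) + itg 0 L (fun x => D x ^+ 2)).
Proof.
rewrite /momentum !int_perE /=.
have -> : itg 0 L (fun x => phi x ^+ 2 + phi x ^+ 2) = 2 * itg 0 L (fun x => f y x ^+ 2).
  have cphi := profile_cont p.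
  rewrite -(@itg_period _ L (fun x => phi x ^+ 2 + phi x ^+ 2) y) //; last 2 first.
  - by cont.
  - by move=> x; rewrite per.
  by rewrite -itgZ; [apply: eq_itg => x _; rewrite /wave; ring|apply: cont_itgable; cont].
have c1 : continuous (fun x => f y x ^+ 2) by apply: cont_exp.
have c2 : continuous (fun x => f y x * P x) by apply: cont_mul.
have c3 : continuous (fun x => P x ^+ 2) by apply: cont_exp.
have c4 : continuous (fun x => D x ^+ 2) by apply: cont_exp.
have i1 := itgableZ 2 (cont_itgable 0 L c1); have i2 := itgableZ 4 (cont_itgable 0 L c2).
have i3 := itgableZ 2 (cont_itgable 0 L c3); have i4 := itgableZ 2 (cont_itgable 0 L c4).
have -> : itg 0 L (fun x => (f y x + P x + D x) ^+ 2 + (f y x + P x - D x) ^+ 2)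
  = 2 * itg 0 L (fun x => f y x ^+ 2) + 4 * itg 0 L (fun x => f y x * P x)
    + 2 * itg 0 L (fun x => P x ^+ 2) + 2 * itg 0 L (fun x => D x ^+ 2).
  rewrite -!itgZ ?cont_itgable // -(itgD i1 i2) -(itgD (itgableD i1 i2) i3).
  rewrite -(itgD (itgableD (itgableD i1 i2) i3) i4).
  by apply: eq_itg => x _; move: (f y x) (P x) (D x) => a b d; ring.
move: (itg 0 L (fun x => f y x ^+ 2)) (itg 0 L (fun x => f y x * P x)) => a b.
by move: (itg 0 L (fun x => P x ^+ 2)) (itg 0 L (fun x => D x ^+ 2)) => d e; field.
Qed.

End Perturbation.

(** The coercivity of the two forms survives the cubic remainder, since the
    perturbation is uniformly small. The constraint on the momentum determines
    the projection of [P] on the wave up to a quadratic error. *)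
Lemma drift_lower : exists s K, [/\ 0 < s, 0 < K & forall y P gP D gD,
  sobolev L P gP -> sobolev L D gD -> (forall x, `|P x| <= s) ->
  (forall x, `|D x| <= s) -> P (l / 2 - y) = 0 ->
  sobolev_sq l P gP + sobolev_sq l D gD <= K * drift (perturbed phi y P D)].
Proof.
have [K1 [C1 [K10 C10 H1]]] := sym_form_coercive hw even per.
have [K2 [C2 [K20 C20 H2]]] := alt_form_coercive hw per.
pose K := K1 + K2; have K0 : 0 < K by rewrite addr_gt0.
pose B := K * (18 + C1 * L).
have CL0 : 0 <= C1 * L by rewrite mulr_ge0 // ltW.
have B0 : 0 < B by rewrite mulr_gt0 //; lra.
pose s := Num.min 8^-1 ((2 * B)^-1).
have s0 : 0 < s by rewrite lt_min invr_gt0 ltr0n invr_gt0 mulr_gt0.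
have s8 : s <= 8^-1 by rewrite ge_min lexx.
have sB : B * s <= 2^-1.
  have -> : 2^-1 = B * (2 * B)^-1 by field; rewrite gt_eqF.
  by rewrite ler_wpM2l ?(ltW B0) // ge_min lexx orbT.
exists s, (2 * K * (1 + C1 + C2)); split=> //.
  by rewrite mulr_gt0 ?mulr_gt0 //; lra.
move=> y P gP D gD sP sD Ps Ds P0.
have cP := sob_cont sP; have cD := sob_cont sD.
have := lyapunov_expand hw per per1 y sP sD Ps Ds s8.
have := H1 y _ _ sP; have := H2 y _ _ sD; rewrite P0 expr0n /= addr0.
rewrite /drift (perturbed_mean_sum y sP sD) (perturbed_mean_diff y sP sD).
rewrite (perturbed_momentum y sP sD) -/L -/Phi.
set S := itg 0 L (fun x => P x ^+ 2) + itg 0 L (fun x => D x ^+ 2).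
set dL := lyap _ - lyap _; set FP := itg 0 L (fun x => _ * _).
set NP := sobolev_sq l P gP; set ND := sobolev_sq l D gD.
set f1 := sym_form _ _ _ _ _ _; set f2 := alt_form _ _ _ _ _ _.
set mP := itg 0 L P; set mD := itg 0 L D.
move=> h2 h1 h3.
have S0 : 0 <= S by rewrite addr_ge0.
have SN : S <= NP + ND.
  by rewrite /S /NP /ND /sobolev_sq -/L; have := sq_ge0 gP; have := sq_ge0 gD; lra.
have NP0 : 0 <= NP by rewrite addr_ge0.
have ND0 : 0 <= ND by rewrite addr_ge0.
have Sle : S <= 2 * L * s ^+ 2.
  have b v : continuous v -> (forall x, `|v x| <= s) ->
      itg 0 L (fun x => v x ^+ 2) <= L * s ^+ 2.
    move=> cv vs; have -> : L * s ^+ 2 = itg 0 L (fun=> s ^+ 2).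
      by rewrite itg_cst ?(ltW L0) // subr0 mulrC.
    apply: le_itg; [by apply: cont_itgable; exact: cont_exp|by apply: cont_itgable; exact: cont_cst|].
    by move=> x _; rewrite -(@real_normK _ (v x)) ?num_real // ler_pXn2r ?nnegrE // ltW.
  by rewrite /S; have := b P cP Ps; have := b D cD Ds; lra.
have e1 : 0 <= f1 + C1 * (mP ^+ 2 + FP ^+ 2).
  by rewrite -(pmulr_rge0 _ K10); exact: le_trans h1.
have e2 : 0 <= f2 + C2 * mD ^+ 2.
  by rewrite -(pmulr_rge0 _ K20); exact: le_trans h2.
have N1 : NP + ND <= K * (f1 + C1 * (mP ^+ 2 + FP ^+ 2) + (f2 + C2 * mD ^+ 2)).
  have : 0 <= K1 * (f2 + C2 * mD ^+ 2) by rewrite mulr_ge0 // ltW.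
  have : 0 <= K2 * (f1 + C1 * (mP ^+ 2 + FP ^+ 2)) by rewrite mulr_ge0 // ltW.
  move: h1 h2; rewrite /K; set e3 := f1 + _; set e4 := f2 + _.
  have -> : (K1 + K2) * (e3 + e4) = K1 * e3 + K1 * e4 + K2 * e3 + K2 * e4 by ring.
  by lra.
set dF := 2 * FP + S.
have FP2 : FP ^+ 2 <= 2^-1 * (dF ^+ 2 + S ^+ 2).
  have -> : FP = 2^-1 * (dF - S) by rewrite /dF; field.
  by have := sqr_ge0 (dF + S); rewrite exprMn; lra.
have SS : S ^+ 2 <= 2 * L * s * S.
  rewrite expr2 ler_wpM2r //; apply: le_trans Sle _.
  rewrite ler_wpM2l ?mulr_ge0 ?(ltW L0) // expr2.
  by rewrite ler_piMl ?(ltW s0) //; lra.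
have f12 : f1 + f2 <= `|dL| + 18 * s * S.
  move: h3; rewrite ler_norml => /andP[h3 _]; have := ler_norm dL; lra.
have N2 : NP + ND <= K * (`|dL| + C1 * mP ^+ 2 + C2 * mD ^+ 2 + C1 * dF ^+ 2) + B * s * S.
  apply: le_trans N1 _.
  have -> : B * s * S = K * ((18 + C1 * L) * s * S) by rewrite /B; ring.
  rewrite -mulrDr ler_pM2l //.
  have : C1 * FP ^+ 2 <= C1 * (2^-1 * (dF ^+ 2 + 2 * L * s * S)).
    by rewrite ler_wpM2l //; lra.
  have : 0 <= C1 * dF ^+ 2 by rewrite mulr_ge0 ?sqr_ge0.
  by lra.
have : B * s * S <= 2^-1 * S by rewrite ler_wpM2r.
set T := `|dL| + C1 * mP ^+ 2 + C2 * mD ^+ 2 + C1 * dF ^+ 2 in N2 *.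
have TT : T <= (1 + C1 + C2) * (`|dL| + mP ^+ 2 + mD ^+ 2 + dF ^+ 2).
  have q1 : 0 <= `|dL| by []. have q2 := sqr_ge0 mP; have q3 := sqr_ge0 mD.
  have q4 := sqr_ge0 dF.
  rewrite /T; move: q1 q2 q3 q4.
  move: (`|dL|) (mP ^+ 2) (mD ^+ 2) (dF ^+ 2) => a b d e a0 b0 d0 e0.
  have := mulr_ge0 C10 a0; have := mulr_ge0 C10 d0.
  have := mulr_ge0 C20 a0; have := mulr_ge0 C20 b0; have := mulr_ge0 C20 e0.
  by lra.
have : K * T <= K * ((1 + C1 + C2) * (`|dL| + mP ^+ 2 + mD ^+ 2 + dF ^+ 2)).
  by rewrite ler_pM2l.
set Y := `|dL| + _ + _ + _.
have -> : 2 * K * (1 + C1 + C2) * Y = 2 * (K * ((1 + C1 + C2) * Y)) by ring.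
by lra.
Qed.

Lemma drift_upper : exists2 K, 0 < K & forall y P gP D gD,
  sobolev L P gP -> sobolev L D gD -> (forall x, `|P x| <= 8^-1) ->
  (forall x, `|D x| <= 8^-1) -> sobolev_sq l P gP + sobolev_sq l D gD <= 1 ->
  drift (perturbed phi y P D) <= K * (sobolev_sq l P gP + sobolev_sq l D gD).
Proof.
have [K1 K10 H1] := sym_form_bounded hw per.
have [K2 K20 H2] := alt_form_bounded hw per.
pose J := itg 0 L (fun x => phi x ^+ 2).
have J0 : 0 <= J by exact: sq_ge0.
have Lpos : 0 < L := L0.
exists (K1 + K2 + 3 + 2 * L + (8 * J + 2)); first by lra.
move=> y P gP D gD sP sD P8 D8.
have cP := sob_cont sP; have cD := sob_cont sD.
have := lyapunov_expand hw per per1 y sP sD P8 D8 (lexx _).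
have := H1 y _ _ sP; have := H2 y _ _ sD.
rewrite /drift (perturbed_mean_sum y sP sD) (perturbed_mean_diff y sP sD).
rewrite (perturbed_momentum y sP sD) -/L -/Phi.
have := mean_sq cP; have := mean_sq cD.
have cf : continuous (f y) by exact: wave_cont hw y.
have := sq_itgable_cauchy (cont_sq_itgable 0 L cf) (cont_sq_itgable 0 L cP).
have -> : itg 0 L (fun x => f y x ^+ 2) = J.
  have cphi := profile_cont p.
  by rewrite /J -(@itg_period _ L (fun x => phi x ^+ 2) y) //; [cont|move=> x; rewrite per].
set SP := itg 0 L (fun x => P x ^+ 2); set SD := itg 0 L (fun x => D x ^+ 2).
set dL := lyap _ - lyap _; set FP := itg 0 L (fun x => _ * _).
have SP0 : 0 <= SP by exact: sq_ge0.
have SD0 : 0 <= SD by exact: sq_ge0.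
have hP : SP <= sobolev_sq l P gP by rewrite lerDl sq_ge0.
have hD : SD <= sobolev_sq l D gD by rewrite lerDl sq_ge0.
move: hP hD; move: (sobolev_sq l P gP) (sobolev_sq l D gD) => NP ND hP hD.
move: (itg 0 L P) (itg 0 L D) (sym_form _ _ _ _ _ _) (alt_form _ _ _ _ _ _) => mP mD f1 f2.
move=> hF hmD hmP h2 h1 h3 N1.
set N := NP + ND in N1 *.
have N0 : 0 <= N by rewrite /N; lra.
have dLN : `|dL| <= (K1 + K2 + 3) * N.
  have -> : dL = (dL - (f1 + f2)) + f1 + f2 by ring.
  apply: le_trans (ler_normD _ _) _.
  have := ler_normD (dL - (f1 + f2)) f1.
  have : 0 <= K1 * ND by rewrite mulr_ge0 ?(ltW K10) //; lra.
  have : 0 <= K2 * NP by rewrite mulr_ge0 ?(ltW K20) //; lra.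
  by rewrite /N; lra.
have S2 : (SP + SD) ^+ 2 <= N.
  apply: le_trans (_ : N * N <= _); last by rewrite ler_piMl.
  by rewrite expr2 ler_pM ?addr_ge0 //; rewrite /N; lra.
have JN : J * SP <= J * N by rewrite ler_wpM2l // /N; lra.
have LN : L * SP + L * SD <= L * N by rewrite -mulrDr ler_pM2l // /N; lra.
have := sqr_ge0 (2 * FP - (SP + SD)).
have LN0 : 0 <= L * N by rewrite mulr_ge0 ?(ltW Lpos).
by lra.
Qed.

End Drift.

(** * Orbital stability *)

Section Stability.
Context {R : realType}.
Variables (c A l : R) (phi phi1 : R -> R).
Hypothesis hw : half_wave c A l phi phi1.
Hypothesis even : forall x, phi (- x) = phi x.
Hypothesis per : Defs.periodic (l + l) phi.
Hypothesis per1 : Defs.periodic (l + l) phi1.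
Implicit Types (x y z s t e : R) (f g h P D : R -> R) (w : (R -> R) * (R -> R)).
Let l0 : 0 < l. Proof. exact: hw_l hw. Qed.
Let p := hw_profile hw.
Let L := l + l.
Let L0 : 0 < L. Proof. by rewrite addr_gt0. Qed.
Let Phi := (phi, phi).

Let waveX y : Xper L (translate y Phi).
Proof. by split; exact: sobolev_H1per (wave_sobolev hw per per1 y). Qed.

Let rho_lt w e : rho L w Phi < e -> exists y, Xnorm L (w - translate y Phi) < e.
Proof.
move=> /inf_lt[]; first by exists (Xnorm L (w - translate 0 Phi)), 0.
by move=> _ [y _ <-] h; exists y.
Qed.

Let rho_le w y : rho L w Phi <= Xnorm L (w - translate y Phi).
Proof.
apply: ge_inf; last by exists y.
by exists 0 => _ [z _ <-]; exact: Xnorm_ge0.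
Qed.

(** ** Symmetric and antisymmetric deviations *)

Definition sym_dev y w x : R := 2^-1 * (w.1 x + w.2 x) - wave phi y x.
Definition alt_dev w x : R := 2^-1 * (w.1 x - w.2 x).

Lemma dev_perturbed y w : perturbed phi y (sym_dev y w) (alt_dev w) = w.
Proof.
case: w => u v; rewrite /perturbed /sym_dev /alt_dev /=.
by congr (_, _); apply/funext => x; move: (u x) (v x) (wave phi y x) => *; field.
Qed.

Lemma dev_sobolev y w : Xper L w -> exists gP gD,
  sobolev L (sym_dev y w) gP /\ sobolev L (alt_dev w) gD.
Proof.
move=> /Xper_sobolev[s1 s2]; have sw := wave_sobolev hw per per1 y.
have sP := sobolevB (sobolevZ 2^-1 (sobolevD s1 s2)) sw.
have sD := sobolevZ 2^-1 (sobolevB s1 s2).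
by eexists; eexists; split; [exact: sP|exact: sD].
Qed.

Lemma dev_small s y w : Xper L w -> Xnorm L (w - translate y Phi) < s / (L^-1 + 1) ->
  (forall x, `|sym_dev y w x| <= s) /\ (forall x, `|alt_dev w x| <= s).
Proof.
move=> Xw; set k := L^-1 + 1; have [gP [gD [sP sD]]] := dev_sobolev y Xw.
have k1 : 1 <= k by rewrite lerDr invr_ge0 ltW.
have k0 : 0 < k by exact: lt_le_trans k1.
have := Xnorm_perturbed hw y sP sD; rewrite dev_perturbed => E hs.
have X0 := Xnorm_ge0 L (w - translate y Phi).
have s0 : 0 < s by have := le_lt_trans X0 hs; rewrite pmulr_lgt0 ?invr_gt0.
have h2 : Xnorm L (w - translate y Phi) ^+ 2 <= s ^+ 2 / k ^+ 2.
  by rewrite -expr_div_n ler_pXn2r ?nnegrE ?(ltW hs) ?divr_ge0 ?(ltW s0) ?(ltW k0).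
have bound v g x : sobolev L v g ->
    2 * sobolev_sq l v g <= Xnorm L (w - translate y Phi) ^+ 2 -> `|v x| <= s.
  move=> sv hv; have := sobolev_sup L0 x sv; rewrite -/k => h.
  have G0 : 0 <= itg 0 L (fun x => g x ^+ 2) by apply: itg_ge0 => t _; exact: sqr_ge0.
  have V0 : 0 <= itg 0 L (fun x => v x ^+ 2) by apply: itg_ge0 => t _; exact: sqr_ge0.
  have kG : itg 0 L (fun x => g x ^+ 2) <= k * itg 0 L (fun x => g x ^+ 2).
    by rewrite ler_peMl.
  have h3 : v x ^+ 2 <= k * sobolev_sq l v g by rewrite mulrDr -/L; lra.
  have h4 : k * (2 * sobolev_sq l v g) <= k * (s ^+ 2 / k ^+ 2).
    by rewrite ler_pM2l //; exact: le_trans h2.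
  have h5 : k * (s ^+ 2 / k ^+ 2) <= s ^+ 2.
    have -> : k * (s ^+ 2 / k ^+ 2) = s ^+ 2 / k by field; rewrite gt_eqF.
    by rewrite ler_pdivrMr // ler_peMr ?sqr_ge0.
  have N0 : 0 <= k * sobolev_sq l v g by exact: mulr_ge0 (ltW k0) (addr_ge0 V0 G0).
  rewrite -(ler_pXn2r (n := 2)) ?nnegrE ?(ltW s0) // real_normK ?num_real //.
  by move: h3 h4 h5 N0; rewrite mulrCA; move: (k * sobolev_sq l v g) => * ; lra.
have NP0 : 0 <= sobolev_sq l (sym_dev y w) gP.
  by rewrite addr_ge0 //; apply: itg_ge0 => t _; exact: sqr_ge0.
have ND0 : 0 <= sobolev_sq l (alt_dev w) gD.
  by rewrite addr_ge0 //; apply: itg_ge0 => t _; exact: sqr_ge0.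
split=> x; [apply: (bound _ gP) => //|apply: (bound _ gD) => //].
  by rewrite E; move: NP0 ND0; move: (sobolev_sq _ _ _) (sobolev_sq _ _ _) => *; lra.
by rewrite E; move: NP0 ND0; move: (sobolev_sq _ _ _) (sobolev_sq _ _ _) => *; lra.
Qed.

(** ** Modulation *)

Let wave_lipschitz : exists2 M, 0 < M & forall x z, `|phi x - phi z| <= M * `|x - z|.
Proof.
have [M M0 hM] := periodic_bounded L0 per1 (profile_cont1 p); exists M => //.
have lip x z : x < z -> `|phi x - phi z| <= M * `|x - z|.
  move=> xz; have [t _ E] := mean_value xz (fun t _ => pr_der p t).
  by rewrite distrC E normrM [`|x - z|]distrC ler_wpM2r.
move=> x z; case: (ltgtP x z) => [/lip //|zx|->]; last by rewrite !subrr normr0 mulr0.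
by rewrite distrC [`|x - z|]distrC lip.
Qed.

Let wave_straddle t : 0 < t -> t < l / 2 -> let d := phi l - phi 0 in
  0 < d * (phi (l / 2) - phi (l / 2 - t)) /\ 0 < d * (phi (l / 2 + t) - phi (l / 2)).
Proof.
move=> t0 tl d; have lpos : 0 < l := l0.
have dd z : has_deriv (fun z => d * phi z) z (d * phi1 z).
  by have ? := pr_der p z; apply: der_eq; [der|rewrite /=; ring].
have incr a b : 0 < a -> a < b -> b < l -> 0 < d * (phi b - phi a).
  move=> a0 ab bl; rewrite mulrBr subr_gt0.
  apply: (@der_gt0_lt _ a b (fun z => d * phi z) _ ab (fun z _ => dd z)) => z /andP[az zb].
  by apply: (hw_mono hw); apply/andP; split; lra.
by split; apply: incr; lra.
Qed.

(** A function close to a translate of the wave takes the value [phi (l / 2)]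
    near the corresponding point, where the wave crosses it transversally. *)
Lemma modulation s : 0 < s -> exists2 e, 0 < e & forall w, Xper L w -> rho L w Phi < e ->
  exists y, [/\ forall x, `|sym_dev y w x| <= s, forall x, `|alt_dev w x| <= s
    & sym_dev y w (l / 2 - y) = 0].
Proof.
move=> s0; have lpos : 0 < l := l0.
have [M M0 lip] := wave_lipschitz.
pose t := Num.min (l / 4) (s / (2 * M)).
have t0 : 0 < t by rewrite lt_min !divr_gt0 ?mulr_gt0.
have tl : t < l / 2 by rewrite gt_min; apply/orP; left; lra.
have tM : M * t <= s / 2.
  have -> : s / 2 = M * (s / (2 * M)) by field; rewrite gt_eqF.
  by rewrite ler_pM2l // ge_min lexx orbT.
have [] := wave_straddle t0 tl; set d := phi l - phi 0.
set a := phi (l / 2 - t); set b := phi (l / 2); set k := phi (l / 2 + t) => hab hbk.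
have ab0 : 0 < `|b - a| by rewrite normr_gt0; apply: contraTneq hab => ->; rewrite mulr0 ltxx.
have bk0 : 0 < `|k - b| by rewrite normr_gt0; apply: contraTneq hbk => ->; rewrite mulr0 ltxx.
pose r := Num.min (s / 2) (Num.min `|b - a| `|k - b|).
have r0 : 0 < r by rewrite !lt_min ab0 bk0 divr_gt0.
have rs : r <= s / 2 by rewrite ge_min lexx.
have ra : r <= `|b - a| by rewrite !ge_min lexx !orbT.
have rk : r <= `|k - b| by rewrite !ge_min lexx !orbT.
have k0 : 0 < L^-1 + 1 by rewrite addr_gt0 ?invr_gt0.
exists (r / (L^-1 + 1)); first by rewrite divr_gt0.
move=> w Xw /rho_lt[y0 /(dev_small Xw)[hP hD]].
have [[_ c1 _] [_ c2 _]] := Xw.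
pose q x := 2^-1 * (w.1 x + w.2 x).
have cq : continuous q by rewrite /q; cont.
pose z0 := l / 2 - y0.
have near_q z : `|q (z - y0) - phi z| <= r.
  by have := hP (z - y0); rewrite /sym_dev /wave subrK.
have qa := near_q (l / 2 - t); have qk := near_q (l / 2 + t).
rewrite -/a -/k in qa qk.
have [z /andP[z1 z2] qz] : exists2 z, l / 2 - t - y0 <= z <= l / 2 + t - y0 & q z = b.
  apply: intermediate; [by lra|by move=> x _; exact: cq|].
  move: qa qk ra rk; rewrite !ler_norml => /andP[q1 q2] /andP[q3 q4].
  have [d0|d0|d0] := ltgtP 0 d; last by move: hab; rewrite -d0 mul0r ltxx.
    move: hab hbk; rewrite !pmulr_rgt0 // => h1 h2.
    by rewrite !gtr0_norm // => h3 h4; apply/orP; left; apply/andP; split; lra.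
  move: hab hbk; rewrite !nmulr_rgt0 // => h1 h2.
  by rewrite !ltr0_norm // => h3 h4; apply/orP; right; apply/andP; split; lra.
exists (l / 2 - z).
have yE : l / 2 - (l / 2 - z) = z by ring.
split; last by rewrite yE /sym_dev -/(q z) qz /wave (_ : z + (l / 2 - z) = l / 2) ?subrr //; ring.
  move=> x; have -> : sym_dev (l / 2 - z) w x
      = sym_dev y0 w x + (phi (x + y0) - phi (x + (l / 2 - z))).
    by rewrite /sym_dev /wave; ring.
  apply: le_trans (ler_normD _ _) _; have := hP x.
  have := lip (x + y0) (x + (l / 2 - z)).
  have : M * `|x + y0 - (x + (l / 2 - z))| <= M * t.
    by rewrite ler_pM2l // ler_norml; apply/andP; split; lra.
  by lra.
by move=> x; have := hD x; lra.
Qed.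

(** ** The bootstrap argument *)

Let one_test : test_fun L (fun _ : R => 1 : R).
Proof. by apply: (trig_test L0); exact: trig_cst. Qed.

(** Testing the equations with constants: both means are conserved. *)
Let mean_conserved (v z : R -> R -> R) t : weak_equation L v z -> 0 <= t ->
  itg 0 L (v t) = itg 0 L (v 0).
Proof.
move=> [_ /(_ _ one_test t)] h /h; rewrite !int_perE.
have d1 : derive1 (fun _ : R => 1 : R) = (fun=> 0).
  by apply/funext => x; apply: der_derive1; exact: der_cst.
have d0 : derive1 (fun _ : R => 0 : R) = (fun=> 0).
  by apply/funext => x; apply: der_derive1; exact: der_cst.
have -> : derive1n 3 (fun _ : R => 1 : R) = (fun=> 0) by rewrite /derive1n /= d1 !d0.
rewrite d1.
have e f : itg 0 L (fun x => f x * 1) = itg 0 L f by apply: eq_itg => x _; rewrite mulr1.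
rewrite !e => E; apply/eqP; rewrite -subr_eq0 E; apply/eqP.
have z0 : forall k, itg 0 k (fun=> 0 : R) = 0 by move=> k; rewrite /itg Rintegral_cst // mul0r.
rewrite -[RHS](z0 t); apply: eq_itg => r _; rewrite int_perE -[RHS](z0 L).
by apply: eq_itg => x _; rewrite !mulr0 addr0.
Qed.

Let drift_conserved w u t : conserved L (energy L) -> conserved L (momentum L) ->
  conserved L (mass L) -> solution L w u -> 0 <= t ->
  drift c A l phi (u t) = drift c A l phi w.
Proof.
move=> hE hF hM su t0; have [_ u0 _ eq1 eq2] := su.
rewrite /drift /lyapunov (hE _ _ su _ t0) (hF _ _ su _ t0) (hM _ _ su _ t0).
by rewrite (mean_conserved eq1 t0) (mean_conserved eq2 t0) u0.
Qed.

(** Negative times are folded back, to have a function continuous on the whole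
    line. *)
Let rho_continuous w u : solution L w u -> continuous (fun t : R => rho L (u `|t|) Phi : R).
Proof.
move=> su t; have Xu (r : R) : Xper L (u `|r|) by exact: (sol_mem su (normr_ge0 r)).
apply/cvgrPdist_le => /= e e0.
have cu := sol_continuous su (normr_ge0 t).
have : \forall s \near t, Xnorm L (u `|s| - u `|t|) < e / 2.
  have /cvgrPdist_lt /(_ (e / 2)) := cu; rewrite divr_gt0 // => /(_ isT).
  rewrite /= near_withinE => h.
  have nc : `|s| @[s --> t] --> `|t| by apply: cvg_norm; exact: cvg_id.
  have hs : \forall s \near t, 0 <= `|s| ->
      `|0 - Xnorm L (u `|s| - u `|t|)| < e / 2 by exact: nc _ h.
  apply: filterS hs => s /(_ (normr_ge0 s)).
  by rewrite sub0r normrN ger0_norm ?Xnorm_ge0.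
apply: filterS => s hs.
have step a b : Xper L a -> Xper L b -> Xnorm L (b - a) < e / 2 ->
    rho L b Phi <= rho L a Phi + e.
  move=> Xa Xb hab; have e2 : rho L a Phi < rho L a Phi + e / 2 by rewrite ltrDl divr_gt0.
  have [y hy] := rho_lt e2; apply: le_trans (rho_le b y) _.
  have -> : b - translate y Phi = (b - a) + (a - translate y Phi) by rewrite addrA subrK.
  have -> : rho L a Phi + e = e / 2 + (rho L a Phi + e / 2).
    by rewrite addrCA -splitr.
  exact: ltW (Xnorm_triangle L0 (XperB Xb Xa) (XperB Xa (waveX y)) hab hy).
have h1 := step _ _ (Xu t) (Xu s) hs.
have h2 : rho L (u `|t|) Phi <= rho L (u `|s|) Phi + e.
  apply: (step _ _ (Xu s) (Xu t)).
  by rewrite -[u `|t| - _]opprB (Xnorm_opp L0 (XperB (Xu s) (Xu t))).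
move: h1 h2; move: (rho L (u `|s|) Phi) (rho L (u `|t|) Phi) => a b h1 h2.
by rewrite ler_norml; apply/andP; split; lra.
Qed.

(** As long as the distance to the orbit is below the threshold of [modulation],
    conservation of [drift] and [drift_lower] bound it by a smaller number [r].
    Being continuous in time and small initially, it can never reach [r]. *)
Lemma half_wave_stable : globally_well_posed L -> conserved L (energy L) ->
  conserved L (momentum L) -> conserved L (mass L) -> orbitally_stable L Phi.
Proof.
move=> wp hE hF hM e e0.
have [s [K1 [s0 K10 lower]]] := drift_lower hw even per per1.
have [K2 K20 upper] := drift_upper hw per per1.
have [e1 e10 modul] := modulation s0.
pose r := Num.min e (e1 / 2).
have r0 : 0 < r by rewrite lt_min e0 divr_gt0.
have improve w : Xper L w -> rho L w Phi < e1 ->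
    2 * (K1 * drift c A l phi w) < r ^+ 2 -> rho L w Phi < r.
  move=> Xw hw1 hd; have [y [hP hD h0]] := modul w Xw hw1.
  have [gP [gD [sP sD]]] := dev_sobolev y Xw.
  have := lower y _ _ _ _ sP sD hP hD h0; rewrite dev_perturbed => hN.
  have := Xnorm_perturbed hw y sP sD; rewrite dev_perturbed => E.
  apply: le_lt_trans (rho_le w y) _.
  rewrite -(ltr_pXn2r (n := 2)) ?nnegrE ?Xnorm_ge0 ?(ltW r0) //.
  apply: le_lt_trans hd; rewrite [X in X <= _]E ler_pM2l //.
have k0 : 0 < L^-1 + 1 by rewrite addr_gt0 ?invr_gt0.
pose m := r ^+ 2 / (2 * K1 * K2).
have m0 : 0 < m by rewrite divr_gt0 ?exprn_gt0 ?mulr_gt0.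
pose d := Num.min (8^-1 / (L^-1 + 1)) (Num.min 1 (Num.min r m)).
have d0 : 0 < d by rewrite lt_min divr_gt0 //= lt_min ltr01 /= lt_min r0 m0.
have d8 : d <= 8^-1 / (L^-1 + 1) by rewrite ge_min lexx.
have d1 : d <= 1 by rewrite 2!ge_min lexx !orbT.
have dr : d <= r by rewrite 3!ge_min lexx !orbT.
have dm : d <= m by rewrite 3!ge_min lexx !orbT.
exists d => // w Xw hw0; split; first exact: (gwp_existence wp Xw).
have tr0 : translate 0 Phi = Phi by rewrite /translate /=; congr (_, _); apply/funext => x; rewrite addr0.
rewrite -tr0 in hw0.
have small : 2 * (K1 * drift c A l phi w) < r ^+ 2.
  have [hP hD] := dev_small Xw (lt_le_trans hw0 d8).
  have [gP [gD [sP sD]]] := dev_sobolev 0 Xw.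
  have := Xnorm_perturbed hw 0 sP sD; have := upper 0 _ _ _ _ sP sD hP hD.
  rewrite dev_perturbed; move: (sobolev_sq _ _ _ + _) => N hN E.
  have X2 : Xnorm L (w - translate 0 Phi) ^+ 2 < d.
    apply: lt_le_trans (_ : d * d <= _); last by rewrite ler_piMl // ltW.
    by rewrite -expr2 ltr_pXn2r ?nnegrE ?Xnorm_ge0 ?(ltW d0).
  rewrite [X in X < _]E in X2.
  have N1 : N <= 1 by lra.
  have hd := hN N1.
  have : K1 * drift c A l phi w <= K1 * (K2 * N) by rewrite ler_pM2l.
  have : K1 * K2 * (2 * N) < K1 * K2 * m.
    by rewrite ltr_pM2l ?mulr_gt0 //; lra.
  have -> : K1 * K2 * m = r ^+ 2 / 2 by rewrite /m; field; rewrite !gt_eqF.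
  have := exprn_gt0 2 r0.
  by rewrite !mulrA; lra.
move=> u su t t0; have [hmem u0 _ _ _] := su.
rewrite ltNge; apply/negP => ht.
have cr := rho_continuous su.
have re : r <= e by rewrite ge_min lexx.
have r1 : r < e1 by rewrite gt_min; apply/orP; right; lra.
have [t1 /andP[t10 _] h1] : exists2 t1, 0 <= t1 <= t & rho L (u `|t1|) Phi = r.
  apply: (@intermediate _ 0 t (fun t : R => rho L (u `|t|) Phi)) => //.
    by move=> x _; exact: cr.
  apply/orP; left; rewrite normr0 u0 (ger0_norm t0) (le_trans re ht) andbT.
  apply: le_trans (rho_le w 0) _; exact: le_trans (ltW hw0) dr.
have := improve (u `|t1|) (hmem _ (normr_ge0 _)).
rewrite (drift_conserved hE hF hM su (normr_ge0 _)) h1 => /(_ r1 small).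
by rewrite ltxx.
Qed.

End Stability.

Unset Implicit Arguments.
Set Strict Implicit.
Set Printing Implicit Defensive.

Theorem theorem3p10 (R : realType) (c0 A0 L0 : R) (O : set (R * R))
    (phi : R * R -> R -> R)
    (h_params : (P1 `|` P2) (c0, A0))
    (h_family : wave_family c0 A0 L0 O phi)
    (h_A0 : 0 < A0)
    (h_large : forall p : R * R, O p -> forall x : R, 1 < phi p x)
    (h_wp : globally_well_posed L0)
    (h_energy : conserved L0 (energy L0))
    (h_momentum : conserved L0 (momentum L0))
    (h_mass : conserved L0 (mass L0)) :
  forall c A : R, O (c, A) ->
    orbitally_stable L0 (phi (c, A), phi (c, A)).
Proof.
move=> c A Oc; have gt1 := h_large _ Oc; have even := wf_even h_family Oc.
have period := wf_period h_family Oc; have eqn := wf_equation h_family Oc.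
move: gt1 even period eqn; move: (phi (c, A)) => f gt1 even period eqn.
have prof : profile c A f (derive1 f).
  split=> // x; have [d1 d2 e] := eqn x; first exact: der_of_derivable.
  apply: der_eq (der_of_derivable d2) _; move: e.
  rewrite /derive1n /= /force; move: (derive1 (derive1 f) x) (f x) (ln _) => a b d e.
  by apply/eqP; rewrite -subr_eq0 -oppr_eq0 -e; apply/eqP; ring.
have [hw [per1 _]] := even_profile_half_wave prof period even.
have [_ per _] := period.
have L0E : L0 = L0 / 2 + L0 / 2 by rewrite -splitr.
rewrite L0E in per per1 h_wp h_energy h_momentum h_mass *.
exact: half_wave_stable hw even per per1 h_wp h_energy h_momentum h_mass.
Qed.
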